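(* Let $\mathfrak s$ be a symmetry jet on a manifold $M$, let $\nabla=\nabla^{\mathfrak s}$ with torsion $T^\nabla$. Let $\xi\in\mathcal B^{(1)}$ and suppose that $S(\xi)$ is holonomic. Put $x=\alpha(\xi)$, let $X_x,Y_x,Z_x\in T_xM$ extend to vector fields $X,Y,Z$, and let $\mathfrak X=X_{**_{Y_x}}Y_{*_x}Z_x\in T^3M$. Then $$\Pi\bigl(\mathbb S(\xi)\cdot\mathfrak X,\;\kappa_*(\mathbb S(\xi))\cdot\mathfrak X\bigr)=\xi\Bigl((\nabla_{Z_x}T^\nabla)(Y_x,X_x)\Bigr)-\bigl(\nabla_{\xi Z_x}T^\nabla\bigr)(\xi Y_x,\xi X_x).$$
   Context: All objects are smooth. $\mathcal B^{(1)}$ is the Lie groupoid over $M$ of linear isomorphisms $\xi:T_xM\to T_yM$, source $\alpha(\xi)=x$, target $\beta(\xi)=y$; $-I_x=-\mathrm{id}_{T_xM}$. A local bisection of a Lie groupoid $G\rightrightarrows M$ is a section $b:U\to G$ of $\alpha$ over an open $U$ with $b^0:=\beta\circ b$ a diffeomorphism onto an open set; the $1$-jets $j^1_xb$ of local bisections of $G$ form a Lie groupoid over $M$. $\mathcal B^{(1,1)}_{nh}$ (resp. $\mathcal B^{(1,1,1)}_{nh}$) is the groupoid of $1$-jets of local bisections of $\mathcal B^{(1)}$ (resp. of $\mathcal B^{(1,1)}_{nh}$). On $\mathcal B^{(1,1)}_{nh}$: $p(j^1_xb)=b(x)$, $p_*(j^1_xb)=(b^0)_{*_x}$; $\mathcal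 B^{(1,1)}_{sh}=\{p=p_*\}$. On $\mathcal B^{(1,1,1)}_{nh}$: $p(j^1_xb)=b(x)$, $p_*(j^1_xb)=j^1_x(p\circ b)$, $p_{**}(j^1_xb)=j^1_x(p_*\circ b)$; $\mathcal B^{(1,1,1)}=\{p=p_*=p_{**}\in\mathcal B^{(1,1)}_{sh}\}$. A $(1,1)$-jet is holonomic if it is the $2$-jet $j^2_xf=j^1_x(x'\mapsto f_{*_{x'}})$ of a local diffeomorphism. A symmetry jet is a smooth section $\mathfrak s:M\to\mathcal B^{(1,1)}_{sh}$, $\mathfrak s(x)$ being a jet at $x$ with $p(\mathfrak s(x))=-I_x$. With $(bY)_{b^0(x')}=b(x')Y_{x'}$, $(\nabla^{\mathfrak s}_XY)_x=\frac12[X,Y+s_xY]_x$ where $\mathfrak s(x)=j^1_xs_x$. Each $\xi\in\mathcal B^{(1)}$ with $\alpha(\xi)=x$ has a unique extension $S(\xi)=j^1_xa\in\mathcal B^{(1,1)}_{sh}$ with $p(S(\xi))=\xi$ that is affine: $\xi(\nabla_{X_x}Y)=\nabla_{\xi X_x}(aY)$ for all $X_x,Y$. $\mathbb S(\xi)=j^1_x(S\circ a)\in\mathcal B^{(1,1,1)}$, for any such $a$. Iterated tangent bundles: $T^kM=T(T^{k-1}M)$; $Y_*:TM\to T^2M$ is the differential of $Y:M\to TM$, and $X_{**}:T^2M\to T^3M$ the second differential of $X:M\to TM$. $j^1_xb\in\mathcal B^{(1,1)}_{nh}$ acts on $T^2M$ over $x$ by $j^1_xb\cdot\frac{dX_t}{dt}|_0=\frac{d}{dt}(b(x_t)X_t)|_0$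 ($X_t\in T_{x_t}M$), and $j^1_xb\in\mathcal B^{(1,1,1)}_{nh}$ acts on $T^3M$ over $x$ by $j^1_xb\cdot\frac{d\mathcal Z_t}{dt}|_0=\frac{d}{dt}(b(x_t)\cdot\mathcal Z_t)|_0$ ($\mathcal Z_t\in T^2M$ over $x_t$). $\kappa:T^2M\to T^2M$ is the canonical involution, $(x,X,Y,V)\mapsto(x,Y,X,V)$ in induced coordinates (vector with components $(Y,V)$ at $(x,X)$); $\kappa_*:T^3M\to T^3M$ is its differential. $\kappa_*(\eta)$, for $\eta\in\mathcal B^{(1,1,1)}$, is the element of $\mathcal B^{(1,1,1)}_{nh}$ determined by $\kappa_*(\eta)\cdot\mathfrak X=\kappa_*(\eta\cdot\kappa_*(\mathfrak X))$. $T^3M$ has three projections to $T^2M$: $p$ (canonical), $p_*$ (differential of the canonical projection $T^2M\to TM$), $p_{**}$ (second differential of $TM\to M$). If two elements of $T^3M$ over a point $y$ have the same images under $p,p_*,p_{**}$, then in the coordinates induced by a chart of $M$ they differ only in the last $n=\dim M$ coordinates; $\Pi(\mathfrak X_1,\mathfrak X_2)\in T_yM$ is the (chart-independent) vector whose components are the difference (first minus second) of these. $T^\nabla(X,Y)=\nabla_XY-\nabla_YX-[X,Y]$. *)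

(* Defs.v *)
From HB Require Import structures.
From mathcomp Require Import all_boot all_order all_algebra.
From mathcomp Require Import all_classical all_reals all_analysis.

Set Implicit Arguments.
Unset Strict Implicit.
Unset Printing Implicit Defensive.

Import Order.TTheory GRing.Theory Num.Theory.
Import numFieldNormedType.Exports.

Local Open Scope classical_set_scope.
Local Open Scope ring_scope.

(* For finite-dimensional V and W, f is C^(k+1) on the open set O iff it is   *)
(* differentiable on O and (x, v) |-> (f x, Df(x) v) is C^k on O * V.         *)
Fixpoint Ck_on (R : realType) (k : nat) {struct k} :
    forall V W : normedModType R, set V -> (V -> W) -> Prop :=
  match k with
  | 0 => fun V W O f => forall x, O x -> {for x, continuous f}
  | k'.+1 => fun V W O f =>
      (forall x, O x -> differentiable f x) /\
      @Ck_on R k' (V * V)%type (W * W)%type (O `*` setT)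
        (fun z => (f z.1, 'd f (z.1) z.2))
  end.

Definition smooth_on (R : realType) (V W : normedModType R)
    (O : set V) (f : V -> W) : Prop :=
  forall k, @Ck_on R k V W O f.

(* The data of an atlas with a preferred chart at each point; the axioms are  *)
(* imposed on the base manifold only (record manifold), its iterated tangent  *)
(* bundles inherit them. chi i is the inverse of the chart phi i.             *)
Record charted (R : realType) := Charted {
  pt :> Type;
  model : normedModType R;
  idx : Type;
  dom : idx -> set pt;
  phi : idx -> pt -> model;
  chi : idx -> model -> pt;
  at_ : pt -> idx
}.
Arguments at_ {R c}.
Arguments phi {R c}.
Arguments chi {R c}.
Arguments dom {R c}.

Record manifold (R : realType) (n : nat) := Manifold {
  mspace :> topologicalType;
  midx : Type;
  mdom : midx -> set mspace;
  mphi : midx -> mspace -> 'rV[R]_n;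
  mchi : midx -> 'rV[R]_n -> mspace;
  mat_ : mspace -> midx;
  mhausdorff : hausdorff_space mspace;
  mcountable : @second_countable mspace;
  mat_dom : forall x, mdom (mat_ x) x;
  mdom_open : forall i, open (mdom i);
  mphi_open : forall i, open (mphi i @` mdom i);
  mphiK : forall i x, mdom i x -> mchi i (mphi i x) = x;
  mphi_continuous : forall i x, mdom i x -> {for x, continuous (mphi i)};
  mchi_continuous : forall i u, (mphi i @` mdom i) u ->
    {for u, continuous (mchi i)};
  mtransition : forall i j,
    smooth_on (mphi i @` (mdom i `&` mdom j)) (mphi j \o mchi i)
}.

Section Charted.
Variable R : realType.
Implicit Types N P : charted R.

Definition smooth_at N P (f : N -> P) (z : N) : Prop :=
  exists O : set (model N),
    [/\ open O, O (phi (at_ z) z), O `<=` phi (at_ z) @` dom (at_ z),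
        (forall u, O u -> dom (at_ (f z)) (f (chi (at_ z) u)))
      & smooth_on O (phi (at_ (f z)) \o f \o chi (at_ z))].

(* A tangent vector at x is the pair of x and of its components in the        *)
(* preferred chart at x. A chart i of N induces the chart (phi_i, d phi_i).   *)
Definition Tan N : charted R :=
  @Charted R (N * model N)%type (model N * model N)%type (idx N)
    (fun i => [set z | dom i z.1])
    (fun i z =>
       (phi i z.1, 'd (phi i \o chi (at_ z.1)) (phi (at_ z.1) z.1) z.2))
    (fun i u =>
       (chi i u.1, 'd (phi (at_ (chi i u.1)) \o chi i) (u.1) u.2))
    (fun z => at_ z.1).

Definition proj N (z : Tan N) : N := z.1.

Definition tmap N P (f : N -> P) (z : Tan N) : Tan P :=
  (f z.1, 'd (phi (at_ (f z.1)) \o f \o chi (at_ z.1)) (phi (at_ z.1) z.1) z.2).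

End Charted.

Section Jets.
Variables (R : realType) (n : nat) (M : manifold R n).
Local Notation E := 'rV[R]_n.

Definition chartedM : charted R :=
  @Charted R M E (midx M) (@mdom _ _ M) (@mphi _ _ M) (@mchi _ _ M)
    (@mat_ _ _ M).

Fixpoint Tk (k : nat) : charted R :=
  if k is k'.+1 then Tan (Tk k') else chartedM.

Fixpoint base (k : nat) : Tk k -> M :=
  if k is k'.+1 then fun z => base (proj z) else id.

Local Notation TM := (Tk 1).
Local Notation T2M := (Tk 2).
Local Notation T3M := (Tk 3).

Definition local_diffeo (U : set M) (f g : M -> M) : Prop :=
  [/\ open U, open (f @` U),
      (forall x, U x -> g (f x) = x),
      (forall x, U x -> @smooth_at R chartedM chartedM f x)
    & (forall y, (f @` U) y -> @smooth_at R chartedM chartedM g y)].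

(* An arrow from x to y of level k is a map from the fibre of T^kM over x to  *)
(* the fibre over y. It is normalized to be the identity off the fibre over   *)
(* x, so that arrows are equal as soon as they agree on that fibre.           *)
Record arrow (k : nat) := Arrow {
  src : M;
  tgt : M;
  act : Tk k -> Tk k
}.

Arguments src {k}.
Arguments tgt {k}.
Arguments act {k}.

HB.instance Definition _ k := gen_eqMixin (arrow k).
HB.instance Definition _ k := gen_choiceMixin (arrow k).

Definition mkarrow k (x y : M) (f : Tk k -> Tk k) : arrow k :=
  Arrow x y (fun z => if `[< base z = x >] then f z else z).

Definition lin_arrow (x y : M) (L : E -> E) : arrow 1 :=
  @mkarrow 1 x y (fun z => (y, L z.2)).

Definition B1 : set (arrow 1) :=
  [set xi | exists x y (L : {linear E -> E}),
     bijective L /\ xi = lin_arrow x y L].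

Definition dif (f : M -> M) (x : M) : arrow 1 :=
  @mkarrow 1 x (f x) (@tmap R chartedM chartedM f).

(* Z |-> b(x) . Z, for Z in T^kM over x.                                      *)
Definition hat k (b : M -> arrow k) (z : Tk k) : Tk k := act (b (base z)) z.

(* Smoothness of a section b of the source map is smoothness of hat b.        *)
Record local_bisection k (G : set (arrow k)) := LocalBisection {
  bdom : set M;
  bfun :> M -> arrow k;
  binv : M -> M;
  bisection_in : forall x, bdom x -> G (bfun x);
  bisection_src : forall x, bdom x -> src (bfun x) = x;
  bisection_diffeo : local_diffeo bdom (tgt \o bfun) binv;
  bisection_smooth : forall z : Tk k, bdom (base z) -> smooth_at (hat bfun) z
}.

(* The 1-jet at x of b is (b(x), b_{*x}); it is recorded by its (faithful)    *)
(* action on T^(k+1)M, d/dt Z_t |-> d/dt (b(x_t) . Z_t), which is the         *)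
(* restriction of the differential of hat b to the fibre over x.              *)
Definition jet k (b : M -> arrow k) (x : M) : arrow k.+1 :=
  @mkarrow k.+1 x (tgt (b x)) (tmap (hat b)).

(* p = p_* at j^1_x b *)
Definition semiholonomic (b : M -> arrow 1) (x : M) : Prop :=
  b x = dif (tgt \o b) x.

Definition holonomic (eta : arrow 2) : Prop :=
  exists (U : set M) (f g : M -> M),
    [/\ local_diffeo U f g, U (src eta) & eta = jet (dif f) (src eta)].

(* srep x is the s_x of the definition of nabla: any choice will do.          *)
Record symmetry_jet := SymmetryJet {
  sjet :> M -> arrow 2;
  srep : M -> local_bisection B1;
  srep_dom : forall x, bdom (srep x) x;
  srepE : forall x, sjet x = jet (srep x) x;
  s_semiholonomic : forall x, semiholonomic (srep x) x;
  s_opp : forall x, srep x x = lin_arrow x x (fun v => - v);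
  s_smooth : forall z : T2M, smooth_at (hat sjet) z
}.

(* Vector fields may be given near a point only: their values elsewhere are   *)
(* irrelevant for all the operations below.                                   *)
Definition vector_field_near (x : M) (X : M -> TM) : Prop :=
  (forall x', proj (X x') = x') /\ @smooth_at R chartedM TM X x.

(* X_* and X_** *)
Definition star (X : M -> TM) : TM -> T2M := @tmap R chartedM TM X.
Definition sstar (X : M -> TM) : T2M -> T3M := tmap (star X).

(* Operations on two vectors of the same tangent space.                       *)
Definition addT (u v : TM) : TM := (u.1, u.2 + v.2).
Definition subT (u v : TM) : TM := (u.1, u.2 - v.2).
Definition scaleT (c : R) (u : TM) : TM := (u.1, c *: u.2).

(* Components of X at chi(u) in the preferred chart at x.                               *)
Definition components (X : M -> TM) (x : M) (u : E) : E :=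
  (@phi R TM (mat_ x) (X (mchi (mat_ x) u))).2.

Definition lie_bracket (X Y : M -> TM) (x : M) : TM :=
  (x, 'd (components Y x) (mphi (mat_ x) x) (X x).2
      - 'd (components X x) (mphi (mat_ x) x) (Y x).2).

(* (b Y)_{b^0(x')} = b(x') Y_{x'} *)
Definition push (b : local_bisection B1) (Y : M -> TM) (y : M) : TM :=
  act (b (binv b y)) (Y (binv b y)).

Section Connection.
Variable s : symmetry_jet.

Definition nabla (X Y : M -> TM) (x : M) : TM :=
  scaleT 2^-1
    (lie_bracket X (fun x' => addT (Y x') (push (srep s x) Y x')) x).

(* The extension of v with constant components in the preferred chart. All    *)
(* the expressions below are tensorial in the extended vectors.               *)
Definition extend (v : TM) : M -> TM :=
  fun x' => @chi R TM (mat_ v.1) (mphi (mat_ v.1) x', v.2).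

Definition nabla_at (v : TM) (Y : M -> TM) : TM := nabla (extend v) Y v.1.

Definition torsion (X Y : M -> TM) (x : M) : TM :=
  subT (subT (nabla X Y x) (nabla Y X x)) (lie_bracket X Y x).

Definition torsion_at (u v : TM) : TM := torsion (extend u) (extend v) u.1.

(* (nabla_z T)(u, v) *)
Definition nabla_torsion (z u v : TM) : TM :=
  let U := extend u in
  let V := extend v in
  subT (subT (nabla_at z (torsion U V)) (torsion_at (nabla_at z U) v))
       (torsion_at u (nabla_at z V)).

Definition is_affine_extension (xi : arrow 1) (eta : arrow 2) : Prop :=
  exists a : local_bisection B1,
    [/\ bdom a (src xi), eta = jet a (src xi), a (src xi) = xi,
        semiholonomic a (src xi)
      & forall (v : TM) (Y : M -> TM),
          base v = src xi -> vector_field_near (src xi) Y ->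
          act xi (nabla_at v Y) = nabla_at (act xi v) (push a Y)].

(* The affine extension exists and is unique for xi in B1; the default value  *)
(* of xget is irrelevant. SS xi does not depend on the bisection a.           *)
Definition S (xi : arrow 1) : arrow 2 :=
  xget (@mkarrow 2 (src xi) (src xi) id) [set eta | is_affine_extension xi eta].

Definition is_SS (xi : arrow 1) (eta : arrow 3) : Prop :=
  exists a : local_bisection B1,
    [/\ bdom a (src xi), S xi = jet a (src xi)
      & eta = jet (fun x' => S (a x')) (src xi)].

Definition SS (xi : arrow 1) : arrow 3 :=
  xget (@mkarrow 3 (src xi) (src xi) id) [set eta | is_SS xi eta].

End Connection.

(* Components are in the chart of T2M induced by the preferred chart of M.    *)
Definition kappa (z : T2M) : T2M :=
  let: ((x, X), (Y, V)) := z in ((x, Y), (X, V)).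

Definition kappa_star : T3M -> T3M := tmap kappa.

Definition kappa_arrow (eta : arrow 3) : arrow 3 :=
  @mkarrow 3 (src eta) (tgt eta)
    (fun z => kappa_star (act eta (kappa_star z))).

Definition p3 : T3M -> T2M := @proj R T2M.
Definition p3_star : T3M -> T2M := tmap (@proj R TM).
Definition p3_sstar : T3M -> T2M := tmap (tmap (@proj R chartedM)).

(* Pi(z1, z2) is defined and equal to v; the components are taken in the      *)
(* chart of T3M induced by the preferred chart of M at the base point.        *)
Definition is_Pi (z1 z2 : T3M) (v : TM) : Prop :=
  [/\ p3 z1 = p3 z2, p3_star z1 = p3_star z2, p3_sstar z1 = p3_sstar z2
    & v = (base z1, z1.2.2.2 - z2.2.2.2)].

End Jets.

(* Main.v *)
(* In an induced chart of T^2M, s(x) acts by                                  *)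
(*   ((u, X), (V, W)) |-> ((u, -X), (-V, -W - 2 G(u; V, X)))                  *)
(* for a smooth G bilinear in (V, X), and nabla_V X = DX(V) + G(u; V, X). A   *)
(* 1-jet in B^(1,1)_sh extending xi is affine iff it intertwines s(x) and     *)
(* s(y), so that, with L, G' the expressions of xi and of s at y,             *)
(*   S(xi) : ((u, X), (V, W)) |->                                             *)
(*     ((w, L X), (L V, L W + L G(u; V, X) - G'(w; L V, L X))).               *)
(* S(xi) is holonomic iff the quadratic term is symmetric in (V, X), that is  *)
(* L T(V, X) = T'(L V, L X) for the torsion T(V, X) = G(V, X) - G(X, V).      *)
(* Let j^1_x a = S(xi), with a covering f and of fibre part F. SS(xi) is the  *)
(* differential of u |-> S(a(u)) and, by the Schwarz lemma, kappa is the swap *)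
(* of X and V in every chart. So, for an element of T^3M with components Z    *)
(* over u, the last components of SS(xi) and of its kappa_*-conjugate differ  *)
(* by the differential at (x, V, X) of                                        *)
(*   (u, V, X) |-> F(u, T_u(V, X)) - T'_(f u)(F(u, V), F(u, X)).              *)
(* This map vanishes for u fixed at x, so only its derivative along Z         *)
(* remains. As DF along Z is L G(Z, .) - G'(L Z, L .), it is the difference   *)
(* of the covariant derivatives of the torsions.                              *)

Require Import Defs.
From HB Require Import structures.
From mathcomp Require Import all_boot all_order all_algebra.
From mathcomp Require Import all_classical all_reals all_analysis.
From mathcomp Require Import ring lra.

Set Implicit Arguments.
Unset Strict Implicit.
Unset Printing Implicit Defensive.

Import Order.TTheory GRing.Theory Num.Theory.
Import numFieldNormedType.Exports.

Local Open Scope classical_set_scope.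
Local Open Scope ring_scope.

(** * Smooth maps between normed spaces *)

(** Everything is computed in charts. There [s] is described by a Christoffel symbol G, bilinear in
    its two vector arguments, and the connection is D + G ([sjet_chart], [nabla_chart]). A
    semiholonomic 1-jet is affine exactly when it intertwines the symmetries at its two ends
    ([affine_inP], [affine_intertwining], [intertwining_affine]). This forces its quadratic term to
    be B(V, X) = L G(V, X) - G'(L V, L X) in all charts, whence [S_chart]. An affine extension
    exists because a bisection with a prescribed bilinear term can be built
    ([affine_extension_exists]).

    If S(xi) is holonomic, B is the second derivative of a diffeomorphism, hence symmetric
    ([schwarz], [holonomic_symmetric]). Antisymmetrizing the formula for B then says that xi carries
    the torsion at its source to the torsion at its target ([torsion_preserved]). The theorem
    measures how far this fails to first order.

    Let a bisection a represent S(xi), with base map f and fibre part F. Near the source, S(a(x'))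
    has the quadratic term [S_quad], and SS(xi) acts by the differential of these actions
    ([S_local_near], [act_jet_S]). Conjugation by kappa exchanges V and X, and it changes only the
    last coordinate, where [S_quad] is then differentiated with V and X exchanged ([is_Pi_jet_S]).
    So Pi is the derivative of q(u, V, X) = F(u, T_u(V, X)) - T'_{f u}(F(u, V), F(u, X)). As q
    vanishes on the whole fibre over the base point, only the base direction Z contributes, and the
    result depends on the values of X, Y, Z alone. The derivative of F along Z is B(Z, .); inserting
    its formula groups the terms into the two covariant derivatives of the torsion
    ([diff_S_quad_antisym], [nabla_torsion_chart]). *)

Section LinearMaps.
Variable R : realType.

Lemma linear_opp (V W : lmodType R) (f : V -> W) v : linear f -> f (- v) = - f v.
Proof.
move=> lf; pose fL : {linear V -> W} := HB.pack f (GRing.isLinear.Build _ _ _ _ _ lf).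
exact: (linearN fL).
Qed.

Lemma linear_add (V W : lmodType R) (f : V -> W) u v : linear f -> f (u + v) = f u + f v.
Proof.
move=> lf; pose fL : {linear V -> W} := HB.pack f (GRing.isLinear.Build _ _ _ _ _ lf).
exact: (linearD fL).
Qed.

Lemma linear_zero (V W : lmodType R) (f : V -> W) : linear f -> f 0 = 0.
Proof.
move=> lf; pose fL : {linear V -> W} := HB.pack f (GRing.isLinear.Build _ _ _ _ _ lf).
exact: (linear0 fL).
Qed.

Lemma linear_scale (V W : lmodType R) (f : V -> W) c v :
  linear f -> f (c *: v) = c *: f v.
Proof. by move=> lf; rewrite -[c *: v]addr0 lf (linear_zero lf) addr0. Qed.

Lemma linear_sub (V W : lmodType R) (f g : V -> W) :
  linear f -> linear g -> linear (fun v => f v - g v).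
Proof. by move=> lf lg c u v; rewrite lf lg scalerBr opprD addrACA. Qed.

Lemma linear_comp (U V W : lmodType R) (f : U -> V) (g : V -> W) :
  linear f -> linear g -> linear (g \o f).
Proof. by move=> lf lg c u v; rewrite /= lf lg. Qed.

End LinearMaps.

Section SmoothMaps.
Variable R : realType.
Implicit Types U V W : normedModType R.

Lemma lin_is_diff V W (f : V -> W) x :
  linear f -> continuous f -> is_diff x f f.
Proof.
move=> lf cf.
pose fL : {linear V -> W} := HB.pack f (GRing.isLinear.Build _ _ _ _ _ lf).
have -> : f = fL by [].
apply: DiffDef; first exact: linear_differentiable.
exact: diff_lin.
Qed.

Lemma is_diff_near V W (f g df : V -> W) x :
  (\forall y \near x, f y = g y) -> is_diff x f df -> is_diff x g df.
Proof.
move=> fg [/diff_locallyP[cdf fE] dE].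
have gE : g \o shift x = cst (g x) + 'd f x +o_ 0 id.
  apply/eqaddoP => e e0.
  have /(_ _ e0) : forall e, 0 < e -> \forall h \near (0 : V),
      `|((f \o shift x) - (cst (f x) + 'd f x)) h| <= e * `|h|.
    by move=> e' e'0; move/eqaddoP: fE; apply.
  have fg0 : \forall h \near (0 : V), f (h + x) = g (h + x).
    have : \forall h \near (0 : V), (fun y => f y = g y) (h + x).
      move: fg; rewrite (near_shift 0 x) => fg.
      by apply: filterS fg => h /=; rewrite subr0.
    by [].
  have fgx : f x = g x by exact: nbhs_singleton fg.
  apply: filterS2 fg0 => h; rewrite /= -![(_ - _ : _ -> _) _]/(_ - _) /=.
  by rewrite -![(_ + _ : _ -> _) _]/(_ + _) /= /cst fgx => ->.
have dgf := diff_unique cdf gE.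
by split; [apply/diff_locallyP; rewrite dgf | rewrite dgf].
Qed.

Lemma differentiable_near V W (f g : V -> W) x :
  (\forall y \near x, f y = g y) -> differentiable f x -> differentiable g x.
Proof. by move=> fg /differentiableP /(is_diff_near fg)[]. Qed.

Lemma diff_near V W (f g : V -> W) x :
  (\forall y \near x, f y = g y) -> differentiable f x ->
  'd g x = 'd f x :> (V -> W).
Proof. by move=> fg /differentiableP /(is_diff_near fg)[]. Qed.

Lemma fst_continuous V W : continuous (@fst V W).
Proof. by move=> z; exact: cvg_fst. Qed.

Lemma snd_continuous V W : continuous (@snd V W).
Proof. by move=> z; exact: cvg_snd. Qed.

Lemma pair_continuous U V W (f : U -> V) (g : U -> W) :
  continuous f -> continuous g -> continuous (fun x => (f x, g x)).
Proof. by move=> cf cg x; apply: cvg_pair; [exact: cf | exact: cg]. Qed.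

Lemma comp_continuous U V W (f : U -> V) (g : V -> W) :
  continuous f -> continuous g -> continuous (fun x => g (f x)).
Proof. by move=> cf cg x; apply: continuous_comp; [exact: cf | exact: cg]. Qed.

Lemma is_diff_fst V W (x : V * W) : is_diff x fst fst.
Proof. by apply: lin_is_diff => //; exact: fst_continuous. Qed.

Lemma is_diff_snd V W (x : V * W) : is_diff x snd snd.
Proof. by apply: lin_is_diff => //; exact: snd_continuous. Qed.

Lemma open_setX V W (D : set V) (D' : set W) :
  open D -> open D' -> open (D `*` D').
Proof.
move=> oD oD'; rewrite openE => -[x y] [/= Dx D'y].
exists (D, D') => //=; split; exact: open_nbhs_nbhs.
Qed.

(** The tangent map of [f], which is also the map whose regularity [Ck_on] requires at a
    successor. *)
Definition tangent V W (f : V -> W) (z : V * V) : W * W := (f z.1, 'd f (z.1) z.2).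

Lemma tangent_near V W (f g : V -> W) z :
  (\forall y \near z.1, f y = g y) -> differentiable f z.1 -> tangent g z = tangent f z.
Proof.
by move=> fg df; rewrite /tangent (diff_near fg df) (nbhs_singleton fg).
Qed.

Lemma Ck_on_sub k V W (D D' : set V) (f : V -> W) :
  D' `<=` D -> Ck_on k D f -> Ck_on k D' f.
Proof.
elim: k V W D D' f => [|k IH] V W D D' f DD' /=; first by move=> + x /DD'; exact.
move=> [df Cf]; split; first by move=> x /DD'; exact: df.
by apply: IH Cf => -[x y] [/= /DD'].
Qed.

Lemma near_open V (D : set V) (P : V -> Prop) x :
  open D -> D x -> (forall y, D y -> P y) -> \forall y \near x, P y.
Proof. by move=> oD Dx DP; apply: filterS DP _; exact: open_nbhs_nbhs. Qed.

Lemma nearP_open V (P : V -> Prop) x :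
  (\forall y \near x, P y) ->
  exists D : set V, [/\ open D, D x & forall y, D y -> P y].
Proof. by rewrite /prop_near1 nbhsE => -[D [oD Dx] DP]; exists D; split. Qed.

Lemma Ck_on_eq k V W (D : set V) (f g : V -> W) :
  open D -> {in D, f =1 g} -> Ck_on k D f -> Ck_on k D g.
Proof.
elim: k V W D f g => [|k IH] V W D f g oD fg /=.
  move=> cf x Dx; have nfg : \forall y \near x, f y = g y.
    by apply: (near_open oD) => // y Dy; apply: fg; rewrite inE.
  have := cf x Dx; rewrite /prop_for /continuous_at.
  rewrite (fg x) ?inE //; apply: cvg_trans; exact: near_eq_cvg.
move=> [df Cf].
have nfg x : D x -> \forall y \near x, f y = g y.
  by move=> Dx; apply: (near_open oD) => // y Dy; apply: fg; rewrite inE.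
split; first by move=> x Dx; apply: differentiable_near (nfg _ Dx) (df _ Dx).
apply: IH Cf; first exact: open_setX oD openT.
move=> z; rewrite inE => -[Dx _].
by rewrite -[LHS]/(tangent f z) -(tangent_near (nfg _ Dx) (df _ Dx)).
Qed.

(** By the chain rule the tangent map of a composite is the composite of the tangent maps, so the
    induction applies to the tangent maps themselves. *)
Lemma Ck_on_comp k U V W (D : set U) (D' : set V) (f : U -> V) (g : V -> W) :
  open D -> (forall x, D x -> D' (f x)) ->
  Ck_on k D f -> Ck_on k D' g -> Ck_on k D (g \o f).
Proof.
elim: k U V W D D' f g => [|k IH] U V W D D' f g oD fD /=.
  move=> cf cg x Dx; apply: continuous_comp; first exact: cf.
  exact/cg/fD.
move=> [df Cf] [dg Cg]; split.
  move=> x Dx; apply: differentiable_comp; first exact: df.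
  exact/dg/fD.
have oT : open (D `*` [set: U]) by exact: open_setX oD openT.
apply: (@Ck_on_eq _ _ _ _ (tangent g \o tangent f)) => //.
  move=> -[x v]; rewrite inE => -[/= Dx _]; rewrite /tangent /=.
  by rewrite (diff_comp (df _ Dx) (dg _ (fD _ Dx))).
by apply: IH Cf Cg => // -[x v] [/= /fD].
Qed.

Lemma Ck_on_lin k V W (D : set V) (f : V -> W) :
  linear f -> continuous f -> Ck_on k D f.
Proof.
elim: k V W D f => [|k IH] V W D f lf cf /=; first by move=> x _; exact: cf.
split; first by move=> x _; have [] := lin_is_diff x lf cf.
have -> : (fun z : V * V => (f z.1, 'd f (z.1) z.2)) = fun z => (f z.1, f z.2).
  by apply/funext => z; have [_ ->] := lin_is_diff z.1 lf cf.
apply: IH.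
  by move=> a [x y] [x' y'] /=; rewrite !lf.
apply: pair_continuous; apply: comp_continuous cf.
  exact: fst_continuous.
exact: snd_continuous.
Qed.

Lemma Ck_on_cst k V W (D : set V) (c : W) : Ck_on k D (cst c).
Proof.
elim: k V W D c => [|k IH] V W D c /=; first by move=> x _; exact: cvg_cst.
split; first by move=> x _; exact: differentiable_cst.
have -> : (fun z : V * V => (cst c z.1, 'd (cst c) (z.1) z.2)) = cst (c, 0).
  by apply/funext => z; rewrite diff_cst.
exact: IH.
Qed.

Lemma Ck_on_pair k U V W (D : set U) (f : U -> V) (g : U -> W) :
  open D -> Ck_on k D f -> Ck_on k D g -> Ck_on k D (fun x => (f x, g x)).
Proof.
elim: k U V W D f g => [|k IH] U V W D f g oD /=.
  move=> cf cg x Dx; apply: cvg_pair; [exact: cf | exact: cg].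
move=> [df Cf] [dg Cg]; split.
  by move=> x Dx; apply: differentiable_pair; [exact: df | exact: dg].
have oT : open (D `*` [set: U]) by exact: open_setX oD openT.
(* The tangent map of a pair is the pair of the tangent maps, up to this linear regrouping of the
   four components. *)
pose sw (z : (V * V) * (W * W)) := ((z.1.1, z.2.1), (z.1.2, z.2.2)).
apply: (@Ck_on_eq _ _ _ _ (sw \o (fun z => (tangent f z, tangent g z)))) => //.
  move=> -[x v]; rewrite inE => -[/= Dx _]; rewrite /sw /tangent /=.
  by rewrite (diff_pair (df _ Dx) (dg _ Dx)).
apply: (@Ck_on_comp _ _ _ _ _ setT) => //; first exact: IH.
apply: Ck_on_lin; first by move=> a [[? ?] [? ?]] [[? ?] [? ?]].
have c1 := @fst_continuous (V * V)%type (W * W)%type.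
have c2 := @snd_continuous (V * V)%type (W * W)%type.
apply: pair_continuous; apply: pair_continuous.
- exact: comp_continuous c1 (@fst_continuous V V).
- exact: comp_continuous c2 (@fst_continuous W W).
- exact: comp_continuous c1 (@snd_continuous V V).
- exact: comp_continuous c2 (@snd_continuous W W).
Qed.

Definition smooth V W (f : V -> W) (x : V) :=
  exists D, [/\ open D, D x & smooth_on D f].

Lemma smooth_near V W (f g : V -> W) x :
  (\forall y \near x, f y = g y) -> smooth f x -> smooth g x.
Proof.
move=> /nearP_open[P [oP Px Pfg]] [D [oD Dx sf]].
exists (P `&` D); split; [exact: openI | by [] | move=> k].
apply: (@Ck_on_eq _ _ _ _ f); first exact: openI.
  by move=> y; rewrite inE => -[/Pfg].
by apply: Ck_on_sub (sf k) => y [].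
Qed.

Lemma smooth_differentiable V W (f : V -> W) x : smooth f x -> differentiable f x.
Proof. by move=> [D [oD Dx sf]]; have [df _] := sf 1%N; exact: df. Qed.

Lemma smooth_continuous V W (f : V -> W) x : smooth f x -> {for x, continuous f}.
Proof. by move=> /smooth_differentiable; exact: differentiable_continuous. Qed.

Lemma near_continuous V W (f : V -> W) x (Q : W -> Prop) :
  {for x, continuous f} -> (\forall w \near f x, Q w) -> \forall y \near x, Q (f y).
Proof. by move=> cf nQ; exact: cf. Qed.

Lemma smooth_nearby V W (f : V -> W) x :
  smooth f x -> \forall y \near x, smooth f y.
Proof.
by move=> [D [oD Dx sf]]; apply: (near_open oD Dx) => y Dy; exists D.
Qed.

Lemma smooth_tangent V W (f : V -> W) z : smooth f z.1 -> smooth (tangent f) z.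
Proof.
move=> [D [oD Dx sf]]; exists (D `*` setT); split => //.
  exact: open_setX oD openT.
by move=> k; have [] := sf k.+1.
Qed.

Lemma smooth_comp U V W (f : U -> V) (g : V -> W) x :
  smooth f x -> smooth g (f x) -> smooth (g \o f) x.
Proof.
move=> sf; have := smooth_continuous sf; case: sf => [D [oD Dx sf]] cf.
move=> [D' [oD' D'x sg]].
have /nearP_open[P [oP Px PD']] : \forall y \near x, D' (f y).
  by apply: cf; apply: open_nbhs_nbhs.
exists (P `&` D); split; [exact: openI | by [] | move=> k].
apply: (@Ck_on_comp _ _ _ _ _ D') => //; first exact: openI.
  by move=> y [/PD'].
by apply: Ck_on_sub (sf k) => y [].
Qed.

Lemma smooth_lin V W (f : V -> W) x : linear f -> continuous f -> smooth f x.
Proof.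
move=> lf cf; exists setT; split => //; first exact: openT.
by move=> k; exact: Ck_on_lin.
Qed.

Lemma smooth_cst V W (c : W) (x : V) : smooth (cst c) x.
Proof.
by exists setT; split => //; [exact: openT | move=> k; exact: Ck_on_cst].
Qed.

Lemma smooth_pair U V W (f : U -> V) (g : U -> W) x :
  smooth f x -> smooth g x -> smooth (fun y => (f y, g y)) x.
Proof.
move=> [D [oD Dx sf]] [D' [oD' D'x sg]].
exists (D `&` D'); split; [exact: openI | by [] | move=> k].
apply: Ck_on_pair; first exact: openI.
  by apply: Ck_on_sub (sf k) => y [].
by apply: Ck_on_sub (sg k) => y [].
Qed.

Lemma smooth_id V (x : V) : smooth id x.
Proof. by apply: smooth_lin => // y; exact: cvg_id. Qed.

Lemma smooth_fst V W (x : V * W) : smooth fst x.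
Proof. by apply: smooth_lin => //; exact: fst_continuous. Qed.

Lemma smooth_snd V W (x : V * W) : smooth snd x.
Proof. by apply: smooth_lin => //; exact: snd_continuous. Qed.

Lemma smoothD V W (f g : V -> W) x :
  smooth f x -> smooth g x -> smooth (fun y => f y + g y) x.
Proof.
move=> sf sg.
apply: (@smooth_comp _ _ _ _ (fun z : W * W => z.1 + z.2) _ (smooth_pair sf sg)).
apply: smooth_lin; first by move=> a [? ?] [? ?] /=; rewrite scalerDr addrACA.
by move=> z; apply: continuousD; [exact: fst_continuous | exact: snd_continuous].
Qed.

Lemma smoothZ V W (f : V -> W) c x : smooth f x -> smooth (fun y => c *: f y) x.
Proof.
move=> sf; apply: (@smooth_comp _ _ _ _ ( *:%R c) _ sf).
apply: smooth_lin; first by move=> a u v; rewrite scalerDr !scalerA mulrC.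
exact: scaler_continuous.
Qed.

Lemma smoothN V W (f : V -> W) x : smooth f x -> smooth (fun y => - f y) x.
Proof.
move=> sf; apply: (smooth_near _ (smoothZ (-1) sf)).
by apply: nearW => y; rewrite scaleN1r.
Qed.

Lemma smoothB V W (f g : V -> W) x :
  smooth f x -> smooth g x -> smooth (fun y => f y - g y) x.
Proof. by move=> sf sg; apply: smoothD => //; exact: smoothN. Qed.

Lemma tangent_comp U V W (f : U -> V) (g : V -> W) z :
  differentiable f z.1 -> differentiable g (f z.1) ->
  tangent (g \o f) z = tangent g (tangent f z).
Proof. by move=> df dg; rewrite /tangent /= diff_comp. Qed.

Lemma differentiable_id V (x : V) : differentiable (@id V) x.
Proof. exact: (ex_diff (is_diff_def := is_diff_id x)). Qed.

Lemma tangent_id V (z : V * V) : tangent id z = z.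
Proof. by case: z => x v; rewrite /tangent /= (diff_val (is_diff_def := is_diff_id x)). Qed.

(** Along [v] the difference quotient is constant, so the directional derivative is [w] without any
    limit to compute. *)
Lemma diff_affine_line V W (f : V -> W) x v w :
  differentiable f x -> (forall t, f (t *: v + x) = f x + t *: w) ->
  'd f x v = w.
Proof.
move=> df fE; rewrite -deriveE // /derive.
apply: cvg_lim => //.
apply: (@cvg_trans _ (cst w @ (0:R)^')); last exact: cvg_cst.
apply: near_eq_cvg; near=> t => /=.
rewrite fE addrC addKr scalerA mulVf ?scale1r //.
by near: t; exact: nbhs_dnbhs_neq.
Unshelve. all: by end_near. Qed.

Lemma near_fst_pair V W (Q : V -> Prop) (p : V * W) :
  (\forall u \near p.1, Q u) -> \forall z \near p, Q z.1.
Proof. by case: p => u w H; apply: cvg_fst. Qed.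

End SmoothMaps.

Section FiniteDim.
Variables (R : realType) (n : nat).
Implicit Types U V W : normedModType R.

Lemma linear_rV_continuous W (f : 'rV[R]_n -> W) : linear f -> continuous f.
Proof.
move=> lf.
pose fL : {linear 'rV[R]_n -> W} := HB.pack f (GRing.isLinear.Build _ _ _ _ _ lf).
have -> : f = fun v => \sum_(j < n) v 0 j *: f (delta_mx 0 j).
  apply/funext => v; rewrite {1}(row_sum_delta v) -[f]/(fL : _ -> _) linear_sum.
  by apply: eq_bigr => j _; rewrite linearZ.
have -> : (fun v : 'rV[R]_n => \sum_(j < n) v 0 j *: f (delta_mx 0 j)) =
    \sum_(j < n) (fun v : 'rV[R]_n => v 0 j *: f (delta_mx 0 j)).
  by apply/funext => v; rewrite fct_sumE.
move=> v; apply/differentiable_continuous/differentiable_sum => j.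
exact/differentiableZl/differentiable_coord.
Qed.

End FiniteDim.

(** * Second derivatives: the Schwarz lemma and the second tangent map *)

Section Schwarz.
Variable R : realType.
Implicit Types U V W : normedModType R.

Lemma is_diff_segment V (f : V -> R) v y t :
  differentiable f (t *: v + y) ->
  is_diff t (fun t' : R => f (t' *: v + y)) (fun t' => 'd f (t *: v + y) (t' *: v)).
Proof.
move=> df.
have dl : is_diff t (fun t' : R => t' *: v + y) (fun t' : R => t' *: v).
  have := is_diffD (is_diff_scalel t v) (is_diff_cst y t).
  by rewrite addr0.
have df' := differentiableP df.
exact: (@is_diff_comp _ _ _ _ (fun t' : R => t' *: v + y) _ f _ t dl df').
Qed.

(* The mean value theorem along v; exchanging v and w gives the symmetry of   *)
(* D^2 f.                                                                     *)
Lemma second_difference V (f : V -> R) u v w e : 0 < e ->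
  (\forall y \near u, differentiable f y) ->
  differentiable (fun y => 'd f y v) u ->
  \forall s \near 0^'+,
    `|f (s *: v + (s *: w + u)) - f (s *: v + u)
      - (f (s *: w + u) - f u) - s ^+ 2 * 'd (fun y => 'd f y v) u w|
    <= s ^+ 2 * (e * (2 * (`|v| + `|w|))).
Proof.
move=> e0 ndf dg; set g := fun y => 'd f y v; set A := 'd g u.
(* First-order expansion of y |-> Df(y) v at [u], with error at most e|h|. It will be used at h = c
   v + s w and at h = c v, both of which are small with s. *)
have : \forall h \near (0 : V), differentiable f (h + u) /\
    `|g (h + u) - g u - A h| <= e * `|h|.
  apply: filterI.
    move: ndf; rewrite (near_shift 0 u) => ndf.
    by apply: filterS ndf => h /=; rewrite subr0.
  have /eqaddoP/(_ _ e0) := diff_locally dg.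
  apply: filterS => h.
  by rewrite -![(_ - _ : _ -> _) _]/(_ - _) /= -![(_ + _ : _ -> _) _]/(_ + _)
    /= opprD addrA.
move=> /nbhs_ballP[d /= d0 dP].
have N0 : 0 <= `|v| + `|w| by rewrite addr_ge0.
near=> s.
have s0 : 0 < s by near: s; exact: nbhs_right_gt.
have sd : s * (`|v| + `|w| + 1) < d.
  rewrite -ltr_pdivlMr ?ltr_wpDl //.
  by near: s; apply: nbhs_right_lt; rewrite divr_gt0 // ltr_wpDl.
have small a b : 0 <= a <= s -> 0 <= b <= s -> ball (0 : V) d (a *: v + b *: w).
  move=> /andP[a0 as_] /andP[b0 bs].
  rewrite -ball_normE /= sub0r normrN.
  apply: le_lt_trans sd; rewrite (le_trans (ler_normD _ _)) // !normrZ.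
  rewrite !ger0_norm // mulrDr mulr1 mulrDr ler_wpDr // ?(ltW s0) //.
  by rewrite lerD // ler_wpM2r.
(* The second difference is [phi s - phi 0], and the derivative of [phi] is a difference of two
   values of [g]. The mean value theorem turns the second difference into s times a first difference
   of [g]. *)
pose phi (t : R) := f (t *: v + (s *: w + u)) - f (t *: v + u).
pose dphi (t : R) := g (t *: v + (s *: w + u)) - g (t *: v + u).
have dphiE t : 0 <= t <= s -> is_derive t 1 phi (dphi t).
  move=> ts; have ss : 0 <= s <= s by rewrite lexx ltW.
  have zs : 0 <= (0 : R) <= s by rewrite lexx ltW.
  have [d1 _] := dP _ (small _ _ ts ss); have [d2 _] := dP _ (small _ _ ts zs).
  rewrite -addrA in d1; rewrite scale0r addr0 in d2.
  have := is_diff_segment d1; have := is_diff_segment d2 => D2 D1.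
  have [D E] := is_diffB D1 D2.
  have dphit : derivable phi t 1 by exact: diff_derivable.
  apply: DeriveDef => //.
  by rewrite deriveE // E /= -[LHS]/(_ - _) !scale1r.
have [c cs] : exists2 c, c \in `]0, s[%R & phi s - phi 0 = dphi c * (s - 0).
  apply: MVT => //.
    by move=> t; rewrite in_itv /= => /andP[t0 ts]; apply: dphiE; rewrite !ltW.
  apply: derivable_within_continuous => t; rewrite in_itv /= => ts.
  by have [] := dphiE t ts.
rewrite subr0 /phi !scale0r !add0r => ->.
have {}cs : 0 <= c <= s by move: cs; rewrite in_itv /= => /andP[? ?]; rewrite !ltW.
have ss : 0 <= s <= s by rewrite lexx ltW.
have zs : 0 <= (0 : R) <= s by rewrite lexx ltW.
have [_ e1] := dP _ (small _ _ cs ss); have [_ e2] := dP _ (small _ _ cs zs).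
rewrite scale0r addr0 in e2.
have -> : dphi c * s - s ^+ 2 * A w =
    s * ((g (c *: v + s *: w + u) - g u - A (c *: v + s *: w))
       - (g (c *: v + u) - g u - A (c *: v))).
  have -> : A (c *: v + s *: w) = A (c *: v) + s * A w.
    by rewrite linearD; congr (_ + _); rewrite linearZ.
  by rewrite /dphi addrA; ring.
rewrite normrM (gtr0_norm s0) expr2 -mulrA ler_pM2l //.
rewrite (le_trans (ler_normB _ _)) // (le_trans (lerD e1 e2)) //.
rewrite -mulrDr mulrCA ler_pM2l //.
apply: (@le_trans _ _ ((s * `|v| + s * `|w|) + s * `|v|)).
  have cv : `|c *: v| <= s * `|v|.
    by rewrite normrZ; case/andP: cs => c0 cs; rewrite ger0_norm // ler_wpM2r.
  rewrite lerD // (le_trans (ler_normD _ _)) // lerD //.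
  by rewrite normrZ gtr0_norm.
have sw0 : 0 <= s * `|w| by rewrite mulr_ge0 // ltW.
by move: sw0; nra.
Unshelve. all: by end_near. Qed.

(** One and the same second difference is approximated by s^2 times either mixed derivative, with
    error s^2 times an arbitrarily small constant. Dividing by s^2 shows that the two are
    arbitrarily close. *)
Lemma schwarzR V (f : V -> R) u v w :
  (\forall y \near u, differentiable f y) ->
  differentiable (fun y => 'd f y v) u -> differentiable (fun y => 'd f y w) u ->
  'd (fun y => 'd f y v) u w = 'd (fun y => 'd f y w) u v.
Proof.
move=> ndf dv dw; apply/eqP; rewrite -subr_eq0 -normr_le0.
set N := 2 * (`|v| + `|w|).
have N0 : 0 <= N by rewrite mulr_ge0 // addr_ge0.
suff H e : 0 < e -> `|'d (fun y => 'd f y v) u w - 'd (fun y => 'd f y w) u v|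
    <= e * (2 * N).
  apply/ler_addgt0Pl => e e0; rewrite addr0.
  have N1 : 0 < 2 * N + 1 by rewrite ltr_wpDl // mulr_ge0.
  apply: (le_trans (H (e / (2 * N + 1)) _)); first by rewrite divr_gt0.
  by rewrite -mulrA ler_piMr ?(ltW e0) // ler_pdivrMl // mulr1 lerDl.
move=> e0; near (0:R)^'+ => s.
have s0 : 0 < s by near: s; exact: nbhs_right_gt.
have s2 : 0 < s ^+ 2 by rewrite exprn_gt0.
have h1 : `|f (s *: v + (s *: w + u)) - f (s *: v + u)
      - (f (s *: w + u) - f u) - s ^+ 2 * 'd (fun y => 'd f y v) u w|
    <= s ^+ 2 * (e * N).
  by near: s; exact: second_difference.
have h2 : `|f (s *: w + (s *: v + u)) - f (s *: w + u)
      - (f (s *: v + u) - f u) - s ^+ 2 * 'd (fun y => 'd f y w) u v|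
    <= s ^+ 2 * (e * N).
  by near: s; rewrite /N [`|v| + _]addrC; exact: second_difference.
have := lerD h1 h2; move/(le_trans (ler_normB _ _)).
rewrite [s *: w + (_ + _)]addrCA.
set a := f _; set b := f _; set c := f _; set d := f _.
set A := 'd _ _ _; set B := 'd _ _ _.
have -> : a - b - (c - d) - s ^+ 2 * A - (a - c - (b - d) - s ^+ 2 * B) =
   s ^+ 2 * (B - A) by ring.
rewrite normrM ger0_norm ?(ltW s2) // -mulrDr ler_pM2l // distrC.
by move/le_trans; apply; rewrite mulr_natl mulr2n -mulrDr.
Unshelve. all: by end_near. Qed.

Lemma is_diff_tangent V W (f : V -> W) u v :
  differentiable (tangent f) (u, v) ->
  is_diff u (fun y => 'd f y v) (fun w : V => ('d (tangent f) (u, v) (w, 0)).2).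
Proof.
move=> dT.
have D1 : is_diff u (fun y : V => (y, v)) (fun w : V => (w, 0)).
  exact: is_diff_pair.
have D2 := differentiableP dT.
have D3 := is_diff_comp (g := tangent f) D1 D2.
have := is_diff_comp D3 (is_diff_snd (tangent f (u, v))).
by [].
Qed.

Lemma smooth_diff_dir V W (f : V -> W) u v :
  smooth f u -> is_diff u (fun y => 'd f y v)
    (fun w : V => ('d (tangent f) (u, v) (w, 0)).2).
Proof.
by move=> sf; apply/is_diff_tangent/smooth_differentiable/smooth_tangent.
Qed.

(** [('d (tangent f) (u, v) (w, 0)).2] is the second derivative D^2 f(u)(w, v). Its symmetry is
    checked on each coordinate by [schwarzR]. *)
Lemma schwarz V n (f : V -> 'rV[R]_n) u v w : smooth f u ->
  ('d (tangent f) (u, v) (w, 0)).2 = ('d (tangent f) (u, w) (v, 0)).2.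
Proof.
move=> sf; apply/rowP => j.
pose c (N : 'rV[R]_n) := N 0 j.
have lc : linear c by move=> a x y; rewrite /c !mxE.
have cc : continuous c := @coord_continuous _ 1 n 0 j.
have dfj : \forall y \near u, differentiable f y.
  by near=> y; apply: smooth_differentiable; near: y; exact: smooth_nearby.
have cdE v' : \forall y \near u, c ('d f y v') = 'd (c \o f) y v'.
  near=> y.
  have df : differentiable f y by near: y.
  have dc := lin_is_diff (f y) lc cc.
  by rewrite (diff_comp df (ex_diff (is_diff_def := dc))) /= (diff_val (is_diff_def := dc)).
have D v' : is_diff u (fun y => 'd (c \o f) y v')
    (fun w : V => c ('d (tangent f) (u, v') (w, 0)).2).
  apply: is_diff_near (cdE v') _.
  have d1 := smooth_diff_dir v' sf.
  exact: is_diff_comp d1 (lin_is_diff _ lc cc).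
have [[d1 e1] [d2 e2]] := (D v, D w).
have := @schwarzR _ (c \o f) u v w _ d1 d2.
rewrite e1 e2; apply.
near=> y; apply: differentiable_comp; first by near: y.
exact: (ex_diff (is_diff_def := lin_is_diff (f y) lc cc)).
Unshelve. all: by end_near. Qed.

(** A fibre direction moves along a line on which [f] is affine, so its contribution is [f] itself;
    only the base direction needs a genuine derivative. *)
Lemma diff_fibre_linear U V W (f : U * V -> W) u v h w :
  differentiable f (u, v) -> linear (fun v => f (u, v)) ->
  'd f (u, v) (h, w) = 'd f (u, v) (h, 0) + f (u, w).
Proof.
move=> df lf.
have -> : (h, w) = (h, 0) + (0, w) :> U * V.
  by rewrite -[RHS]/(h + 0, 0 + w) addr0 add0r.
rewrite linearD; congr (_ + _); apply: diff_affine_line => // t.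
have -> : t *: (0, w) + (u, v) = (u, t *: w + v) :> U * V.
  by rewrite -[LHS]/(t *: (0 : U) + u, t *: w + v) scaler0 add0r.
by rewrite lf addrC.
Qed.

Lemma diff_fst_comp U V W W' (f : U * V -> W * W') (g : U -> W) u v h w :
  (\forall z \near (u, v), (f z).1 = g z.1) ->
  differentiable f (u, v) -> differentiable g u ->
  ('d f (u, v) (h, w)).1 = 'd g u h.
Proof.
move=> fg df dg.
have dg' := differentiableP dg; have df' := differentiableP df.
have d1 := is_diff_comp (g := g) (is_diff_fst (u, v)) dg'.
have d2 := is_diff_comp df' (is_diff_fst (f (u, v))).
have fg' : \forall z \near (u, v), (fst \o f) z = (g \o fst) z by [].
have [_ e] := is_diff_near fg' d2.
have := congr1 (@^~ (h, w)) (diff_val (is_diff_def := d1)).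
by rewrite e.
Qed.

(** The coordinate expression of the canonical involution kappa. *)
Definition swap_mid V (z : (V * V) * (V * V)) := ((z.1.1, z.2.1), (z.1.2, z.2.2)).

Lemma diff_tangent V W (f : V -> W) u v w w' : smooth f u ->
  'd (tangent f) (u, v) (w, w') =
    ('d f u w, ('d (tangent f) (u, v) (w, 0)).2 + 'd f u w').
Proof.
move=> sf.
have dT : differentiable (tangent f) (u, v).
  by apply: smooth_differentiable; apply: smooth_tangent.
rewrite [LHS]surjective_pairing; congr pair.
  have fE : \forall z \near (u, v), (tangent f z).1 = f z.1 by near=> z.
  exact: diff_fst_comp fE dT (smooth_differentiable sf).
have ds := is_diff_comp (differentiableP dT) (is_diff_snd (tangent f (u, v))).
have e x : ('d (tangent f) (u, v) x).2 = 'd (snd \o tangent f) (u, v) x.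
  by rewrite (diff_val (is_diff_def := ds)).
rewrite !e; apply: diff_fibre_linear; first exact: ex_diff.
by move=> a x y /=; rewrite linearP.
Unshelve. all: by end_near. Qed.

(** The two sides differ only in the order of the second derivative of [f]. Applied to transition
    maps, this makes kappa independent of the chart. *)
Lemma tangent2_swap V n (f : V -> 'rV[R]_n) z : smooth f z.1.1 ->
  tangent (tangent f) (swap_mid z) = swap_mid (tangent (tangent f) z).
Proof.
case: z => -[x X] [Y Z] /= sf.
have e v w w' : tangent (tangent f) ((x, v), (w, w')) = ((f x, 'd f x v),
    ('d f x w, ('d (tangent f) (x, v) (w, 0)).2 + 'd f x w')).
  exact: (congr1 (pair (f x, 'd f x v)) (diff_tangent v w w' sf)).
apply: (etrans (e Y X Z)); apply: esym.
apply: (etrans (congr1 (@swap_mid _) (e X Y Z))).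
by rewrite (schwarz X Y sf).
Qed.

End Schwarz.

(** * Injectivity of small perturbations of a linear isomorphism *)

Section Perturbation.
Variable R : realType.

Lemma injective_linear_bijective n (f : {linear 'rV[R]_n -> 'rV[R]_n}) :
  (forall v, f v = 0 -> v = 0) -> bijective f.
Proof.
move=> f0; pose F : 'End('rV[R]_n) := linfun f.
have F0 : lker F == 0%VS.
  apply/lker0P => u v; rewrite !lfunE => e; apply/eqP; rewrite -subr_eq0.
  by apply/eqP/f0; rewrite linearB e subrr.
exists (F^-1)%VF => v.
  by have := lker0_lfunK F0 v; rewrite lfunE.
by have := lker0_lfunVK F0 v; rewrite lfunE.
Qed.

(** A bilinear map that is continuous at the origin is bounded on a ball. Rescaling both arguments
    into the ball gives |B h v| < |v| / k for small h and nonzero v, whereas |L v| is at least |v| /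
    k. *)
Lemma perturbed_injective (V W : normedModType R) (L : V -> W) (B : V -> V -> W) k :
  0 < k -> (forall v, `|v| <= k * `|L v|) ->
  (forall v, linear (B ^~ v)) -> (forall h, linear (B h)) ->
  {for (0, 0), continuous (fun z : V * V => B z.1 z.2)} ->
  \forall h \near (0 : V), forall v, L v + B h v = 0 -> v = 0.
Proof.
move=> k0 Lk Bl Br cB.
have B0 : B 0 0 = 0 := linear_zero (Br 0).
have BZl c h v : B (c *: h) v = c *: B h v := linear_scale c h (Bl v).
have BZr c h v : B h (c *: v) = c *: B h v := linear_scale c v (Br h).
have : \forall z \near ((0, 0) : V * V), `|B z.1 z.2| < 1.
  have /cvgrPdist_lt/(_ 1 ltr01) := cB.
  by apply: filterS => z; rewrite /= B0 sub0r normrN.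
move=> /nbhs_ballP[e /= e0 Be].
have t0 : 0 < e / (2 * k) by rewrite divr_gt0 // mulr_gt0.
(* With t = e / (2k), the vectors h / t and (e / (2|v|)) v both have norm below e, and the product
   of the two scaling factors is k / |v|. *)
apply/nbhs_ballP; exists (e * (e / (2 * k))); first by rewrite /= mulr_gt0.
move=> h; rewrite -ball_normE /= sub0r normrN => he v Lv.
apply/eqP; apply: contraT => v0; have v0' : 0 < `|v| by rewrite normr_gt0.
set t := e / (2 * k) in t0 he.
have c0 : 0 < e / (2 * `|v|) by rewrite divr_gt0 // mulr_gt0.
have : `|B (t^-1 *: h) ((e / (2 * `|v|)) *: v)| < 1.
  apply: (Be (_, _)); split; rewrite -ball_normE /= sub0r normrN normrZ.
    by rewrite gtr0_norm ?invr_gt0 // mulrC ltr_pdivrMr.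
  rewrite gtr0_norm // invfM mulrA mulfVK ?gt_eqF //.
  by rewrite ltr_pdivrMr // ltr_pMr // ltr1n.
have tc0 : 0 < t^-1 * (e / (2 * `|v|)) by rewrite mulr_gt0 // invr_gt0.
rewrite BZl BZr scalerA normrZ (gtr0_norm tc0).
have -> : `|B h v| = `|L v|.
  by rewrite -[B h v]opprK -(addr0_eq Lv) opprK normrN.
have -> : t^-1 * (e / (2 * `|v|)) = k / `|v|.
  by rewrite /t; field; rewrite !gt_eqF.
rewrite mulrAC ltr_pdivrMr // mul1r => /(le_lt_trans (Lk v)).
by rewrite ltxx.
Qed.

End Perturbation.

(** * Charts of iterated tangent bundles *)

Section GoodCharts.
Variable R : realType.
Implicit Types N P Q : charted R.

(* The axioms of an atlas that pass from N to Tan N. *)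
Record good_atlas N : Prop := GoodAtlas {
  dom_at : forall z : N, dom (at_ z) z;
  phiK : forall i (z : N), dom i z -> chi i (phi i z) = z;
  overlap_open : forall i j : idx N, open (phi i @` (dom i `&` dom j));
  transition_smooth : forall i j : idx N,
    smooth_on (phi i @` (dom i `&` dom j)) (phi j \o chi i)
}.

Section OneAtlas.
Variables (N : charted R) (gN : good_atlas N).
Implicit Types (i j : idx N) (z : N).

Lemma chart_near i j z : dom i z -> dom j z -> \forall u \near phi i z,
  [/\ dom i (chi i u), dom j (chi i u) & phi i (chi i u) = u].
Proof.
move=> iz jz; apply: (near_open (overlap_open gN i j)); first by exists z.
by move=> _ [y [iy jy] <-]; rewrite phiK.
Qed.

Lemma chart_near_at i z : dom i z ->
  \forall u \near phi i z, dom i (chi i u) /\ phi i (chi i u) = u.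
Proof. by move=> iz; apply: filterS (chart_near iz iz) => u []. Qed.

Lemma smooth_transition i j z : dom i z -> dom j z ->
  smooth (phi j \o chi i) (phi i z).
Proof.
move=> iz jz; exists (phi i @` (dom i `&` dom j)).
by split; [exact: overlap_open | exists z | exact: transition_smooth].
Qed.

Lemma phi_tanE i (z : Tan N) :
  phi (c := Tan N) i z = tangent (phi i \o chi (at_ z.1)) (phi (at_ z.1) z.1, z.2).
Proof. by rewrite /tangent /= (phiK gN) //; exact: dom_at. Qed.

Lemma phi_at (z : Tan N) : phi (c := Tan N) (at_ z.1) z = (phi (at_ z.1) z.1, z.2).
Proof.
rewrite phi_tanE -[RHS]tangent_id; apply: tangent_near; last exact: differentiable_id.
by apply: filterS (chart_near_at (dom_at gN z.1)) => u [_ /= ->].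
Qed.

(** A vector is stored by its components in the preferred chart at its base point, so the left-hand
    side passes through that chart. The chain rule eliminates it. *)
Lemma phi_chi_tan i j (u : model N * model N) :
  dom i (chi i u.1) -> dom j (chi i u.1) -> phi i (chi i u.1) = u.1 ->
  phi (c := Tan N) j (chi (c := Tan N) i u) = tangent (phi j \o chi i) u.
Proof.
move=> iu ju uE; set a := chi i u.1 in iu ju uE *.
have au := dom_at gN a.
rewrite phi_tanE /= -/a.
have -> : (phi (at_ a) a, 'd (phi (at_ a) \o chi i) (u.1) u.2) =
  tangent (phi (at_ a) \o chi i) u by [].
have d1 : differentiable (phi (at_ a) \o chi i) u.1.
  by rewrite -uE; apply: smooth_differentiable; apply: smooth_transition.
have d2 : differentiable (phi j \o chi (at_ a)) ((phi (at_ a) \o chi i) u.1).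
  by apply: smooth_differentiable; apply: smooth_transition.
rewrite -tangent_comp //; apply: tangent_near.
  rewrite -uE; apply: filterS (chart_near iu au) => w [iw aw wE] /=.
  by rewrite phiK.
by rewrite -uE; apply: smooth_differentiable; exact: smooth_transition.
Qed.

Lemma phiK_tan i (z : Tan N) : dom i z.1 ->
  chi (c := Tan N) i (phi (c := Tan N) i z) = z.
Proof.
case: z => a v /= ia; rewrite phiK //; congr pair.
have au := dom_at gN a.
have d1 : differentiable (phi i \o chi (at_ a)) (phi (at_ a) a).
  by apply: smooth_differentiable; apply: smooth_transition.
have := @diff_comp _ _ _ _ (phi i \o chi (at_ a)) (phi (at_ a) \o chi i) _ d1.
rewrite /= phiK // => /(_ _)/(congr1 (@^~ v)) /= <-.
  rewrite (diff_near (f := id)) ?diff_val //.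
  by apply: filterS (chart_near au ia) => w [aw iw wE] /=; rewrite phiK.
by apply: smooth_differentiable; apply: smooth_transition.
Qed.

(** The transitions of the induced charts are the tangent maps of the old transitions. Order [k] for
    them is part of order [k.+1] below, hence smoothness of all orders is inherited. *)
Lemma good_Tan : good_atlas (Tan N).
Proof.
have imE i j : phi (c := Tan N) i @` (dom (c := Tan N) i `&` dom (c := Tan N) j) =
    (phi i @` (dom i `&` dom j)) `*` setT.
  apply/seteqP; split => [_ [z [iz jz] <-]|u [[a [ia ja] au] _]].
    by split => //; exists z.1.
  have iu : chi i u.1 = a by rewrite -au phiK.
  exists (chi (c := Tan N) i u); first by split; rewrite /= iu.
  rewrite phi_chi_tan ?iu // -[RHS]tangent_id; apply: tangent_near.
    by rewrite -au; apply: filterS (chart_near_at ia) => w [_ /= ->].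
  exact: differentiable_id.
split.
- by move=> z; exact: (dom_at gN z.1).
- exact: phiK_tan.
- by move=> /= i j; rewrite imE; exact: open_setX (overlap_open gN i j) openT.
- move=> /= i j k; rewrite imE.
  refine (@Ck_on_eq R k (model N * model N)%type (model N * model N)%type _
    (tangent (phi j \o chi i)) _ _ _ _).
  + exact: open_setX (overlap_open gN i j) openT.
  + move=> u; rewrite inE => -[[a [ia ja] au] _].
    by rewrite -phi_chi_tan //= -au phiK.
  + by have [] := transition_smooth gN i j k.+1.
Qed.

End OneAtlas.

Definition smooth_in N P (i : idx N) (j : idx P) (f : N -> P) (z : N) :=
  smooth (phi j \o f \o chi i) (phi i z) /\
  \forall u \near phi i z, dom j (f (chi i u)).

Lemma smooth_in_change N P (i i' : idx N) (j j' : idx P) (f : N -> P) z :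
  good_atlas N -> good_atlas P ->
  dom i z -> dom i' z -> dom j (f z) -> dom j' (f z) ->
  smooth_in i j f z -> smooth_in i' j' f z.
Proof.
move=> gN gP iz i'z jz j'z [sf nf].
have st := smooth_transition gN i'z iz.
pose Q2 w := [/\ dom j (chi j w), dom j' (chi j w) & phi j (chi j w) = w].
have n2 : \forall w \near phi i z, Q2 ((phi j \o f \o chi i) w).
  apply: (@near_continuous _ _ _ _ _ Q2 (smooth_continuous sf)).
  by rewrite /= phiK //; exact: chart_near.
pose Q1 w := dom j (f (chi i w)) /\ Q2 ((phi j \o f \o chi i) w).
have n1 : \forall u \near phi i' z, Q1 ((phi i \o chi i') u).
  apply: (@near_continuous _ _ _ _ _ Q1 (smooth_continuous st)).
  by rewrite /= phiK //; exact: filterI.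
have fE : \forall u \near phi i' z, [/\ dom j' (f (chi i' u)),
    dom j (f (chi i' u)) & chi i (phi i (chi i' u)) = chi i' u].
  apply: filterS2 (chart_near gN i'z iz) n1 => u [i'u iu uE] [] /=.
  by rewrite (phiK gN iu) => jf [_ + _]; rewrite /= (phiK gP jf).
split; last by apply: filterS fE => u [].
apply: (@smooth_near _ _ _ ((phi j' \o chi j) \o (phi j \o f \o chi i) \o
    (phi i \o chi i'))).
  by apply: filterS fE => u [_ ju uE] /=; rewrite uE phiK.
apply: smooth_comp => //; apply: smooth_comp; rewrite /= !phiK //.
exact: smooth_transition.
Qed.

(** [smooth_at] refers to preferred charts, which vary with the point. This allows any charts around
    [z] and [f z], in particular charts kept fixed while the point moves. *)
Lemma smooth_atP N P (i : idx N) (j : idx P) (f : N -> P) z :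
  good_atlas N -> good_atlas P -> dom i z -> dom j (f z) ->
  smooth_at f z <-> smooth_in i j f z.
Proof.
move=> gN gP iz jz.
have az := dom_at gN z; have afz := dom_at gP (f z).
split=> [[D [oD Dz Dsub Ddom sf]]|si].
  apply: (@smooth_in_change _ _ (at_ z) i (at_ (f z)) j) => //; split.
    by exists D.
  exact: near_open oD Dz Ddom.
have [[D [oD Dz sf]]] : smooth_in (at_ z) (at_ (f z)) f z.
  exact: (@smooth_in_change _ _ i (at_ z) j (at_ (f z))).
move=> /nearP_open[D' [oD' D'z D'f]].
pose D'' := phi (at_ z) @` (dom (at_ z) `&` dom (at_ z)).
have oD'' : open D'' := overlap_open gN (at_ z) (at_ z).
exists (D `&` D' `&` D''); split.
- by apply: openI => //; exact: openI.
- by split => //; exists z.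
- by move=> u [_ [y [yz _] <-]]; exists y.
- by move=> u [[_ /D'f]].
- by move=> k; apply: Ck_on_sub (sf k) => u [[]].
Qed.

Lemma smooth_at_near N P (i : idx N) (f : N -> P) z :
  good_atlas N -> good_atlas P -> dom i z -> smooth_at f z ->
  \forall u \near phi i z, smooth_at f (chi i u).
Proof.
move=> gN gP iz; have jz := dom_at gP (f z).
move=> /(smooth_atP gN gP iz jz)[/smooth_nearby sf nf].
have := chart_near_at gN iz.
have nnf := nf; move/nearP_open : nnf => [D [oD Dz Df]].
have nD : \forall u \near phi i z, D u by exact: near_open oD Dz _.
apply: filterS3 sf nD => u sfu Du [iu uE].
apply/(smooth_atP gN gP iu (Df _ Du)); split; rewrite uE //.
exact: near_open oD Du Df.
Qed.

(** The definition of [tmap] uses preferred charts. Transitions to [i] and [j] enter on both sides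
    and cancel by functoriality of [tangent]. *)
Lemma tmapE N P (i : idx N) (j : idx P) (f : N -> P) (z : Tan N) :
  good_atlas N -> good_atlas P -> dom i z.1 -> dom j (f z.1) ->
  smooth_at f z.1 ->
  phi (c := Tan P) j (tmap f z) =
    tangent (phi j \o f \o chi i) (phi (c := Tan N) i z).
Proof.
case: z => a v gN gP; rewrite [(a, v).1]/= => ia ja sf.
have aa := dom_at gN a; have fa := dom_at gP (f a).
have [sat nat_] := (smooth_atP gN gP aa fa).1 sf.
have [sij nij] := (smooth_atP gN gP ia ja).1 sf.
rewrite (phi_tanE gP) (phi_tanE gN) /=.
set F := phi (at_ (f a)) \o f \o chi (at_ a).
have -> : (phi (at_ (f a)) (f a), 'd F (phi (at_ a) a) v) =
    tangent F (phi (at_ a) a, v) by rewrite /tangent /= /F /= phiK.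
have dF : differentiable F (phi (at_ a) a) by exact: smooth_differentiable.
have Fa : F (phi (at_ a) a) = phi (at_ (f a)) (f a) by rewrite /F /= phiK.
have dj : differentiable (phi j \o chi (at_ (f a))) (F (phi (at_ a) a)).
  by rewrite Fa; apply: smooth_differentiable; exact: smooth_transition.
have di : differentiable (phi i \o chi (at_ a)) (phi (at_ a) a).
  by apply: smooth_differentiable; exact: smooth_transition.
have dij : differentiable (phi j \o f \o chi i) ((phi i \o chi (at_ a)) (phi (at_ a) a)).
  by rewrite /= phiK //; exact: smooth_differentiable.
rewrite -!tangent_comp //; apply: tangent_near.
  apply: filterS2 (chart_near gN aa ia) nat_ => u [au iu uE] fu /=.
  by rewrite /F /= !phiK.
exact: differentiable_comp.
Qed.

Lemma smooth_tmap N P (f : N -> P) (z : Tan N) :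
  good_atlas N -> good_atlas P -> smooth_at f z.1 -> smooth_at (tmap f) z.
Proof.
move=> gN gP sf.
have aa := dom_at gN z.1; have fa := dom_at gP (f z.1).
have [sat nat_] := (smooth_atP gN gP aa fa).1 sf.
apply/(@smooth_atP (Tan N) (Tan P) (at_ z.1) (at_ (f z.1)) _ _ (good_Tan gN)
  (good_Tan gP)) => //.
have pE : phi (c := Tan N) (at_ z.1) z = (phi (at_ z.1) z.1, z.2).
  exact: phi_at.
have fst_near (Q : model N -> Prop) : (\forall u \near phi (at_ z.1) z.1, Q u) ->
    \forall w \near phi (c := Tan N) (at_ z.1) z, Q w.1.
  by rewrite pE => H; apply: cvg_fst.
split; last first.
  exact: (fst_near (fun u => dom (at_ (f z.1)) (f (chi (at_ z.1) u)))).
apply: (@smooth_near _ _ _ (tangent (phi (at_ (f z.1)) \o f \o chi (at_ z.1)))).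
  have := fst_near _ (chart_near_at gN aa).
  have := fst_near _ (smooth_at_near gN gP aa sf).
  apply: filterS3 (fst_near _ nat_) => w fw sw [aw wE].
  symmetry; apply: (etrans (tmapE (z := chi (c := Tan N) (at_ z.1) w) gN gP aw fw sw)).
  rewrite phi_chi_tan // (tangent_near (f := id)).
  - by rewrite tangent_id.
  - by rewrite -wE; apply: filterS (chart_near_at gN aw) => u [].
  - exact: differentiable_id.
by apply: smooth_tangent; rewrite pE.
Qed.

Lemma tmap_comp N P Q (f : N -> P) (g : P -> Q) (z : Tan N) :
  good_atlas N -> good_atlas P -> good_atlas Q ->
  smooth_at f z.1 -> smooth_at g (f z.1) ->
  tmap (g \o f) z = tmap g (tmap f z).
Proof.
move=> gN gP gQ sf sg; rewrite /tmap /=; congr pair.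
have aa := dom_at gN z.1; have fa := dom_at gP (f z.1).
have ga := dom_at gQ (g (f z.1)).
have [{}sf nf] := (smooth_atP gN gP aa fa).1 sf.
have [{}sg ng] := (smooth_atP gP gQ fa ga).1 sg.
set F := phi (at_ (f z.1)) \o f \o chi (at_ z.1) in sf *.
set G := phi (at_ (g (f z.1))) \o g \o chi (at_ (f z.1)) in sg *.
have FE : phi (at_ (f z.1)) (f z.1) = F (phi (at_ z.1) z.1).
  by rewrite /F /= phiK.
have dF := smooth_differentiable sf; rewrite FE in sg *.
have dG := smooth_differentiable sg.
have nE : \forall u \near phi (at_ z.1) z.1,
    (G \o F) u = (phi (at_ (g (f z.1))) \o (g \o f) \o chi (at_ z.1)) u.
  by apply: filterS nf => u fu; rewrite /G /F /= phiK.
have e1 := diff_near nE (differentiable_comp dF dG).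
exact: (congr1 (fun h : model N -> model Q => h z.2) (etrans e1 (diff_comp dF dG))).
Qed.

Lemma tmap_near N P (f g : N -> P) (z : Tan N) :
  good_atlas N -> good_atlas P -> smooth_at f z.1 ->
  (\forall u \near phi (at_ z.1) z.1, f (chi (at_ z.1) u) = g (chi (at_ z.1) u)) ->
  tmap g z = tmap f z.
Proof.
move=> gN gP sf fg; have aa := dom_at gN z.1.
have fgz : f z.1 = g z.1 by have := nbhs_singleton fg; rewrite /= phiK.
have [{}sf _] := (smooth_atP gN gP aa (dom_at gP (f z.1))).1 sf.
rewrite /tmap -fgz; congr pair.
rewrite (diff_near (f := phi (at_ (f z.1)) \o f \o chi (at_ z.1))) //.
  by apply: filterS fg => u /= ->.
exact: smooth_differentiable.
Qed.

End GoodCharts.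

(** * The projections of the iterated tangent bundles *)

Section Projections.
Variable R : realType.
Implicit Types N : charted R.

Lemma tmap_id N (z : Tan N) : good_atlas N -> tmap (@id N) z = z.
Proof.
case: z => x v gN; rewrite /tmap /=; congr pair.
have nE : \forall u \near phi (at_ x) x, u = (phi (at_ x) \o id \o chi (at_ x)) u.
  by apply: filterS (chart_near_at gN (dom_at gN x)) => u [_ e]; exact: esym e.
have h := diff_val (is_diff_def := is_diff_near nE (is_diff_id (phi (at_ x) x))).
exact: (congr1 (fun f : model N -> model N => f v) h).
Qed.

Lemma proj_chart N (i : idx N) (z : Tan N) : good_atlas N -> dom i z.1 ->
  \forall w \near phi (c := Tan N) i z,
    w.1 = (phi i \o @Defs.proj R N \o chi (c := Tan N) i) w /\
    dom i (@Defs.proj R N (chi (c := Tan N) i w)).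
Proof.
move=> gN iz; have H := chart_near_at gN iz.
have H1 : \forall w \near (phi (c := Tan N) i z : model N * model N),
    (dom i (chi i w.1) /\ phi i (chi i w.1) = w.1).
  exact: (@near_fst_pair _ _ _ (fun u => dom i (chi i u) /\ phi i (chi i u) = u)).
by apply: filterS H1 => w [iw e]; split; rewrite /= ?e.
Qed.

Lemma proj_smooth N (z : Tan N) : good_atlas N -> smooth_at (@Defs.proj R N) z.
Proof.
move=> gN; have iz := dom_at gN z.1.
apply/(@smooth_atP R (Tan N) N (at_ z.1) (at_ z.1) _ z (good_Tan gN) gN iz iz).
split; last by apply: filterS (proj_chart gN iz) => w [].
apply: (@smooth_near _ _ _ (@fst (model N) (model N))); last exact: smooth_fst.
by apply: filterS (proj_chart gN iz) => w [].
Qed.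

Lemma tmap_proj N (z : Tan (Tan N)) : good_atlas N ->
  tmap (@Defs.proj R N) z = (z.1.1, z.2.1).
Proof.
move=> gN; have iz := dom_at gN z.1.1.
rewrite /tmap; congr pair.
have nE : \forall w \near (phi (c := Tan N) (at_ z.1.1) z.1 : model N * model N),
    w.1 = (phi (at_ z.1.1) \o @Defs.proj R N \o chi (c := Tan N) (at_ z.1.1)) w.
  by apply: filterS (proj_chart gN iz) => w [].
have h := diff_val (is_diff_def := is_diff_near nE (is_diff_fst _)).
exact: (congr1 (fun f : model N * model N -> model N => f z.2) h).
Qed.

Lemma tmap_tmap_proj N (z : Tan (Tan (Tan N))) : good_atlas N ->
  tmap (tmap (@Defs.proj R N)) z = ((z.1.1.1, z.1.2.1), (z.2.1.1, z.2.2.1)).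
Proof.
move=> gN; have iz := dom_at gN z.1.1.1; have gT := good_Tan gN.
set i := at_ z.1.1.1 in iz.
rewrite {1}/tmap tmap_proj //; congr pair.
pose pr (w : (model N * model N) * (model N * model N)) := (w.1.1, w.2.1).
have nE : \forall w \near (phi (c := Tan (Tan N)) i z.1 :
    (model N * model N) * (model N * model N)),
    pr w = (phi (c := Tan N) i \o tmap (@Defs.proj R N) \o chi (c := Tan (Tan N)) i) w.
  have H := chart_near_at gT (i := i) (z := z.1.1) iz.
  have H1 : \forall w \near (phi (c := Tan (Tan N)) i z.1 :
    (model N * model N) * (model N * model N)),
    (dom (c := Tan N) i (chi (c := Tan N) i w.1) /\
     phi (c := Tan N) i (chi (c := Tan N) i w.1) = w.1).
    exact: (@near_fst_pair _ _ _ (fun u => dom (c := Tan N) i (chi (c := Tan N) i u) /\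
      phi (c := Tan N) i (chi (c := Tan N) i u) = u)).
  apply: filterS H1 => w [iw wE].
  pose m : Tan (Tan N) := chi (c := Tan (Tan N)) i w.
  have sm := proj_smooth m.1 gN.
  have := @tmapE R (Tan N) N i i (@Defs.proj R N) m gT gN iw iw sm.
  rewrite (phi_chi_tan (i := i) (j := i) (u := w) gT iw iw wE).
  rewrite [tangent (_ \o chi _) w](tangent_near (f := id)); last exact: differentiable_id.
    rewrite tangent_id => e; apply: esym; apply: (etrans e).
    rewrite (tangent_near (f := fst)).
    - by rewrite /tangent (diff_val (is_diff_def := is_diff_fst w.1)).
    - by rewrite -wE; apply: filterS (proj_chart (z := chi (c := Tan N) i w.1) gN iw) => ? [].
    - exact: (ex_diff (is_diff_def := is_diff_fst w.1)).
  by rewrite -wE; apply: filterS (chart_near_at (z := chi (c := Tan N) i w.1) gT iw) => ? [].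
have lpr : linear pr by move=> c [[? ?] [? ?]] [[? ?] [? ?]].
have cpr : continuous pr.
  have c1 := @fst_continuous _ (model N * model N)%type (model N * model N)%type.
  have c2 := @snd_continuous _ (model N * model N)%type (model N * model N)%type.
  have c3 := @fst_continuous _ (model N) (model N).
  exact: pair_continuous (comp_continuous c1 c3) (comp_continuous c2 c3).
have h := diff_val (is_diff_def := is_diff_near nE (lin_is_diff _ lpr cpr)).
exact: (congr1 (fun f : (model N * model N) * (model N * model N) ->
  model N * model N => f z.2) h).
Qed.

Lemma smooth_at_id N (z : N) : good_atlas N -> smooth_at (@id N) z.
Proof.
move=> gN; have iz := dom_at gN z.
apply/(@smooth_atP R N N (at_ z) (at_ z) id z gN gN iz iz); split.
  exact: (smooth_transition gN iz iz).
by apply: filterS (chart_near_at gN iz) => u [].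
Qed.

Lemma tmap_proj_section N (X : N -> Tan N) (z : Tan N) : good_atlas N ->
  (forall x, Defs.proj (X x) = x) -> smooth_at X z.1 ->
  tmap (@Defs.proj R N) (tmap X z) = z.
Proof.
move=> gN pX sX.
have := tmap_comp gN (good_Tan gN) gN sX (proj_smooth (X z.1) gN).
have -> : @Defs.proj R N \o X = id by apply/funext.
by rewrite (tmap_id z gN) => <-.
Qed.

(** The tangent functor applied twice to the identity [proj \o X = id]. It recovers the components
    of w from those of X_** w. *)
Lemma tmap_tmap_proj_section N (X : N -> Tan N) (w : Tan (Tan N)) :
  good_atlas N -> (forall x, Defs.proj (X x) = x) -> smooth_at X w.1.1 ->
  tmap (tmap (@Defs.proj R N)) (tmap (tmap X) w) = w.
Proof.
move=> gN pX sX; have gT := good_Tan gN.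
have s1 := smooth_tmap (z := w.1) gN gT sX.
have s2 := smooth_tmap gT gN (proj_smooth (tmap X w.1).1 gN).
have := tmap_comp gT (good_Tan gT) gT s1 s2 => <-.
rewrite -[RHS](tmap_id w gT); apply: (tmap_near gT gT (smooth_at_id w.1 gT)).
have iw := dom_at gN w.1.1; have sn := smooth_at_near gN gT iw sX.
have ns : \forall u \near (phi (c := Tan N) (at_ w.1.1) w.1 : model N * model N),
    smooth_at X (chi (at_ w.1.1) u.1).
  exact: (@near_fst_pair _ _ _ (fun u => smooth_at X (chi (at_ w.1.1) u))).
by apply: filterS ns => u su; rewrite /= tmap_proj_section.
Qed.

Lemma tmap_tmap_chart N (i j : idx N) (f : N -> N) (z : Tan (Tan N)) :
  good_atlas N -> dom i z.1.1 -> dom j (f z.1.1) -> smooth_at f z.1.1 ->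
  phi (c := Tan (Tan N)) j (tmap (tmap f) z) =
    tangent (tangent (phi j \o f \o chi i)) (phi (c := Tan (Tan N)) i z).
Proof.
move=> gN iz jz sf; have gT := good_Tan gN.
have sT := smooth_tmap (z := z.1) gN gN sf.
apply: (etrans (@tmapE R (Tan N) (Tan N) i j (tmap f) z gT gT iz jz sT)).
have [sl nj] := (smooth_atP gN gN iz jz).1 sf.
have H := chart_near_at gT (i := i) (z := z.1) iz.
have H1 : \forall w \near (phi (c := Tan N) i z.1 : model N * model N),
  (smooth_at f (chi i w.1) /\ dom j (f (chi i w.1))).
  have H1 : \forall u \near phi i z.1.1, smooth_at f (chi i u) /\ dom j (f (chi i u)).
    by apply: filterI => //; exact: smooth_at_near.
  exact: (@near_fst_pair _ _ _ (fun u => smooth_at f (chi i u) /\ dom j (f (chi i u)))).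
apply: tangent_near; last by apply: smooth_differentiable; apply: smooth_tangent.
apply: filterS2 H H1 => w [iw wE] [sw jw].
have := @tmapE R N N i j f (chi (c := Tan N) i w) gN gN iw jw sw.
by rewrite wE => /esym.
Qed.

End Projections.

(** * The base manifold: induced charts of its tangent bundles, arrows and jets in charts *)

Section Charts.
Variables (R : realType) (n : nat) (M : manifold R n).
Local Notation E := 'rV[R]_n.
Local Notation phi0 := (@phi R (Tk M 0)).
Local Notation phi1 := (@phi R (Tk M 1)).
Local Notation phi2 := (@phi R (Tk M 2)).
Local Notation chi0 := (@chi R (Tk M 0)).
Local Notation chi1 := (@chi R (Tk M 1)).
Local Notation chi2 := (@chi R (Tk M 2)).
Local Notation dom0 := (@dom R (Tk M 0)).
Local Notation at0 := (@at_ R (Tk M 0)).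
Local Notation at2 := (@at_ R (Tk M 2)).
Implicit Types (i j : midx M) (x y : M).

Lemma chart_set_near (U : set M) i x : open U -> U x -> dom0 i x ->
  \forall u \near phi0 i x, U (chi0 i u).
Proof.
move=> oU Ux ix; apply: (@mchi_continuous _ _ M i (phi0 i x)); first by exists x.
by rewrite -[mchi _ _]/(chi0 i (phi0 i x)) /= mphiK //; apply: open_nbhs_nbhs.
Qed.

Lemma good_M : good_atlas (Tk M 0).
Proof.
split.
- exact: mat_dom.
- exact: mphiK.
- move=> i j; rewrite openE => _ [x [ix jx] <-].
  have nd : \forall u \near phi0 i x, (phi0 i @` dom0 i) u.
    by apply: (near_open (@mphi_open _ _ M i)) => //; exists x.
  apply: filterS2 nd (chart_set_near (@mdom_open _ _ M j) jx ix).
  by move=> _ [y iy <-]; rewrite /= mphiK // => jy; exists y.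
- exact: mtransition.
Qed.

Lemma good_Tk k : good_atlas (Tk M k).
Proof. by elim: k => [|k IH]; [exact: good_M | exact: good_Tan]. Qed.

Let g0 := good_Tk 0.
Let g1 := good_Tk 1.
Let g2 := good_Tk 2.

Lemma phi1_linear i x : linear (fun v => (phi1 i (x, v)).2).
Proof. by move=> a v w /=; rewrite linearP. Qed.

Lemma chi1_linear i u : linear (fun v => (chi1 i (u, v)).2).
Proof. by move=> a v w /=; rewrite linearP. Qed.

Lemma phi1_at x v : phi1 (at0 x) (x, v) = (phi0 (at0 x) x, v).
Proof. exact: (phi_at g0 (x, v)). Qed.

Lemma chi1_at x v : chi1 (at0 x) (phi0 (at0 x) x, v) = (x, v).
Proof. by rewrite -phi1_at; apply: (phiK g1); exact: (dom_at g0 x). Qed.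

Lemma phi2_at (z : Tk M 2) : phi2 (at0 z.1.1) z =
  ((phi0 (at0 z.1.1) z.1.1, z.1.2), z.2).
Proof.
exact: etrans (phi_at g1 z) (congr1 (fun w => (w, z.2)) (phi_at g0 z.1)).
Qed.

Lemma phi1K i (z : Tk M 1) : dom0 i z.1 -> chi1 i (phi1 i z) = z.
Proof. exact: (phiK g1). Qed.

Lemma chi1K i u v : dom0 i (chi0 i u) -> phi0 i (chi0 i u) = u ->
  phi1 i (chi1 i (u, v)) = (u, v).
Proof.
move=> iu uE; rewrite (phi_chi_tan g0) // -[RHS]tangent_id.
apply: tangent_near (@differentiable_id _ _ _).
by rewrite /= -uE; apply: filterS (chart_near_at g0 iu) => w [_ /= ->].
Qed.

Lemma chi2K i z : dom0 i (chi0 i z.1.1) -> phi0 i (chi0 i z.1.1) = z.1.1 ->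
  phi2 i (chi2 i z) = z.
Proof.
move=> iu uE; have zE : phi1 i (chi1 i z.1) = z.1.
  by rewrite [z.1]surjective_pairing chi1K.
apply: (etrans (phi_chi_tan (i := i) (j := i) (u := z) g1 iu iu zE)).
rewrite -[RHS]tangent_id; apply: tangent_near (@differentiable_id _ _ _).
rewrite -zE; apply: filterS (chart_near_at (i := i) (z := chi1 i z.1) g1 iu).
by move=> w [_ /= ->].
Qed.

Section Arrows.
Implicit Types xi : arrow M 1.

Lemma B1P xi : B1 xi -> exists L : {linear E -> E},
  bijective L /\ xi = lin_arrow (src xi) (tgt xi) L.
Proof. by move=> [x [y [L [bL ->]]]]; exists L. Qed.

(** The linear map that expresses the arrow in the chart [i] at its source and the chart [j] at its
    target. *)
Definition arrow_lin i j xi (v : E) : E :=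
  (phi1 j (act xi (chi1 i (phi0 i (src xi), v)))).2.

Lemma act_B1 xi : B1 xi -> exists L : {linear E -> E},
  bijective L /\ forall v, act xi (src xi, v) = (tgt xi, L v).
Proof.
move=> /B1P[L [bL ->]]; exists L; split=> // v /=.
by case: asboolP.
Qed.

Lemma arrow_lin_linear i j xi : B1 xi -> dom0 i (src xi) ->
  linear (arrow_lin i j xi).
Proof.
move=> Bxi ix; have [L [_ actE]] := act_B1 Bxi.
have E1 v : act xi (chi1 i (phi0 i (src xi), v)) =
    (tgt xi, L (chi1 i (phi0 i (src xi), v)).2).
  rewrite -actE; congr act; apply/injective_projections => //=.
  exact: mphiK.
move=> a v w; rewrite /arrow_lin !E1.
by rewrite chi1_linear linearP phi1_linear.
Qed.

Lemma arrow_linP i j xi (z : Tk M 1) : B1 xi -> dom0 i (src xi) ->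
  z.1 = src xi -> phi1 j (act xi z) = (phi0 j (tgt xi), arrow_lin i j xi (phi1 i z).2).
Proof.
move=> Bxi ix zx; have [L [_ actE]] := act_B1 Bxi.
have -> : arrow_lin i j xi (phi1 i z).2 = (phi1 j (act xi z)).2.
  by rewrite /arrow_lin -{1}zx -[(_, _)]/(phi1 i z) phi1K // zx.
by case: z zx => z1 z2 /= ->; rewrite actE.
Qed.

Lemma arrow_lin_at xi v : B1 xi ->
  arrow_lin (at0 (src xi)) (at0 (tgt xi)) xi v = (act xi (src xi, v)).2.
Proof.
move=> Bxi; have [L [_ actE]] := act_B1 Bxi.
by rewrite /arrow_lin chi1_at actE phi1_at.
Qed.

End Arrows.

Lemma jetE k (b : M -> arrow M k) x (z : Tk M k.+1) :
  base z = x -> act (jet b x) z = tmap (hat b) z.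
Proof. by move=> zx /=; case: asboolP. Qed.

(** * Connections and affine jets in charts *)

Section Bisections.
Implicit Types a : local_bisection (@B1 R n M).

(* bis0 and bis1 are b^0 and the fibre part of hat b for b = a, in charts. *)
Definition bis0 i j a (u : E) : E := phi0 j (tgt (a (chi0 i u))).
Definition bis1 i j a (z : E * E) : E := (phi1 j (hat a (chi1 i z))).2.

Lemma hat_base a x (z : Tk M 1) : bdom a x -> z.1 = x -> (hat a z).1 = tgt (a x).
Proof.
move=> ax; have [L [_ actE]] := act_B1 (bisection_in ax).
case: z => _ v /= ->; have := actE v; rewrite (bisection_src ax) => actE'.
by rewrite /hat [base _]/= actE'.
Qed.

Variables (a : local_bisection (@B1 R n M)) (x : M) (i j : midx M).
Hypotheses (ax : bdom a x) (ix : dom0 i x) (jy : dom0 j (tgt (a x))).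
Local Notation u0 := (phi0 i x).

Lemma smooth_tgt : @smooth_at R (Tk M 0) (Tk M 0) (fun y : M => tgt (a y)) x.
Proof. by have [_ _ _ + _] := bisection_diffeo a; exact. Qed.

Lemma bis_near : \forall u \near u0,
  [/\ dom0 i (chi0 i u), phi0 i (chi0 i u) = u, bdom a (chi0 i u) &
      dom0 j (tgt (a (chi0 i u)))].
Proof.
have [oU _ _ _ _] := bisection_diffeo a.
have [_ nj] := (smooth_atP g0 g0 ix jy).1 smooth_tgt.
apply: filterS3 (chart_near_at g0 ix) (chart_set_near oU ax ix) nj.
by move=> u [].
Qed.

Lemma bis0_smooth : smooth (bis0 i j a) u0.
Proof. by have [] := (smooth_atP g0 g0 ix jy).1 smooth_tgt. Qed.

Lemma bis0E : bis0 i j a u0 = phi0 j (tgt (a x)).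
Proof. by rewrite /bis0 /= mphiK. Qed.

Lemma hat_chart u v : dom0 i (chi0 i u) -> phi0 i (chi0 i u) = u ->
  bdom a (chi0 i u) ->
  phi1 j (hat a (chi1 i (u, v))) = (bis0 i j a u, bis1 i j a (u, v)).
Proof.
move=> iu uE au; have Ba := bisection_in au.
rewrite [LHS]surjective_pairing; congr pair.
have sa := bisection_src au.
by rewrite (arrow_linP (i := i)) ?sa.
Qed.

Lemma bis1_linear u : dom0 i (chi0 i u) -> phi0 i (chi0 i u) = u ->
  bdom a (chi0 i u) -> linear (fun v => bis1 i j a (u, v)).
Proof.
move=> iu uE au; have Ba := bisection_in au.
have sa := bisection_src au.
have := @arrow_lin_linear i j _ Ba; rewrite /arrow_lin sa uE; exact.
Qed.

Lemma bis1_arrow_lin u v : phi0 i (chi0 i u) = u -> bdom a (chi0 i u) ->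
  bis1 i j a (u, v) = arrow_lin i j (a (chi0 i u)) v.
Proof. by move=> uE au; rewrite /arrow_lin (bisection_src au) uE. Qed.

Lemma bis1_smooth v : smooth (bis1 i j a) (u0, v).
Proof.
have iu : dom0 i (chi0 i u0) by rewrite (phiK g0).
have uE : phi0 i (chi0 i u0) = u0 by rewrite (phiK g0).
pose z : Tk M 1 := chi1 i (u0, v).
have zx : z.1 = x by rewrite /= mphiK.
have sz : smooth_at (hat a) z by apply: bisection_smooth; rewrite /= mphiK.
have hz : dom0 j (hat a z).1 by rewrite (hat_base ax zx).
have iz : dom0 i z.1 by rewrite zx.
have [s _] := (@smooth_atP R (Tk M 1) (Tk M 1) i j (hat a) z g1 g1 iz hz).1 sz.
rewrite chi1K // in s.
exact: smooth_comp s (smooth_snd _).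
Qed.

End Bisections.

Section OneBisection.
Variables (a : local_bisection (@B1 R n M)) (x : M) (i j : midx M).
Hypotheses (ax : bdom a x) (ix : dom0 i x) (jy : dom0 j (tgt (a x))).
Local Notation u0 := (phi0 i x : E).
Local Notation f := (bis0 i j a).
Local Notation F := (bis1 i j a).

(** The quadratic term of the 1-jet of [a] at [x]: the fibre part is differentiated along the base
    direction [V] with the fibre components [X] held fixed. *)
Definition bis_diff (V X : E) : E := 'd F (u0, X) (V, 0).

Lemma hat_chart_near v : \forall z \near ((u0, v) : E * E),
  phi1 j (hat a (chi1 i z)) = (f z.1, F z).
Proof.
have := @near_fst_pair _ E E _ (u0, v) (bis_near ax ix jy).
by apply: filterS => -[u w] [iu uE au _]; exact: hat_chart.
Qed.

Lemma bis1_linear_at : linear (fun v => F (u0, v)).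
Proof. by apply: bis1_linear; rewrite /= ?mphiK. Qed.

Lemma bis1_differentiable v : differentiable F (u0, v).
Proof. exact/smooth_differentiable/bis1_smooth. Qed.

Lemma is_diff_bis1 X : is_diff u0 (fun u => F (u, X)) (fun V => bis_diff V X).
Proof.
have d1 : is_diff u0 (fun u : E => (u, X)) (fun V : E => (V, 0)).
  exact: is_diff_pair.
exact: is_diff_comp d1 (differentiableP (bis1_differentiable X)).
Qed.

Lemma bis_diff_linearl X : linear (fun V => bis_diff V X).
Proof.
move=> c V V'; rewrite /bis_diff -linearP; congr (_ _).
by rewrite -[RHS]/(c *: V + V', c *: 0 + 0) scaler0 addr0.
Qed.

Lemma bis_diff_linearr V : linear (bis_diff V).
Proof.
move=> c X Y.
have nE : \forall u \near u0, c *: F (u, X) + F (u, Y) = F (u, c *: X + Y).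
  apply: filterS (bis_near ax ix jy) => u [iu uE au _].
  by rewrite (bis1_linear j iu uE au).
have := is_diffD (is_diffZ c (is_diff_bis1 X)) (is_diff_bis1 Y).
move/(is_diff_near nE) => d1; have d2 := is_diff_bis1 (c *: X + Y).
have := diff_val (is_diff_def := d1); rewrite (diff_val (is_diff_def := d2)).
by move=> /(congr1 (@^~ V)).
Qed.

(** The jet acts by the differential of (u, X) |-> (f u, F(u, X)), and F is linear in X, so W enters
    through F itself. *)
Lemma jet_chart (z : Tk M 2) (X V W : E) : base z = x ->
  phi2 i z = ((u0, X), (V, W)) ->
  phi2 j (act (jet a x) z) =
    ((phi0 j (tgt (a x)), F (u0, X)), ('d f u0 V, F (u0, W) + bis_diff V X)).
Proof.
move=> zx zE; rewrite jetE //.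
have sz : smooth_at (hat a) z.1.
  by apply: bisection_smooth; rewrite (_ : base (z.1 : Tk M 1) = x).
have z1x : z.1.1 = x by [].
have iz : dom0 i z.1.1 by rewrite z1x.
have jz : dom0 j (hat a z.1).1 by rewrite (hat_base ax z1x).
apply: (etrans (@tmapE R (Tk M 1) (Tk M 1) i j (hat a) z g1 g1 iz jz sz)).
rewrite zE.
have sf := bis0_smooth ax ix jy; have sF := bis1_smooth ax ix jy X.
have df := smooth_differentiable sf; have dF := smooth_differentiable sF.
have fE : \forall z \near ((u0, X) : E * E), (f z.1, F z) = (phi1 j \o hat a \o chi1 i) z.
  by apply: filterS (hat_chart_near X) => w e; exact: esym e.
have d1 := is_diff_comp (is_diff_fst (u0, X)) (differentiableP df).
have d2 := is_diff_pair d1 (differentiableP dF).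
have d3 := is_diff_near fE d2.
rewrite /tangent (diff_val (is_diff_def := d3)) -(nbhs_singleton fE) /=.
rewrite bis0E //; congr (_, (_, _)).
rewrite [LHS](diff_fibre_linear _ _ dF) 1?addrC //.
exact: bis1_linear_at.
Qed.

Lemma semiholonomic_chart V : semiholonomic a x -> 'd f u0 V = F (u0, V).
Proof.
move=> sh; pose z : Tk M 1 := chi1 i (u0, V).
have zx : base z = x by rewrite /= mphiK.
have zE : phi1 i z = (u0, V) by rewrite chi1K //= mphiK.
have e1 : phi1 j (hat a z) = (f u0, F (u0, V)) by rewrite hat_chart //= mphiK.
have e2 : hat a z = @tmap R (Tk M 0) (Tk M 0) (fun y : M => tgt (a y)) z.
  by rewrite /hat zx sh /=; case: asboolP.
have zx1 : z.1 = x by exact: zx.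
have sz : @smooth_at R (Tk M 0) (Tk M 0) (fun y : M => tgt (a y)) z.1.
  by rewrite zx1; exact: smooth_tgt.
have iz : dom0 i z.1 by rewrite zx1.
have jz : dom0 j (tgt (a z.1)) by rewrite zx1.
have := @tmapE R (Tk M 0) (Tk M 0) i j (fun y : M => tgt (a y)) z g0 g0 iz jz sz.
by rewrite -e2 e1 zE => /(congr1 snd)/esym.
Qed.

End OneBisection.

Lemma jet_base (a : local_bisection (@B1 R n M)) x (z : Tk M 2) :
  bdom a x -> base z = x -> (act (jet a x) z).1.1 = tgt (a x).
Proof. by move=> ax zx; rewrite jetE //=; apply: hat_base. Qed.

Lemma phi1_addT i (p q : Tk M 1) :
  q.1 = p.1 -> (phi1 i (addT p q)).2 = (phi1 i p).2 + (phi1 i q).2.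
Proof.
by case: p q => [p1 p2] [q1 q2] /= ->; rewrite /addT /= linearD.
Qed.

Definition comps i (Y : M -> Tk M 1) (u : E) : E := (phi1 i (Y (chi0 i u))).2.

Definition near_field i x (Y : M -> Tk M 1) :=
  \forall u \near phi0 i x, (Y (chi0 i u)).1 = chi0 i u.

Lemma near_field_at i x Y : dom0 i x -> near_field i x Y -> (Y x).1 = x.
Proof. by move=> ix /nbhs_singleton; rewrite /= mphiK. Qed.

Lemma binvK (a : local_bisection (@B1 R n M)) x :
  bdom a x -> binv a (tgt (a x)) = x.
Proof. by have [_ _ gf _ _] := bisection_diffeo a; exact: gf. Qed.

Section Push.
Variables (a : local_bisection (@B1 R n M)) (x : M) (i j : midx M).
Variable Y : M -> Tk M 1.
Hypotheses (ax : bdom a x) (ix : dom0 i x) (jy : dom0 j (tgt (a x))).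
Local Notation u0 := (phi0 i x : E).
Local Notation w0 := (phi0 j (tgt (a x)) : E).
Local Notation f := (bis0 i j a).
Local Notation F := (bis1 i j a).
Local Notation g := ((fun w => phi0 i (binv a (chi0 j w))) : E -> E).

Lemma binv_smooth : smooth g w0 /\ \forall w \near w0,
  [/\ dom0 i (binv a (chi0 j w)), bdom a (binv a (chi0 j w)) &
      tgt (a (binv a (chi0 j w))) = chi0 j w].
Proof.
have [oU ofU gf sf sg] := bisection_diffeo a.
have fUy : ((fun y : M => tgt (a y)) @` bdom a) (tgt (a x)) by exists x.
have gy : binv a (tgt (a x)) = x by exact: binvK.
have iy : dom0 i (binv a (tgt (a x))) by rewrite gy.
have [s nd] := (@smooth_atP R (Tk M 0) (Tk M 0) j i (binv a) _ g0 g0 jy iy).1 (sg _ fUy).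
split=> //; apply: filterS2 nd (chart_set_near ofU fUy jy) => w iw [x' ax' xw].
have bw : binv a (chi0 j w) = x' by rewrite -xw /= binvK.
by rewrite bw in iw *; split.
Qed.

Lemma binv_inverse : g w0 = u0.
Proof.
by rewrite /= mphiK // binvK.
Qed.

(** Semiholonomy identifies F(u0, .) with the derivative of the base map, whose inverse is the
    derivative of [binv]. *)
Lemma diff_binv X : semiholonomic a x -> 'd g w0 (F (u0, X)) = X.
Proof.
move=> sh; have [sg _] := binv_smooth; have sf := bis0_smooth ax ix jy.
have dg := smooth_differentiable sg; have df := smooth_differentiable sf.
rewrite -(semiholonomic_chart ax ix jy X sh).
have fu0 : f u0 = w0 by exact: bis0E.
have df' := differentiableP df; have dg' := differentiableP dg.
rewrite -fu0 in dg'.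
have d := is_diff_comp df' dg'.
have nE : \forall u \near u0, (g \o f) u = u.
  apply: filterS (bis_near ax ix jy) => u [iu uE au ju].
  by rewrite /= /bis0 /= mphiK // binvK.
have e1 := diff_val (is_diff_def := is_diff_near nE d).
have e2 := diff_val (is_diff_def := is_diff_id u0).
have e : X = 'd g (f u0) ('d f u0 X).
  exact: (congr1 (fun h : E -> E => h X) (etrans (esym e2) e1)).
by rewrite -fu0 -e.
Qed.

Hypotheses (sh : semiholonomic a x) (nY : near_field i x Y)
  (dY : differentiable (comps i Y) u0).

Lemma push_near : \forall w \near w0, (push a Y (chi0 j w)).1 = chi0 j w /\
  comps j (push a Y) w = F (g w, comps i Y (g w)).
Proof.
have [sg ng] := binv_smooth.
pose Q u := (Y (chi0 i u)).1 = chi0 i u.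
have nQ : \forall w \near w0, Q (g w).
  apply: (@near_continuous _ _ _ _ _ Q (smooth_continuous sg)).
  by rewrite binv_inverse.
apply: filterS2 nQ ng => w; rewrite /Q -[chi0 i (g w)]/(mchi i (mphi i _)).
move=> + [iw aw tw]; rewrite mphiK // => Yw.
have pE : push a Y (chi0 j w) = hat a (Y (binv a (chi0 j w))).
  by rewrite /hat /push (_ : base (Y _) = binv a (chi0 j w)).
split; first by rewrite pE (hat_base aw).
set x' := binv a (chi0 j w) in iw aw tw Yw pE *.
have YK : chi1 i (phi0 i x', (phi1 i (Y x')).2) = Y x'.
  have iY : dom0 i (Y x').1 by rewrite Yw.
  by have := phi1K iY; rewrite {1}[phi1 i (Y x')]surjective_pairing {1}[_.1]/= Yw.
have xK : chi0 i (phi0 i x') = x' by exact: (phiK g0).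
rewrite /comps pE; apply: (congr1 (fun z => (phi1 j (hat a z)).2)).
by rewrite -[RHS]/(chi1 i (phi0 i x', (phi1 i (Y (chi0 i (phi0 i x')))).2)) xK YK.
Qed.

Lemma is_diff_push : is_diff w0 (comps j (push a Y))
  (fun V => 'd F (u0, comps i Y u0) ('d g w0 V, 'd (comps i Y) u0 ('d g w0 V))).
Proof.
have [sg ng] := binv_smooth.
have nE : \forall w \near w0, F (g w, comps i Y (g w)) = comps j (push a Y) w.
  by apply: filterS push_near => w [].
apply: is_diff_near nE _.
have dg := differentiableP (smooth_differentiable sg).
have dY' : is_diff (g w0) (comps i Y) ('d (comps i Y) u0).
  by rewrite binv_inverse; exact: differentiableP.
have d1 := is_diff_pair dg (is_diff_comp dg dY').
have dF : is_diff ((g w0, comps i Y (g w0)) : E * E) F ('d F (u0, comps i Y u0)).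
  rewrite binv_inverse; apply: differentiableP.
  exact: bis1_differentiable.
exact: is_diff_comp d1 dF.
Qed.

(** In charts the pushed field is w |-> F(g w, Y(g w)), with g the inverse of the base map. The
    derivative is taken in the direction F(u0, X) because Dg sends it back to X. *)
Lemma diff_push X : 'd (comps j (push a Y)) w0 (F (u0, X)) =
  bis_diff a x i j X (comps i Y u0) + F (u0, 'd (comps i Y) u0 X).
Proof.
have e := diff_val (is_diff_def := is_diff_push).
apply: (etrans (congr1 (fun h : E -> E => h (F (u0, X))) e)).
have eb := congr1 (fun V => 'd F (u0, comps i Y u0) (V, 'd (comps i Y) u0 V))
  (diff_binv X sh).
apply: (etrans eb).
apply: diff_fibre_linear; first exact: bis1_differentiable.
exact: bis1_linear_at.
Qed.

End Push.

(** * Symmetry jets and their connections in charts *)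

Section Christoffel.
Variable s : symmetry_jet M.

(* Read off the action of s on T^2M, hence smooth by smoothness of s: the     *)
(* representatives srep s x need not depend smoothly on x.                    *)
Definition christoffel i (u V X : E) : E :=
  - (2^-1 *: (phi2 i (hat s (chi2 i ((u, X), (V, 0))))).2.2).

Lemma srep_tgt x : tgt (srep s x x) = x.
Proof. by rewrite s_opp. Qed.

Lemma srep_bis1 i x X : dom0 i x -> bis1 i i (srep s x) (phi0 i x, X) = - X.
Proof.
move=> ix; have iu : dom0 i (chi0 i (phi0 i x)) by rewrite /= mphiK.
have uE : phi0 i (chi0 i (phi0 i x)) = phi0 i x by rewrite /= mphiK.
have := chi1K X iu uE; set z : Tk M 1 := chi1 i _ => zE.
have zx : base z = x by rewrite /= mphiK.
have zs : (x, z.2) = z by apply: injective_projections.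
have aE : act (srep s x x) z = (x, - z.2) by rewrite s_opp /=; case: asboolP.
rewrite /bis1 -/z /hat zx aE; apply: (etrans (linearN _ _)).
by have := congr1 snd zE; rewrite -{1}zs => /(congr1 -%R).
Qed.

Section At.
Variables (x : M) (i : midx M).
Hypothesis ix : dom0 i x.
Local Notation u0 := (phi0 i x : E).
Local Notation a := (srep s x).
Let ax := srep_dom s x.

Let ita : dom0 i (tgt (a x)).
Proof. by rewrite srep_tgt. Qed.

Let sjet_chart0 (z : Tk M 2) (X V W : E) : base z = x ->
  phi2 i z = ((u0, X), (V, W)) ->
  phi2 i (act (s x) z) = ((u0, - X), (- V, - W + bis_diff a x i i V X)).
Proof.
move=> zx zE; rewrite srepE (jet_chart ax ix ita zx zE).
rewrite (semiholonomic_chart ax ix ita V (s_semiholonomic s x)).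
by rewrite !srep_bis1 // srep_tgt.
Qed.

Lemma christoffelE V X :
  christoffel i u0 V X = - (2^-1 *: bis_diff a x i i V X).
Proof.
rewrite /christoffel; set z : Tk M 2 := chi2 i _.
have zx : base z = x by rewrite /= mphiK.
have zE : phi2 i z = ((u0, X), (V, 0)) by apply: chi2K => /=; rewrite !mphiK.
by rewrite /hat zx (sjet_chart0 zx zE) /= oppr0 add0r.
Qed.

Lemma sjet_chart (z : Tk M 2) (X V W : E) : base z = x ->
  phi2 i z = ((u0, X), (V, W)) ->
  phi2 i (act (s x) z) = ((u0, - X), (- V, - W - 2 *: christoffel i u0 V X)).
Proof.
move=> zx zE; rewrite (sjet_chart0 zx zE) christoffelE.
by rewrite scalerN opprK scalerA divff ?scale1r // pnatr_eq0.
Qed.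

Lemma christoffel_linearl X : linear (fun V => christoffel i u0 V X).
Proof.
move=> c V W; rewrite !christoffelE bis_diff_linearl.
by rewrite scalerDr opprD !scalerN !scalerA mulrC.
Qed.

Lemma christoffel_linearr V : linear (christoffel i u0 V).
Proof.
move=> c X Y; rewrite !christoffelE (bis_diff_linearr ax ix ita).
by rewrite scalerDr opprD !scalerN !scalerA mulrC.
Qed.

Lemma christoffel_smooth V X :
  smooth (fun w : E * (E * E) => christoffel i w.1 w.2.1 w.2.2) (u0, (V, X)).
Proof.
pose l (w : E * (E * E)) : (E * E) * (E * E) := ((w.1, w.2.2), (w.2.1, 0)).
pose z : Tk M 2 := chi2 i (l (u0, (V, X))).
have zx : base z = x by rewrite /= mphiK.
have zE : phi2 i z = l (u0, (V, X)) by apply: chi2K => /=; rewrite !mphiK.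
have iz : dom0 i z.1.1 by rewrite (_ : z.1.1 = x).
have jz : dom0 i (hat s z).1.1.
  by rewrite /hat zx srepE (jet_base (srep_dom s x) zx) srep_tgt.
have [sh _] :=
  (@smooth_atP R (Tk M 2) (Tk M 2) i i (hat s) z g2 g2 iz jz).1 (s_smooth s z).
have s1 := @smooth_fst _ E (E * E)%type (u0, (V, X)).
have s2 := @smooth_snd _ E (E * E)%type (u0, (V, X)).
have s21 := smooth_comp s2 (@smooth_fst _ E E (V, X)).
have s22 := smooth_comp s2 (@smooth_snd _ E E (V, X)).
have sl : smooth l (u0, (V, X)).
  apply: smooth_pair; apply: smooth_pair => //; exact: smooth_cst.
rewrite -[phi _ z]/(phi2 i z) zE in sh.
have h1 := smooth_comp sl sh.
have h2 := smooth_comp h1 (smooth_snd _).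
have h3 := smooth_comp h2 (smooth_snd _).
exact: smoothN (smoothZ 2^-1 h3).
Qed.

End At.

(** At x the symmetry is -1, so Y + s_x Y vanishes there and only its derivative along X survives in
    the bracket. Both summands contribute DY(X), and the second also contributes minus the quadratic
    term of s_x, which is 2 G. *)
Lemma nabla_chart X Y x : near_field (at0 x) x Y ->
  differentiable (comps (at0 x) Y) (phi0 (at0 x) x : E) ->
  nabla s X Y x = (x, 'd (comps (at0 x) Y) (phi0 (at0 x) x : E) (X x).2 +
     christoffel (at0 x) (phi0 (at0 x) x) (X x).2 (Y x).2).
Proof.
set i := at0 x; set u0 : E := phi0 i x => nY dY.
have ix : dom0 i x by exact: mat_dom.
have ax := srep_dom s x; set a := srep s x in ax.
have ay : dom0 i (tgt (a x)) by rewrite srep_tgt.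
have sh := s_semiholonomic s x.
have Yx := near_field_at ix nY.
have Y0 : comps i Y u0 = (Y x).2.
  rewrite /comps -[chi0 i u0]/(mchi i (mphi i x)) mphiK //.
  by rewrite [Y x in LHS]surjective_pairing Yx phi1_at.
have pY : push a Y x = (x, - (Y x).2).
  have bx : binv a x = x by rewrite -{1}(srep_tgt x) binvK.
  rewrite /push bx s_opp /=.
  by case: asboolP => // h; case: h; rewrite -[RHS]Yx.
have dP := is_diff_push ax ix ay nY dY.
have DP V := diff_push ax ix ay sh nY dY V.
have nP := push_near ax ix ay nY.
rewrite srep_tgt -/u0 in dP DP nP.
pose Z x' := addT (Y x') (push a Y x').
have nZ : \forall u \near u0, comps i Y u + comps i (push a Y) u = comps i Z u.
  apply: filterS2 nY nP => u Yu [Pu _].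
  have e : (push a Y (chi0 i u)).1 = (Y (chi0 i u)).1 by rewrite Pu Yu.
  exact: esym (phi1_addT i e).
have dZ := is_diff_near nZ (is_diffD (differentiableP dY) dP).
set vX : E := (X x).2.
have eZ : 'd (comps i Z) u0 vX =
    'd (comps i Y) u0 vX + 'd (comps i (push a Y)) u0 vX.
  have e1 := diff_val (is_diff_def := dZ).
  have e2 := diff_val (is_diff_def := dP).
  apply: (etrans (congr1 (fun h : E -> E => h vX) e1)); congr (_ + _).
  exact: esym (congr1 (fun h : E -> E => h vX) e2).
(* The direction -X is taken because F(u0, -X) = X for the symmetry, and [diff_push] gives the
   derivative along F(u0, .). *)
have eP := DP (- vX).
have LX : bis1 i i a (u0, - vX) = vX by rewrite srep_bis1 // opprK.
have LY : bis1 i i a (u0, 'd (comps i Y) u0 (- vX)) = 'd (comps i Y) u0 vX.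
  apply: (etrans (srep_bis1 _ ix)); apply: (etrans (congr1 -%R (linearN _ _))).
  exact: opprK.
have Bx : bis_diff a x i i (- vX) (comps i Y u0) = - bis_diff a x i i vX (Y x).2.
  have := bis_diff_linearl a x i i (Y x).2 (-1) vX 0.
  rewrite Y0 addr0 !scaleN1r => ->.
  by rewrite [X in _ + X](_ : _ = 0) ?addr0 //; exact: linear0.
rewrite LY LX Bx in eP.
have Z0 : (Z x).2 = 0 by rewrite /Z pY /= subrr.
have X0 : 'd (comps i X) u0 (Z x).2 = 0.
  exact: etrans (congr1 (fun v => 'd (comps i X) u0 v) Z0) (linear0 _).
have halve (dZ' dX' dY' dP' b c : E) : dZ' = dY' + dP' -> dX' = 0 ->
    dP' = - b + dY' -> c = - (2^-1 *: b) -> 2^-1 *: (dZ' - dX') = dY' + c.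
  move=> -> -> -> ->; rewrite subr0 addrCA scalerDr scalerN addrC.
  congr (_ + _); rewrite -mulr2n -[dY' *+ 2]scaler_nat scalerA mulVf ?scale1r ?pnatr_eq0 //.
exact: (congr1 (pair x) (halve _ _ _ _ _ _ eZ X0 eP (christoffelE ix _ _))).
Qed.

End Christoffel.

(** * Affine jets as the jets that intertwine the symmetries *)

Section Affine.
Variable s : symmetry_jet M.

Lemma phi2_coords i x (z : Tk M 2) : base z = x ->
  phi2 i z = ((phi0 i x, (phi2 i z).1.2), ((phi2 i z).2.1, (phi2 i z).2.2)).
Proof.
by move=> <-; apply: injective_projections; apply: injective_projections.
Qed.

Lemma phi2_inj i (z z' : Tk M 2) :
  dom0 i z.1.1 -> dom0 i z'.1.1 -> phi2 i z = phi2 i z' -> z = z'.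
Proof.
by move=> iz iz' e; rewrite -(phiK g2 (i := i) (z := z)) // e (phiK g2).
Qed.

Lemma sjet_base x (z : Tk M 2) : base z = x -> (act (s x) z).1.1 = x.
Proof. by move=> zx; rewrite srepE (jet_base (srep_dom s x) zx) srep_tgt. Qed.

Section OneBisection.
Variables (a : local_bisection (@B1 R n M)) (x : M).
Hypotheses (ax : bdom a x) (sh : semiholonomic a x).
Local Notation y := (tgt (a x)).

(* Affinity of j^1_x a in charts; as intertwining does not mention charts,    *)
(* it is independent of i and j.                                              *)
Definition affine_in i j := forall V X : E, bis_diff a x i j V X =
  bis1 i j a (phi0 i x, christoffel s i (phi0 i x) V X)
  - christoffel s j (phi0 j y) (bis1 i j a (phi0 i x, V))
      (bis1 i j a (phi0 i x, X)).

Definition intertwining := forall z : Tk M 2, base z = x ->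
  act (jet a x) (act (s x) z) = act (s y) (act (jet a x) z).

Lemma jet_semiholonomic_chart i j (z : Tk M 2) (X V W : E) :
  dom0 i x -> dom0 j y -> base z = x ->
  phi2 i z = ((phi0 i x, X), (V, W)) ->
  phi2 j (act (jet a x) z) =
    ((phi0 j y, bis1 i j a (phi0 i x, X)), (bis1 i j a (phi0 i x, V),
      bis1 i j a (phi0 i x, W) + bis_diff a x i j V X)).
Proof.
move=> ix jy zx zE.
by rewrite (jet_chart ax ix jy zx zE) (semiholonomic_chart ax ix jy V sh).
Qed.

Lemma jet_jet_base (z : Tk M 2) : base z = x ->
  base (act (s x) z) = x /\ base (act (jet a x) z) = y.
Proof. by move=> zx; split; [exact: sjet_base | exact: jet_base]. Qed.

Lemma jet_sjet_chart i j (z : Tk M 2) (X V W : E) :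
  dom0 i x -> dom0 j y -> base z = x ->
  phi2 i z = ((phi0 i x, X), (V, W)) ->
  let F v := bis1 i j a (phi0 i x, v) in
  phi2 j (act (jet a x) (act (s x) z)) = ((phi0 j y, - F X), (- F V,
      - F W - 2 *: F (christoffel s i (phi0 i x) V X) + bis_diff a x i j V X))
  /\ phi2 j (act (s y) (act (jet a x) z)) = ((phi0 j y, - F X), (- F V,
      - F W - bis_diff a x i j V X - 2 *: christoffel s j (phi0 j y) (F V) (F X))).
Proof.
move=> ix jy zx zE F; have [zsx zjx] := jet_jet_base zx.
have lF : linear F := bis1_linear_at j ax ix.
have lB := bis_diff_linearr ax ix jy.
split.
  rewrite (jet_semiholonomic_chart ix jy zsx (sjet_chart s ix zx zE)).
  rewrite -!/(F _) (linear_add _ _ lF) (linear_opp X lF) (linear_opp V lF)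
    (linear_opp W lF) (linear_opp (2 *: _) lF) (linear_scale _ _ lF).
  rewrite (linear_opp _ (lB _)).
  have -> : bis_diff a x i j (- V) X = - bis_diff a x i j V X.
    exact: (linear_opp _ (bis_diff_linearl a x i j X)).
  by rewrite opprK.
rewrite (sjet_chart s jy zjx (jet_semiholonomic_chart ix jy zx zE)).
by rewrite opprD.
Qed.

Lemma affine_intertwining i j : dom0 i x -> dom0 j y ->
  affine_in i j -> intertwining.
Proof.
move=> ix jy aff z zx; have [zsx zjx] := jet_jet_base zx.
apply: (@phi2_inj j).
- by rewrite (jet_base ax zsx).
- by rewrite (sjet_base zjx).
have zE := phi2_coords i zx.
have [-> ->] := jet_sjet_chart ix jy zx zE; congr (_, (_, _)).
set F := fun v => bis1 i j a (phi0 i x, v).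
rewrite aff -!/(F _); move: (F _) (F _) (christoffel s j _ _ _) => W G1 G2.
by apply/rowP => k; rewrite !mxE; ring.
Qed.

(** The last components of the two sides of the intertwining relation differ by twice the defect of
    the affinity formula, so the relation forces this defect to vanish. *)
Lemma intertwining_affine i j : dom0 i x -> dom0 j y ->
  intertwining -> affine_in i j.
Proof.
move=> ix jy int V X.
pose z : Tk M 2 := chi2 i ((phi0 i x, X), (V, 0)).
have zx : base z = x by rewrite /= mphiK.
have zE : phi2 i z = ((phi0 i x, X), (V, 0)) by apply: chi2K => /=; rewrite !mphiK.
have [] := jet_sjet_chart ix jy zx zE.
rewrite int // => -> /(congr1 (fun z => z.2.2)) /=.
set B := bis_diff _ _ _ _ _ _; set G := christoffel s j _ _ _.
set F := bis1 _ _ _ (_, christoffel _ _ _ _ _); set W := bis1 _ _ _ _ => e.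
have {}e : 2 *: (B - (F - G)) = 0.
  have -> : 2 *: (B - (F - G)) = (- W - 2 *: F + B) - (- W - B - 2 *: G).
    by clear e; move: B F G W => B F G W; apply/rowP => k; rewrite !mxE; ring.
  by rewrite e subrr.
apply/eqP; rewrite -subr_eq0; move/eqP: e; rewrite scaler_eq0.
by rewrite pnatr_eq0.
Qed.

Lemma push_at Y : (Y x).1 = x -> push a Y y = act (a x) (Y x).
Proof. by rewrite /push binvK. Qed.

Lemma nabla_push v Y : base v = x -> near_field (at0 x) x Y ->
  differentiable (comps (at0 x) Y) (phi0 (at0 x) x : E) ->
  let F v := bis1 (at0 x) (at0 y) a (phi0 (at0 x) x, v) in
  act (a x) (nabla_at s v Y) =
    (y, F ('d (comps (at0 x) Y) (phi0 (at0 x) x : E) v.2) +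
        F (christoffel s (at0 x) (phi0 (at0 x) x) v.2 (Y x).2)) /\
  nabla_at s (act (a x) v) (push a Y) =
    (y, F ('d (comps (at0 x) Y) (phi0 (at0 x) x : E) v.2) +
        bis_diff a x (at0 x) (at0 y) v.2 (Y x).2 +
        christoffel s (at0 y) (phi0 (at0 y) y) (F v.2) (F (Y x).2)).
Proof.
move=> vx nY dY F.
have ix : dom0 (at0 x) x by exact: mat_dom.
have jy : dom0 (at0 y) y by exact: mat_dom.
have Yx := near_field_at ix nY.
have lF : linear F := bis1_linear_at _ ax ix.
have Ba := bisection_in ax; have sx := bisection_src ax.
have actE w : act (a x) (x, w) = (y, F w).
  have [L [_ LE]] := act_B1 Ba; rewrite sx in LE.
  rewrite LE; congr pair.
  have := arrow_lin_at w Ba; rewrite sx LE /= => <-.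
  by rewrite /F bis1_arrow_lin /= ?mphiK.
have exE (w : Tk M 1) : extend w w.1 = w by case: w => w1 w2; exact: chi1_at.
have Y0 : comps (at0 x) Y (phi0 (at0 x) x) = (Y x).2.
  rewrite /comps (phiK g0) // [Y x]surjective_pairing Yx.
  by rewrite phi1_at.
split.
  rewrite /nabla_at [v.1]vx (nabla_chart s _ nY dY) actE -(linear_add _ _ lF).
  have exv : extend v x = v by have := exE v; rewrite (vx : v.1 = x).
  by rewrite exv.
have e1 : act (a x) v = (y, F v.2).
  by rewrite -actE -vx -surjective_pairing.
have nP : near_field (at0 y) y (push a Y).
  by apply: filterS (push_near ax ix jy nY) => w [].
have dP := is_diff_push ax ix jy nY dY.
rewrite /nabla_at e1 (nabla_chart s _ nP (ex_diff (is_diff_def := dP))).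
have -> : extend (y, F v.2) y = (y, F v.2) := exE (y, F v.2).
have -> : (push a Y y).2 = F (Y x).2.
  by rewrite push_at // [Y x]surjective_pairing Yx actE.
congr (_, _ + _).
apply: (etrans (diff_push ax ix jy sh nY dY v.2)).
by rewrite Y0 addrC.
Qed.

End OneBisection.

End Affine.

(** * The affinity condition on vector fields, tested on constant fields *)

Section AffineExtension.
Variable s : symmetry_jet M.

Lemma vector_field_chart i x Y : dom0 i x -> vector_field_near x Y ->
  near_field i x Y /\ smooth (comps i Y) (phi0 i x : E).
Proof.
move=> ix [Yp sY]; split; first by near=> u; exact: Yp.
have iY : dom0 i (Y x).1 by rewrite (Yp x : (Y x).1 = x).
have [sm _] := (@smooth_atP R (Tk M 0) (Tk M 1) i i Y x g0 g1 ix iY).1 sY.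
exact: smooth_comp sm (smooth_snd _).
Unshelve. all: by end_near. Qed.

(** Off the chart domain the value is the zero vector at the same point, since [vector_field_near]
    asks for [proj (X x') = x'] everywhere. *)
Definition const_field i (X : E) (x : M) : Tk M 1 :=
  if `[< dom0 i x >] then chi1 i (phi0 i x, X) else (x, 0).

Lemma const_field_near i x X : dom0 i x ->
  \forall u \near phi0 i x, comps i (const_field i X) u = X.
Proof.
move=> ix; apply: filterS (chart_near_at g0 ix) => u [iu uE].
by rewrite /comps /const_field; case: asboolP => // _; rewrite chi1K uE.
Qed.

Lemma const_field_vector_field i x X : dom0 i x ->
  vector_field_near x (const_field i X).
Proof.
move=> ix; split=> [x'|].
  by rewrite /const_field; case: asboolP => // ix' /=; rewrite /proj /= mphiK.
have near_eq : \forall u \near phi0 i x,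
    (u, X) = phi1 i (const_field i X (chi0 i u)) /\ dom0 i (const_field i X (chi0 i u)).1.
  apply: filterS (chart_near_at g0 ix) => u [iu uE].
  rewrite /const_field; case: asboolP => // _; rewrite uE chi1K //; split => //.
have cx : (const_field i X x).1 = x.
  by rewrite /const_field; case: asboolP => //= _; rewrite mphiK.
have icx : dom0 i (const_field i X x).1 by rewrite cx.
apply/(@smooth_atP R (Tk M 0) (Tk M 1) i i _ x g0 g1 ix icx); split.
  apply: (@smooth_near _ _ _ (fun u : E => (u, X))).
    by apply: filterS near_eq => u [].
  exact: smooth_pair (smooth_id _) (smooth_cst _ _).
by apply: filterS near_eq => u [].
Qed.

Section Characterization.
Variables (a : local_bisection (@B1 R n M)) (x : M).
Hypotheses (ax : bdom a x) (sh : semiholonomic a x).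
Local Notation y := (tgt (a x)).
Local Notation affine_at_x := (forall (v : Tk M 1) (Y : M -> Tk M 1),
  base v = x -> vector_field_near x Y ->
  act (a x) (nabla_at s v Y) = nabla_at s (act (a x) v) (push a Y)).

(** For a field with constant components the derivative of Y vanishes, and affinity reduces to the
    bilinear formula. Conversely the formula cancels all that differs between the two sides, for any
    field. *)
Lemma affine_inP : affine_at_x <-> affine_in s a x (at0 x) (at0 y).
Proof.
have ix : dom0 (at0 x) x by exact: mat_dom.
split=> [aff V X|aff v Y vx vY].
  have vf := const_field_vector_field X ix.
  have [nY sY] := vector_field_chart ix vf.
  have dY := smooth_differentiable sY.
  have Yx : const_field (at0 x) X x = (x, X).
    by rewrite /const_field; case: asboolP => // _; exact: chi1_at.
  have [e1 e2] := nabla_push s ax sh (v := (x, V)) erefl nY dY.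
  have D0 : 'd (comps (at0 x) (const_field (at0 x) X)) (phi0 (at0 x) x : E) V = 0.
    have nE : \forall u \near (phi0 (at0 x) x : E),
        cst X u = comps (at0 x) (const_field (at0 x) X) u.
      by apply: filterS (const_field_near X ix) => u ->.
    have h := diff_val (is_diff_def := is_diff_near nE (is_diff_cst X _)).
    exact: (congr1 (fun h : E -> E => h V) h).
  have := aff (x, V) _ erefl vf; rewrite e1 e2 D0 Yx => /(congr1 snd) /=.
  rewrite (linear_zero (bis1_linear_at _ ax ix)) !add0r => ->.
  by rewrite addrK.
have [nY sY] := vector_field_chart ix vY.
have [-> ->] := nabla_push s ax sh vx nY (smooth_differentiable sY).
by rewrite aff -addrA addrNK.
Qed.

(** The condition is known in the preferred charts; the chart-free intertwining relation transports
    it to [i] and [j]. Arbitrary charts matter because S(a(x')) will be expressed in fixed charts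
    while x' moves. *)
Lemma affine_chart i j (z : Tk M 2) (X V W : E) :
  affine_at_x -> dom0 i x -> dom0 j y -> base z = x ->
  phi2 i z = ((phi0 i x, X), (V, W)) ->
  let L := arrow_lin i j (a x) in
  phi2 j (act (jet a x) z) = ((phi0 j y, L X), (L V, L W +
    (L (christoffel s i (phi0 i x) V X) -
     christoffel s j (phi0 j y) (L V) (L X)))).
Proof.
move=> /affine_inP aff ix jy zx zE L.
have jx := mat_dom x; have jy' := mat_dom y.
have aff' := intertwining_affine ax sh ix jy (affine_intertwining ax sh jx jy' aff).
have LE v : bis1 i j a (phi0 i x, v) = L v by rewrite bis1_arrow_lin /= ?mphiK.
by rewrite (jet_semiholonomic_chart ax sh ix jy zx zE) aff' !LE.
Qed.

End Characterization.

End AffineExtension.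

(* In preferred charts, a bisection is built over the affine map with linear  *)
(* part L; its fibre part L + B(u - u0) has the prescribed derivative B at u0 *)
(* and is invertible near u0.                                                 *)
Section Existence.
Section Construction.
Variables (x y : M) (L : {linear E -> E}) (g : E -> E) (B : E -> E -> E).
Hypotheses (LK : cancel L g) (gK : cancel g L).
Hypotheses (Bl : forall v, linear (B ^~ v)) (Br : forall h, linear (B h)).
Hypothesis Bs : forall z : E * E, smooth (fun z : E * E => B z.1 z.2) z.
Local Notation i := (at0 x).
Local Notation j := (at0 y).
Local Notation u0 := (phi0 i x : E).
Local Notation w0 := (phi0 j y : E).

Let ix : dom0 i x := mat_dom x.
Let jy : dom0 j y := mat_dom y.
Let cL : continuous L. Proof. exact/linear_rV_continuous/linearP. Qed.
Let lg : linear g. Proof. by move=> c v w; apply: (can_inj LK); rewrite linearP !gK. Qed.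
Let cg : continuous g. Proof. exact: linear_rV_continuous. Qed.

Definition aff0 (u : E) : E := w0 + L (u - u0).
Definition aff0_inv (w : E) : E := u0 + g (w - w0).
Definition aff1 (u v : E) : E := L v + B (u - u0) v.

Lemma aff0K : cancel aff0 aff0_inv.
Proof. by move=> u; rewrite /aff0_inv /aff0 [w0 + _]addrC addrK LK addrC subrK. Qed.

Lemma aff0_invK : cancel aff0_inv aff0.
Proof. by move=> w; rewrite /aff0_inv /aff0 [u0 + _]addrC addrK gK addrC subrK. Qed.

Lemma aff0_smooth u : smooth aff0 u.
Proof.
apply: smoothD; first exact: smooth_cst.
have s1 := smoothB (smooth_id u) (smooth_cst u0 u).
exact: (smooth_comp s1 (smooth_lin _ (@linearP _ _ _ _ L) cL)).
Qed.

Lemma aff0_inv_smooth w : smooth aff0_inv w.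
Proof.
apply: smoothD; first exact: smooth_cst.
have s1 := smoothB (smooth_id w) (smooth_cst w0 w).
exact: (smooth_comp s1 (smooth_lin _ lg cg)).
Qed.

Lemma aff0_at : aff0 u0 = w0.
Proof. by rewrite /aff0 subrr linear0 addr0. Qed.

Lemma aff1_linear u : linear (aff1 u).
Proof. by move=> c v w; rewrite /aff1 linearP Br scalerDr addrACA. Qed.

Lemma aff1_smooth z : smooth (fun z : E * E => aff1 z.1 z.2) z.
Proof.
apply: smoothD.
  exact: (smooth_comp (smooth_snd z) (smooth_lin _ (@linearP _ _ _ _ L) cL)).
have s1 := smoothB (smooth_fst z) (smooth_cst u0 z).
exact: smooth_comp (smooth_pair s1 (smooth_snd z)) (Bs _).
Qed.

Lemma aff1_at v : aff1 u0 v = L v.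
Proof. by rewrite /aff1 subrr (linear_zero (Bl v)) addr0. Qed.

(** The continuous inverse of L bounds |v| by a multiple of |L v|, so [perturbed_injective] applies
    to B. *)
Lemma aff1_injective_near : \forall u \near u0, forall v, aff1 u v = 0 -> v = 0.
Proof.
pose gL : {linear E -> E} := HB.pack g (GRing.isLinear.Build _ _ _ _ _ lg).
have [k k0 gk] := @linear_lipschitz _ _ _ gL cg.
have Lk v : `|v| <= k * `|L v| by rewrite -{1}(LK v); exact: gk.
have := perturbed_injective k0 Lk Bl Br (smooth_continuous (Bs _)).
rewrite (near_shift u0 0) => H; apply: filterS H => u /=.
by rewrite add0r.
Qed.

Lemma good_domain : exists D : set E, [/\ open D, D u0 & forall u, D u ->
  [/\ dom0 i (chi0 i u) /\ phi0 i (chi0 i u) = u,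
      dom0 j (chi0 j (aff0 u)) /\ phi0 j (chi0 j (aff0 u)) = aff0 u &
      forall v, aff1 u v = 0 -> v = 0]].
Proof.
pose Q w := dom0 j (chi0 j w) /\ phi0 j (chi0 j w) = w.
have nQ : \forall u \near u0, Q (aff0 u).
  apply: (@near_continuous _ _ _ _ _ Q (smooth_continuous (aff0_smooth u0))).
  by rewrite aff0_at; exact: chart_near_at.
apply: nearP_open.
apply: filterS3 (chart_near_at g0 ix) nQ aff1_injective_near.
by move=> u; split.
Qed.

Variable D : set E.
Hypotheses (oD : open D) (Du0 : D u0) (DP : forall u, D u ->
  [/\ dom0 i (chi0 i u) /\ phi0 i (chi0 i u) = u,
      dom0 j (chi0 j (aff0 u)) /\ phi0 j (chi0 j (aff0 u)) = aff0 u &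
      forall v, aff1 u v = 0 -> v = 0]).

Definition aff_dom : set M := [set x' | dom0 i x' /\ D (phi0 i x')].
Definition aff_map (x' : M) : M := chi0 j (aff0 (phi0 i x')).
Definition aff_inv (y' : M) : M := chi0 i (aff0_inv (phi0 j y')).
Definition aff_lin (x' : M) (v : E) : E :=
  (chi1 j (aff0 (phi0 i x'), aff1 (phi0 i x') (phi1 i (x', v)).2)).2.
Definition aff_fun (x' : M) : arrow M 1 := lin_arrow x' (aff_map x') (aff_lin x').

Lemma open_chart_preimage k (D' : set E) :
  open D' -> open [set x' : M | dom0 k x' /\ D' (phi0 k x')].
Proof.
move=> oD'; rewrite openE => x' [kx' Dx']; apply: filterI.
  by apply: open_nbhs_nbhs; split => //; exact: mdom_open.
by apply: (mphi_continuous kx'); apply: open_nbhs_nbhs.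
Qed.

Lemma aff_image : aff_map @` aff_dom =
  [set y' | dom0 j y' /\ (aff0_inv @^-1` D) (phi0 j y')].
Proof.
apply/seteqP; split => [_ [x' [ix' Dx'] <-]|y' [jy' Dy']].
  have [_ [jf jfE] _] := DP Dx'.
  by split=> //; rewrite /aff_map /preimage /= -[mphi _ _]/(phi0 j _) jfE aff0K.
have [[iu uE] _ _] := DP Dy'.
exists (chi0 i (aff0_inv (phi0 j y'))); first by split; rewrite ?uE.
by rewrite /aff_map uE aff0_invK (phiK g0).
Qed.

Lemma aff_map_chart x' : aff_dom x' ->
  \forall u \near phi0 i x', aff0 u = phi0 j (aff_map (chi0 i u)) /\
     dom0 j (aff_map (chi0 i u)).
Proof.
move=> [ix' Dx'].
have nD : \forall u \near (phi0 i x' : E), D u by exact: near_open oD Dx' _.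
apply: filterS nD => u Du; have [[iu uE] [jf jfE] _] := DP Du.
by rewrite /aff_map uE jfE.
Qed.

Lemma aff_map_smooth x' : aff_dom x' -> @smooth_at R (Tk M 0) (Tk M 0) aff_map x'.
Proof.
move=> Ux; have [ix' Dx'] := Ux; have [_ [jf jfE] _] := DP Dx'.
apply/(@smooth_atP R (Tk M 0) (Tk M 0) i j aff_map x' g0 g0 ix' jf); split.
  by apply: smooth_near (aff0_smooth _); apply: filterS (aff_map_chart Ux) => u [].
by apply: filterS (aff_map_chart Ux) => u [].
Qed.

Lemma aff_inv_smooth y' : (aff_map @` aff_dom) y' ->
  @smooth_at R (Tk M 0) (Tk M 0) aff_inv y'.
Proof.
rewrite aff_image => -[jy' Dy']; have [[iu uE] _ _] := DP Dy'.
apply/(@smooth_atP R (Tk M 0) (Tk M 0) j i aff_inv y' g0 g0 jy' iu).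
have nD : \forall w \near (phi0 j y' : E), D (aff0_inv w).
  apply: (@near_continuous _ _ _ _ _ D (smooth_continuous (aff0_inv_smooth _))).
  exact: near_open oD Dy' _.
have nE : \forall w \near (phi0 j y' : E), aff0_inv w = phi0 i (aff_inv (chi0 j w)) /\
     dom0 i (aff_inv (chi0 j w)).
  apply: filterS2 nD (chart_near_at g0 jy') => w Dw [jw wE].
  by have [[iu' uE'] _ _] := DP Dw; rewrite /aff_inv wE uE'.
split; last by apply: filterS nE => w [].
by apply: smooth_near (aff0_inv_smooth _); apply: filterS nE => w [].
Qed.

Lemma aff_diffeo : local_diffeo aff_dom (fun x' => tgt (aff_fun x')) aff_inv.
Proof.
split.
- exact: open_chart_preimage.
- rewrite -[X in open X]/(aff_map @` aff_dom) aff_image.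
  apply: open_chart_preimage; apply: open_comp => // w _.
  exact: smooth_continuous (aff0_inv_smooth w).
- move=> x' [ix' Dx']; have [_ [jf jfE] _] := DP Dx'.
  by rewrite -[tgt _]/(aff_map x') /aff_inv /aff_map jfE aff0K (phiK g0).
- exact: aff_map_smooth.
- exact: aff_inv_smooth.
Qed.

Lemma aff_lin_linear x' : linear (aff_lin x').
Proof.
move=> c v w; rewrite /aff_lin.
by rewrite phi1_linear aff1_linear chi1_linear.
Qed.

Lemma aff_lin_kernel x' v : aff_dom x' -> aff_lin x' v = 0 -> v = 0.
Proof.
move=> [ix' Dx']; have [_ [jf jfE] inj] := DP Dx'.
rewrite /aff_lin; set w := aff1 _ _ => w0.
have {}w0 : w = 0.
  have := chi1K w jf jfE; rewrite [chi1 j _]surjective_pairing w0.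
  move=> /(congr1 snd) /= <-; exact: linear0.
have v0 := inj _ w0.
have := phi1K (z := (x', v) : Tk M 1) ix'.
rewrite [phi1 i _]surjective_pairing v0 => /(congr1 snd) /= <-; exact: linear0.
Qed.

Lemma aff_in x' : aff_dom x' -> B1 (aff_fun x').
Proof.
move=> Ux; pose lL : {linear E -> E} :=
  HB.pack (aff_lin x') (GRing.isLinear.Build _ _ _ _ _ (aff_lin_linear x')).
exists x', (aff_map x'), lL; split=> //; apply: injective_linear_bijective => v.
exact: aff_lin_kernel.
Qed.

Lemma hat_aff (z : Tk M 1) : hat aff_fun z =
  chi1 j (aff0 (phi1 i z).1, aff1 (phi1 i z).1 (phi1 i z).2).
Proof. by case: z => x' v; rewrite /hat /=; case: asboolP. Qed.

Lemma hat_aff_chart (w : E * E) : D w.1 ->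
  phi1 j (hat aff_fun (chi1 i w)) = (aff0 w.1, aff1 w.1 w.2) /\
  dom0 j (hat aff_fun (chi1 i w)).1.
Proof.
move=> Dw; have [[iu uE] [jf jfE] _] := DP Dw.
have wE : phi1 i (chi1 i w) = w by rewrite [w]surjective_pairing chi1K.
by rewrite hat_aff wE chi1K.
Qed.

Lemma hat_aff_smooth (z : Tk M 1) : aff_dom (base z) -> smooth_at (hat aff_fun) z.
Proof.
move=> [iz Dz].
have jz : dom0 j (hat aff_fun z).1.
  by rewrite hat_aff; have [_ [jf _] _] := DP Dz.
have nD : \forall w \near (phi1 i z : E * E), D w.1.
  have H : \forall u \near ((phi1 i z).1 : E), D u by exact: near_open oD Dz _.
  exact: (@near_fst_pair _ E E D _ H).
apply/(@smooth_atP R (Tk M 1) (Tk M 1) i j _ z g1 g1 iz jz); split.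
  apply: (@smooth_near _ _ _ (fun w : E * E => (aff0 w.1, aff1 w.1 w.2))).
    by apply: filterS nD => w /hat_aff_chart[<- _].
  apply: smooth_pair; last exact: aff1_smooth.
  exact: smooth_comp (smooth_fst _) (aff0_smooth _).
by apply: filterS nD => w /hat_aff_chart[].
Qed.

Definition aff_bisection : local_bisection (@B1 R n M) :=
  LocalBisection aff_in (fun x' _ => erefl) aff_diffeo hat_aff_smooth.

Lemma aff_bisection_dom : bdom aff_bisection x.
Proof. by []. Qed.

Lemma aff_map_at : aff_map x = y.
Proof. by rewrite /aff_map aff0_at (phiK g0). Qed.

Lemma aff_bisection_at : aff_bisection x = lin_arrow x y L.
Proof.
rewrite -[LHS]/(lin_arrow x (aff_map x) (aff_lin x)) aff_map_at.
congr lin_arrow; apply/funext => v.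
by rewrite /aff_lin aff0_at phi1_at aff1_at chi1_at.
Qed.

Lemma aff_bisection_semiholonomic : semiholonomic aff_bisection x.
Proof.
rewrite /semiholonomic aff_bisection_at.
rewrite -[RHS]/(@mkarrow _ _ M 1 x (aff_map x) (@tmap R (Tk M 0) (Tk M 0) aff_map)).
rewrite aff_map_at.
congr Arrow; apply/funext => z; case: asboolP => // zx.
rewrite /tmap (zx : z.1 = x) -[_ x]/(aff_map x) aff_map_at; congr pair.
have nE : \forall u \near u0, aff0 u = (phi0 j \o aff_map \o chi0 i) u.
  by apply: filterS (aff_map_chart (conj ix Du0)) => u [].
have d0 := is_diffD (is_diff_cst (w0 - L u0) u0) (lin_is_diff u0 (@linearP _ _ _ _ L) cL).
have nE' : \forall u \near u0, (cst (w0 - L u0) + L) u = (phi0 j \o aff_map \o chi0 i) u.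
  apply: filterS nE => u <-; rewrite -[LHS]/(w0 - L u0 + L u) /aff0 linearB.
  by rewrite [L u - _]addrC addrA.
have := diff_val (is_diff_def := is_diff_near nE' d0).
move=> /(congr1 (fun h : E -> E => h z.2)) /esym e.
by apply: etrans e; rewrite -[RHS]/(0 + L z.2) add0r.
Qed.

Lemma aff_bisection_diff V X : bis_diff aff_bisection x i j V X = B V X.
Proof.
have ay : dom0 j (tgt (aff_bisection x)) by rewrite aff_bisection_at.
have d := is_diff_bis1 aff_bisection_dom ix ay X.
have lB := Bl X.
have cB : continuous (B ^~ X) by exact: linear_rV_continuous.
have d0 := is_diffD (is_diff_cst (L X - B u0 X) u0) (lin_is_diff u0 lB cB).
have nE : \forall u \near u0,
    (cst (L X - B u0 X) + B ^~ X) u = bis1 i j aff_bisection (u, X).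
  have nD : \forall u \near u0, D u by exact: near_open oD Du0 _.
  apply: filterS nD => u Du; rewrite /bis1.
  have [-> _] := hat_aff_chart (w := (u, X)) Du.
  rewrite -[LHS]/(L X - B u0 X + B u X) /= /aff1 (linear_add _ _ lB) (linear_opp _ lB).
  by rewrite [B u X - _]addrC addrA.
have e1 := diff_val (is_diff_def := is_diff_near nE d0).
have e2 := diff_val (is_diff_def := d).
apply: (etrans (congr1 (fun h : E -> E => h V) (etrans (esym e2) e1))).
by rewrite -[LHS]/(0 + B V X) add0r.
Qed.

End Construction.

Variable s : symmetry_jet M.

(** The affinity formula depends only on xi and on the symmetries at its two ends, so it can be
    prescribed in advance as the bilinear term of a bisection through xi. *)
Lemma affine_extension_exists xi : B1 xi -> exists eta, is_affine_extension s xi eta.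
Proof.
move=> Bxi; have [L [bL xiE]] := B1P Bxi.
set x := src xi in xiE; set y := tgt xi in xiE.
have [g LK gK] := bL.
have ix : dom0 (at0 x) x := mat_dom x; have jy : dom0 (at0 y) y := mat_dom y.
(* The quadratic term that [affine_in] demands of an extension of xi. *)
pose B h v := L (christoffel s (at0 x) (phi0 (at0 x) x) h v) -
  christoffel s (at0 y) (phi0 (at0 y) y) (L h) (L v).
have cL : continuous L by apply/linear_rV_continuous/linearP.
have lL : linear L := @linearP _ _ _ _ L.
have Bl v : linear (B ^~ v).
  apply: linear_sub (linear_comp (christoffel_linearl s ix v) lL) _.
  exact: linear_comp lL (christoffel_linearl s jy (L v)).
have Br h : linear (B h).
  apply: linear_sub (linear_comp (christoffel_linearr s ix h) lL) _.
  exact: linear_comp lL (christoffel_linearr s jy (L h)).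
have sL v : smooth L v := smooth_lin v lL cL.
have Bs z : smooth (fun z : E * E => B z.1 z.2) z.
  case: z => h v; apply: smoothB.
    have h1 := smooth_pair (smooth_cst (phi0 (at0 x) x : E) (h, v)) (smooth_id (h, v)).
    exact: smooth_comp (smooth_comp h1 (christoffel_smooth s ix h v)) (sL _).
  have h1 := smooth_comp (smooth_fst (h, v)) (sL h).
  have h2 := smooth_comp (smooth_snd (h, v)) (sL v).
  have h3 := smooth_pair (smooth_cst (phi0 (at0 y) y : E) (h, v)) (smooth_pair h1 h2).
  exact: smooth_comp h3 (christoffel_smooth s jy (L h) (L v)).
have [D [oD Du0 DP]] := @good_domain x y L g B LK gK Bl Br Bs.
pose a := aff_bisection LK gK Br Bs oD DP.
have ax : bdom a x by exact: aff_bisection_dom.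
have aE : a x = xi by rewrite xiE; exact: aff_bisection_at.
have sh : semiholonomic a x by exact: aff_bisection_semiholonomic.
exists (jet a x), a; split=> //; rewrite -/x -aE.
apply/affine_inP => // V X.
have ty : tgt (a x) = y by rewrite aE.
rewrite ty; apply: etrans (aff_bisection_diff LK gK Bl Br Bs oD Du0 DP V X) _.
have LE v : bis1 (at0 x) (at0 y) a (phi0 (at0 x) x, v) = L v.
  rewrite /bis1; have [-> _] := hat_aff_chart DP (w := (_, v)) Du0.
  exact: aff1_at.
apply: esym; apply: (congr2 (fun v w : E => v - w)); first exact: LE.
exact: congr2 (LE V) (LE X).
Qed.

End Existence.

(** * Change of charts and the canonical involution on T^2M *)

Lemma phi2_change i j (z : Tk M 2) : dom0 i z.1.1 -> dom0 j z.1.1 ->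
  phi2 j z = tangent (tangent (phi0 j \o chi0 i)) (phi2 i z).
Proof.
move=> iz jz.
have sid : @smooth_at R (Tk M 0) (Tk M 0) id z.1.1.
  apply/(@smooth_atP R (Tk M 0) (Tk M 0) i j id z.1.1 g0 g0 iz jz); split.
    exact: (smooth_transition g0).
  by apply: filterS (chart_near g0 iz jz) => u [].
have tid : @tmap R (Tk M 0) (Tk M 0) id = id.
  by apply/funext => w; exact: tmap_id.
have := @tmap_tmap_chart R (Tk M 0) i j id z g0 iz jz sid.
by rewrite tid (tmap_id (N := Tk M 1) z g1).
Qed.

Lemma kappa_base (z : Tk M 2) : (kappa z).1.1 = z.1.1.
Proof. by case: z => -[? ?] [? ?]. Qed.

(** [kappa] is the swap in the preferred chart by definition; the second tangent map of a transition
    commutes with the swap, so it is the swap in every chart. *)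
Lemma phi2_kappa i (z : Tk M 2) : dom0 i z.1.1 ->
  phi2 i (kappa z) = swap_mid (phi2 i z).
Proof.
move=> iz; have az : dom0 (at0 z.1.1) z.1.1 := mat_dom _.
have kE := kappa_base z.
have pk : phi2 (at0 z.1.1) (kappa z) = swap_mid (phi2 (at0 z.1.1) z).
  rewrite (phi2_at z) -kE (phi2_at (kappa z)).
  by case: z {iz az kE} => -[? ?] [? ?].
have ik : dom0 i (kappa z).1.1 by rewrite kE.
have ak : dom0 (at0 z.1.1) (kappa z).1.1 by rewrite kE.
apply: (etrans (phi2_change ak ik)).
apply: (etrans (congr1 (tangent (tangent (phi0 i \o chi0 (at0 z.1.1)))) pk)).
have st : smooth (phi0 i \o chi0 (at0 z.1.1)) (phi2 (at0 z.1.1) z).1.1.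
  by rewrite phi2_at; exact: (smooth_transition g0 az iz).
apply: (etrans (tangent2_swap st)).
congr swap_mid; exact: esym (phi2_change az iz).
Qed.

(** In the chart [kappa] is a linear map, hence equal to its own derivative. *)
Lemma kappa_starE (z : Tk M 3) : kappa_star z = (kappa z.1, swap_mid z.2).
Proof.
rewrite /kappa_star /tmap; congr pair.
set i := at0 z.1.1.1.
have iz : dom0 i z.1.1.1 := mat_dom _.
have nE : \forall w \near (phi2 i z.1 : (E * E) * (E * E)),
    swap_mid w = (phi2 i \o @kappa R n M \o chi2 i) w.
  have H := chart_near_at (i := i) (z := z.1) g2 iz.
  apply: filterS H => w [iw wE].
  by apply: esym; apply: (etrans (phi2_kappa (z := chi2 i w) iw)); rewrite wE.
have lsw : linear (@swap_mid R E) by move=> c [[? ?] [? ?]] [[? ?] [? ?]].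
have csw : continuous (@swap_mid R E).
  have c1 := @fst_continuous _ (E * E)%type (E * E)%type.
  have c2 := @snd_continuous _ (E * E)%type (E * E)%type.
  apply: pair_continuous; apply: pair_continuous.
  - exact: comp_continuous c1 (@fst_continuous _ E E).
  - exact: comp_continuous c2 (@fst_continuous _ E E).
  - exact: comp_continuous c1 (@snd_continuous _ E E).
  - exact: comp_continuous c2 (@snd_continuous _ E E).
have h := diff_val (is_diff_def := is_diff_near nE (lin_is_diff _ lsw csw)).
have := congr1 (fun f : (E * E) * (E * E) -> (E * E) * (E * E) => f z.2) h.
by rewrite -[at_ (kappa z.1)]/(at0 (kappa z.1).1.1) kappa_base.
Qed.

(** * Torsion, and the action on the third tangent bundle *)

Section Torsion.
Variable s : symmetry_jet M.

(** The vector s(x) z is written in both charts, and the two expressions are related by the second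
    tangent map of the transition t. Its quadratic part appears both in the components of z and in
    those of s(x) z, and solving for the symbol gives the inhomogeneous term. *)
Lemma christoffel_change i k x (V X : E) : dom0 i x -> dom0 k x ->
  let t : E -> E := phi0 i \o chi0 k in
  christoffel s i (phi0 i x) ('d t (phi0 k x : E) V) ('d t (phi0 k x : E) X) =
    'd t (phi0 k x : E) (christoffel s k (phi0 k x) V X) -
    ('d (tangent t) (phi0 k x : E, X) (V, 0)).2.
Proof.
move=> ix kx t; set u : E := phi0 k x.
have st : smooth t u by exact: (smooth_transition g0 kx ix).
have tu : t u = phi0 i x by rewrite /t /u /= mphiK.
pose z : Tk M 2 := chi2 k ((u, X), (V, 0)).
have zx : base z = x by rewrite /= mphiK.
have zE : phi2 k z = ((u, X), (V, 0)) by apply: chi2K => /=; rewrite !mphiK.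
have iz : dom0 i z.1.1 by rewrite (zx : z.1.1 = x).
have kz : dom0 k z.1.1 by rewrite (zx : z.1.1 = x).
pose H (X V : E) := ('d (tangent t) (u, X) (V, 0)).2.
have tE (X' V' W' : E) : tangent (tangent t) ((u, X'), (V', W')) =
    ((phi0 i x, 'd t u X'), ('d t u V', H X' V' + 'd t u W')).
  by rewrite -tu; exact: (congr1 (pair (t u, 'd t u X')) (diff_tangent X' V' W' st)).
have zi : phi2 i z = ((phi0 i x, 'd t u X), ('d t u V, H X V)).
  apply: (etrans (phi2_change kz iz)); rewrite zE; apply: (etrans (tE _ _ _)).
  by rewrite linear0 addr0.
have z1x := sjet_base s zx; set z1 := act (s x) z in z1x.
have iz1 : dom0 i z1.1.1 by rewrite z1x.
have kz1 : dom0 k z1.1.1 by rewrite z1x.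
have e1 := sjet_chart s kx zx zE; have e2 := sjet_chart s ix zx zi.
have e3 := phi2_change kz1 iz1.
have e4 := etrans e3 (etrans (congr1 (tangent (tangent t)) e1) (tE _ _ _)).
have := congr1 (fun p : (E * E) * (E * E) => p.2.2) (etrans (esym e2) e4).
rewrite -/u => {e1 e2 e3 e4} /=.
have Hl Y : linear (H Y).
  move=> c v w; rewrite /H.
  have -> : (c *: v + w, 0) = c *: (v, 0) + (w, 0) :> E * E.
    by rewrite -[RHS]/(c *: v + w, c *: 0 + 0) scaler0 addr0.
  by rewrite linearP.
(* [H] is the second derivative of t: linear in its second argument by construction, and in its
   first by symmetry, so the two signs cancel. *)
have HN : H (- X) (- V) = H X V.
  rewrite (linear_opp V (Hl (- X))) {1}/H (schwarz (- X) V st) -/(H V (- X)).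
  by rewrite (linear_opp X (Hl V)) opprK /H (schwarz V X st).
rewrite HN -/(H X V); set Gi := christoffel s i _ _ _; set Gk := christoffel s k _ _ _.
have -> : 'd t u (- 0 - 2 *: Gk) = - (2 *: 'd t u Gk).
  by rewrite oppr0 add0r; apply: (etrans (linearN _ _)); rewrite linearZ.
move: (H X V) ('d t u Gk) Gi => h g G e.
have : 2 *: (G - (g - h)) = 0.
  have -> : 2 *: (G - (g - h)) = (h - 2 *: g) - (- h - 2 *: G).
    by apply/rowP => l; rewrite !mxE; ring.
  by rewrite -e subrr.
by move/eqP; rewrite scaler_eq0 pnatr_eq0 /= subr_eq0 => /eqP.
Qed.

Definition torsion_form i (u V X : E) : E :=
  christoffel s i u V X - christoffel s i u X V.

(** The inhomogeneous term of [christoffel_change] is a second derivative, hence symmetric, and it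
    cancels in the torsion. *)
Lemma torsion_form_change i k x (V X : E) : dom0 i x -> dom0 k x ->
  let t : E -> E := phi0 i \o chi0 k in
  torsion_form i (phi0 i x) ('d t (phi0 k x : E) V) ('d t (phi0 k x : E) X) =
    'd t (phi0 k x : E) (torsion_form k (phi0 k x) V X).
Proof.
move=> ix kx t; have st : smooth t (phi0 k x : E) := smooth_transition g0 kx ix.
rewrite /torsion_form (christoffel_change V X ix kx) (christoffel_change X V ix kx).
rewrite -/t (schwarz X V st) (linearB ('d t (phi0 k x : E))) -/t.
by rewrite opprB addrA subrK.
Qed.

Lemma field_smooth_at i x Y : dom0 i x -> near_field i x Y ->
  smooth (comps i Y) (phi0 i x : E) -> @smooth_at R (Tk M 0) (Tk M 1) Y x.
Proof.
move=> ix nY sY; have iY : dom0 i (Y x).1 by rewrite (near_field_at ix nY).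
apply/(@smooth_atP R (Tk M 0) (Tk M 1) i i Y x g0 g1 ix iY).
have nE : \forall u \near phi0 i x, (Y (chi0 i u)).1 = chi0 i u /\
    (dom0 i (chi0 i u) /\ phi0 i (chi0 i u) = u).
  by apply: filterS2 nY (chart_near_at g0 ix) => u ? ?; split.
split; last by apply: filterS nE => u [Yu [iu uE]]; rewrite /= Yu.
apply: (@smooth_near _ _ _ (fun u => (u, comps i Y u))).
  apply: filterS nE => u [Yu [iu uE]].
  apply: injective_projections => //.
  by apply: esym; apply: etrans uE; exact: congr1 Yu.
exact: smooth_pair (smooth_id _) sY.
Qed.

Lemma field_change i j x Y : dom0 i x -> dom0 j x -> near_field i x Y ->
  smooth (comps i Y) (phi0 i x : E) ->
  near_field j x Y /\ smooth (comps j Y) (phi0 j x : E).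
Proof.
move=> ix jx nY sY; have sm := field_smooth_at ix nY sY.
have jY : dom0 j (Y x).1 by rewrite (near_field_at ix nY).
have [s1 _] := (@smooth_atP R (Tk M 0) (Tk M 1) j j Y x g0 g1 jx jY).1 sm.
split; last exact: smooth_comp s1 (smooth_snd _).
have st := smooth_transition g0 jx ix.
pose Q u := (Y (chi0 i u)).1 = chi0 i u.
have nQ : \forall w \near phi0 j x, Q ((phi0 i \o chi0 j) w).
  apply: (@near_continuous _ _ _ _ _ Q (smooth_continuous st)).
  by rewrite /= mphiK.
apply: filterS2 nQ (chart_near g0 jx ix) => w Qw [jw iw wE].
by move: Qw; rewrite /Q /= mphiK.
Qed.

Lemma torsion_chart U V x :
  near_field (at0 x) x U -> smooth (comps (at0 x) U) (phi0 (at0 x) x : E) ->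
  near_field (at0 x) x V -> smooth (comps (at0 x) V) (phi0 (at0 x) x : E) ->
  torsion s U V x =
    (x, torsion_form (at0 x) (phi0 (at0 x) x) (U x).2 (V x).2).
Proof.
move=> nU sU nV sV.
have eV := nabla_chart s U nV (smooth_differentiable sV).
have eU := nabla_chart s V nU (smooth_differentiable sU).
have alg (a b c d : E) : (a + c) - (b + d) - (a - b) = c - d.
  by apply/rowP => l; rewrite !mxE; ring.
by rewrite /torsion eU eV; exact: (congr1 (pair x) (alg _ _ _ _)).
Qed.

Lemma extend_near (v : Tk M 1) : \forall w \near phi0 (at0 v.1) v.1,
  (extend v (chi0 (at0 v.1) w)).1 = chi0 (at0 v.1) w /\
  comps (at0 v.1) (extend v) w = v.2.
Proof.
have ix : dom0 (at0 v.1) v.1 := mat_dom _.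
apply: filterS (chart_near_at g0 ix) => w [iw wE].
rewrite /comps /extend -[mphi _ _]/(phi0 (at0 v.1) (chi0 (at0 v.1) w)) wE.
by rewrite (chi1K _ iw wE).
Qed.

Lemma extend_at (v : Tk M 1) : extend v v.1 = v.
Proof. by case: v => x v; exact: chi1_at. Qed.

Lemma extend_field (v : Tk M 1) : near_field (at0 v.1) v.1 (extend v) /\
  smooth (comps (at0 v.1) (extend v)) (phi0 (at0 v.1) v.1 : E).
Proof.
split; first by apply: filterS (extend_near v) => w [].
apply: (@smooth_near _ _ _ (cst v.2)); last exact: smooth_cst.
by apply: filterS (extend_near v) => w [_ ->].
Qed.

Lemma near_near (V : normedModType R) (P : V -> Prop) (u : V) :
  (\forall w \near u, P w) -> \forall w \near u, \forall w' \near w, P w'.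
Proof.
move/nearP_open => [D [oD Du DP]].
by apply: (near_open oD Du) => w Dw; exact: near_open DP.
Qed.

Lemma extend_field_near (v : Tk M 1) : \forall w \near phi0 (at0 v.1) v.1,
  near_field (at0 v.1) (chi0 (at0 v.1) w) (extend v) /\
  smooth (comps (at0 v.1) (extend v)) (phi0 (at0 v.1) (chi0 (at0 v.1) w) : E).
Proof.
have ix : dom0 (at0 v.1) v.1 := mat_dom _.
apply: filterS2 (near_near (extend_near v)) (chart_near_at g0 ix) => w nw [iw wE].
rewrite /near_field wE; split; first by apply: filterS nw => w' [].
apply: (@smooth_near _ _ _ (cst v.2)); last exact: smooth_cst.
by apply: filterS nw => w' [_ ->].
Qed.

(** To differentiate the torsion as a field, its components are needed in one fixed chart. At a
    nearby point it is computed in the preferred chart of that point and carried back by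
    tensoriality. *)
Lemma torsion_extend_near (U V : Tk M 1) : U.1 = V.1 ->
  \forall w \near phi0 (at0 U.1) U.1,
    (torsion s (extend U) (extend V) (chi0 (at0 U.1) w)).1 = chi0 (at0 U.1) w /\
    comps (at0 U.1) (torsion s (extend U) (extend V)) w =
      torsion_form (at0 U.1) w U.2 V.2.
Proof.
move=> UV; set x := U.1; set i := at0 x; have ix : dom0 i x := mat_dom _.
have nW (W : Tk M 1) : W.1 = x -> \forall w \near phi0 i x,
    (near_field i (chi0 i w) (extend W) /\
     smooth (comps i (extend W)) (phi0 i (chi0 i w) : E)) /\
    ((extend W (chi0 i w)).1 = chi0 i w /\ comps i (extend W) w = W.2).
  move=> Wx; rewrite /i -Wx.
  by apply: filterS2 (extend_field_near W) (extend_near W) => w ? ?; split.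
have nU := nW U erefl; have nV := nW V (esym UV).
apply: filterS3 nU nV (chart_near_at g0 ix) => w.
move=> [[nU sU] [U1 U2]] [[nV sV] [V1 V2]] [iw wE].
set x' := chi0 i w in nU sU nV sV U1 V1 iw wE *.
have kx' : dom0 (at0 x') x' := mat_dom _.
have [nU' sU'] := field_change iw kx' nU sU.
have [nV' sV'] := field_change iw kx' nV sV.
have tE := torsion_chart nU' sU' nV' sV'.
split; first by rewrite tE.
rewrite /comps -/x' tE.
have := torsion_form_change (extend U x').2 (extend V x').2 iw kx'.
rewrite wE => /esym e; apply: (etrans e).
have c (W : Tk M 1) : (extend W x').1 = x' ->
    'd (phi0 i \o chi0 (at0 x')) (phi0 (at0 x') x' : E) (extend W x').2 =
    comps i (extend W) w.
  move=> W1; have eW : (x', (extend W x').2) = extend W x'.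
    by rewrite [RHS]surjective_pairing W1.
  exact: (congr1 (fun p => (phi1 i p).2) eW).
exact: congr2 (etrans (c U U1) U2) (etrans (c V V1) V2).
Qed.

Lemma nabla_extend x (U V : Tk M 1) : U.1 = x -> V.1 = x ->
  nabla_at s U (extend V) = (x, christoffel s (at0 x) (phi0 (at0 x) x) U.2 V.2).
Proof.
move=> Ux Vx; have := extend_field V; rewrite Vx => -[nV sV].
have EU : extend U x = U by rewrite -Ux extend_at.
have EV : extend V x = V by rewrite -Vx extend_at.
rewrite /nabla_at Ux (nabla_chart s _ nV (smooth_differentiable sV)) EU EV.
congr pair; rewrite -[RHS]add0r; congr (_ + _).
have nE : \forall w \near (phi0 (at0 x) x : E), cst V.2 w = comps (at0 x) (extend V) w.
  by rewrite -Vx; apply: filterS (extend_near V) => w [_ ->].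
have h := diff_val (is_diff_def := is_diff_near nE (is_diff_cst V.2 _)).
exact: (congr1 (fun f : E -> E => f U.2) h).
Qed.

Lemma torsion_at_chart x (U V : Tk M 1) : U.1 = x -> V.1 = x ->
  torsion_at s U V = (x, torsion_form (at0 x) (phi0 (at0 x) x) U.2 V.2).
Proof.
move=> Ux Vx; have := extend_field V; have := extend_field U.
rewrite Ux Vx => -[nU sU] [nV sV].
have EU : extend U x = U by rewrite -Ux extend_at.
have EV : extend V x = V by rewrite -Vx extend_at.
by rewrite /torsion_at Ux (torsion_chart nU sU nV sV) EU EV.
Qed.

Lemma torsion_form_differentiable i x (V X : E) : dom0 i x ->
  differentiable (fun w : E * (E * E) => torsion_form i w.1 w.2.1 w.2.2)
    ((phi0 i x, (V, X)) : E * (E * E)).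
Proof.
move=> ix; apply: smooth_differentiable; apply: smoothB.
  exact: christoffel_smooth.
pose sw (w : E * (E * E)) := (w.1, (w.2.2, w.2.1)).
have ssw : smooth sw (phi0 i x : E, (V, X)).
  apply: smooth_pair; first exact: smooth_fst.
  have s2 := @smooth_snd _ E (E * E)%type (phi0 i x : E, (V, X)).
  apply: smooth_pair; first exact: smooth_comp s2 (smooth_snd _).
  exact: smooth_comp s2 (smooth_fst _).
exact: smooth_comp ssw (christoffel_smooth s ix X V).
Qed.

Lemma torsion_form_linearl i x X : dom0 i x ->
  linear (fun V => torsion_form i (phi0 i x) V X).
Proof.
by move=> ix; exact: linear_sub (christoffel_linearl s ix X) (christoffel_linearr s ix X).
Qed.

Lemma torsion_form_linearr i x V : dom0 i x ->
  linear (torsion_form i (phi0 i x) V).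
Proof.
by move=> ix; exact: linear_sub (christoffel_linearr s ix V) (christoffel_linearl s ix V).
Qed.

Lemma is_diff_torsion_form1 i x (V X : E) : dom0 i x ->
  is_diff (phi0 i x : E) (fun w : E => torsion_form i w V X)
    (fun C : E => 'd (fun w : E * (E * E) => torsion_form i w.1 w.2.1 w.2.2)
      (phi0 i x : E, (V, X)) (C, 0)).
Proof.
move=> ix.
have d1 : is_diff (phi0 i x : E) (fun w : E => (w, (V, X))) (fun w : E => (w, 0)).
  exact: is_diff_pair.
exact: is_diff_comp d1 (differentiableP (torsion_form_differentiable V X ix)).
Qed.

(** Product rule: over a fixed base point the form is linear in each vector argument, so each of
    these contributes by substitution. *)
Lemma diff_torsion_form i x (A B C A' B' : E) : dom0 i x ->
  'd (fun w : E * (E * E) => torsion_form i w.1 w.2.1 w.2.2)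
     (phi0 i x : E, (A, B)) (C, (A', B')) =
  'd (fun w : E => torsion_form i w A B) (phi0 i x : E) C +
    torsion_form i (phi0 i x) A' B + torsion_form i (phi0 i x) A B'.
Proof.
move=> ix; set u : E := phi0 i x; set TT := fun w : E * (E * E) => _.
have dT : differentiable TT (u, (A, B)) := torsion_form_differentiable A B ix.
have -> : (C, (A', B')) = (C, 0) + (0, (A', 0)) + (0, (0, B')) :> E * (E * E).
  by rewrite -[RHS]/(C + 0 + 0, (0 + A' + 0, 0 + 0 + B')) !addr0 !add0r.
rewrite 2!linearD; congr (_ + _ + _).
- have h := diff_val (is_diff_def := is_diff_torsion_form1 A B ix).
  exact: esym (congr1 (fun f : E -> E => f C) h).
- apply: diff_affine_line => // t.
  have -> : t *: (0, (A', 0)) + (u, (A, B)) = (u, (t *: A' + A, B)) :> E * (E * E).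
    rewrite -[LHS]/(t *: (0 : E) + u, (t *: A' + A, t *: (0 : E) + B)).
    by rewrite !scaler0 !add0r.
  exact: etrans (torsion_form_linearl B ix t A' A) (addrC _ _).
- apply: diff_affine_line => // t.
  have -> : t *: (0, (0, B')) + (u, (A, B)) = (u, (A, t *: B' + B)) :> E * (E * E).
    rewrite -[LHS]/(t *: (0 : E) + u, (t *: (0 : E) + A, t *: B' + B)).
    by rewrite !scaler0 !add0r.
  exact: etrans (torsion_form_linearr A ix t B' B) (addrC _ _).
Qed.

(** The extensions have constant components, so their covariant derivatives reduce to the
    Christoffel terms G(Z, U) and G(Z, V). *)
Lemma nabla_torsion_chart x (Z U V : Tk M 1) :
  Z.1 = x -> U.1 = x -> V.1 = x ->
  let i := at0 x in let u := phi0 i x in let G := christoffel s i u in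
  let T := torsion_form i u in
  nabla_torsion s Z U V =
    (x, 'd (fun w : E => torsion_form i w U.2 V.2) (u : E) Z.2
        + G Z.2 (T U.2 V.2) - T (G Z.2 U.2) V.2 - T U.2 (G Z.2 V.2)).
Proof.
move=> Zx Ux Vx i u G T.
have ix : dom0 i x := mat_dom _.
have nT := torsion_extend_near (etrans Ux (esym Vx)); rewrite Ux -/i -/u in nT.
have nTf : near_field i x (torsion s (extend U) (extend V)) by apply: filterS nT => w [].
have d2 := is_diff_torsion_form1 U.2 V.2 ix.
have d3 := differentiableP (ex_diff (is_diff_def := d2)).
have nE : \forall w \near (u : E), torsion_form i w U.2 V.2 =
    comps i (torsion s (extend U) (extend V)) w.
  by apply: filterS nT => w [_ ->].
have d4 := is_diff_near nE d3.
have EZ : extend Z x = Z by rewrite -Zx extend_at.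
have TE : torsion s (extend U) (extend V) x = (x, T U.2 V.2).
  by have := torsion_at_chart Ux Vx; rewrite /torsion_at Ux.
have e1 : nabla_at s Z (torsion s (extend U) (extend V)) =
    (x, 'd (fun w : E => torsion_form i w U.2 V.2) (u : E) Z.2 + G Z.2 (T U.2 V.2)).
  rewrite /nabla_at Zx (nabla_chart s _ nTf (ex_diff (is_diff_def := d4))) EZ TE.
  exact: (congr1 (fun f : E -> E => (x, f Z.2 + G Z.2 (T U.2 V.2)))
    (diff_val (is_diff_def := d4))).
rewrite /nabla_torsion e1 (nabla_extend Zx Ux) (nabla_extend Zx Vx).
rewrite (torsion_at_chart (x := x) (U := (x, _)) erefl Vx).
by rewrite (torsion_at_chart (x := x) (V := (x, _)) Ux erefl).
Qed.

End Torsion.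

(** * The actions of S(xi) and SS(xi), and their comparison by Pi *)

Section Main.
Variable s : symmetry_jet M.

Lemma tmap_T2 (h : Tk M 2 -> Tk M 2) (t : Tk M 3) :
  tmap h t = (h t.1, 'd (phi2 (at2 (h t.1)) \o h \o chi2 (at2 t.1))
    (phi2 (at2 t.1) t.1) t.2).
Proof. by []. Qed.

Lemma p3_starE (z : Tk M 3) : p3_star z = (z.1.1, z.2.1).
Proof. exact: (tmap_proj (N := Tk M 1) z g1). Qed.

Lemma p3_sstarE (z : Tk M 3) :
  p3_sstar z = ((z.1.1.1, z.1.2.1), (z.2.1.1, z.2.2.1)).
Proof. exact: (tmap_tmap_proj (N := Tk M 0) z g0). Qed.

Lemma is_Pi_components (z1 z2 : Tk M 3) (m : Tk M 2) y (c1 c2 c3 c4 c5 c6 : E) :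
  m.1.1 = y -> z1 = (m, ((c1, c2), (c3, c4 + c5))) ->
  z2 = (m, ((c1, c2), (c3, c4 + c6))) -> is_Pi z1 z2 (y, c5 - c6).
Proof.
move=> my e1 e2.
have [z11 z21] : z1.1 = m /\ z2.1 = m by rewrite e1 e2.
have [z12 z22] : z1.2 = ((c1, c2), (c3, c4 + c5)) /\ z2.2 = ((c1, c2), (c3, c4 + c6)).
  by rewrite e1 e2.
split.
- exact: etrans z11 (esym z21).
- by rewrite !p3_starE z11 z21 z12 z22.
- by rewrite !p3_sstarE z11 z21 z12 z22.
- rewrite -[base z1]/(z1.1.1.1) z11 my z12 z22; congr pair => /=.
  by apply/rowP => l; rewrite !mxE; ring.
Qed.

(** Existence makes the choice operator in [S] return an affine extension instead of its default. *)
Lemma S_affine (xi : arrow M 1) : B1 xi -> is_affine_extension s xi (S s xi).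
Proof. by move=> Bxi; exact: (xgetPex _ (affine_extension_exists s Bxi)). Qed.

Lemma S_tgt (xi : arrow M 1) : B1 xi -> tgt (S s xi) = tgt xi.
Proof. by move=> /S_affine[b [_ -> /= -> _ _]]. Qed.

Lemma S_src (xi : arrow M 1) : B1 xi -> src (S s xi) = src xi.
Proof. by move=> /S_affine[b [_ -> _ _ _]]. Qed.

Lemma S_base (xi : arrow M 1) (z : Tk M 2) : B1 xi -> base z = src xi ->
  (act (S s xi) z).1.1 = tgt xi.
Proof.
move=> /S_affine[b [bx -> bE _ _]] zx.
by rewrite (jet_base bx zx) bE.
Qed.

Lemma S_chart (xi : arrow M 1) i j (z : Tk M 2) (X V W : E) : B1 xi ->
  dom0 i (src xi) -> dom0 j (tgt xi) -> base z = src xi ->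
  phi2 i z = ((phi0 i (src xi), X), (V, W)) ->
  let L := arrow_lin i j xi in
  phi2 j (act (S s xi) z) = ((phi0 j (tgt xi), L X), (L V, L W +
    (L (christoffel s i (phi0 i (src xi)) V X) -
     christoffel s j (phi0 j (tgt xi)) (L V) (L X)))).
Proof.
move=> Bxi ix jy zx zE L; have [b [bx -> bE sh aff]] := S_affine Bxi.
rewrite -{1}bE in jy; rewrite -{1}bE in aff.
have {}aff : forall (v : Tk M 1) (Y : M -> Tk M 1),
    base v = src xi -> vector_field_near (src xi) Y ->
    act (b (src xi)) (nabla_at s v Y) = nabla_at s (act (b (src xi)) v) (push b Y).
  by rewrite bE; move: aff; rewrite bE.
have := affine_chart bx sh aff ix jy zx zE.
by rewrite bE.
Qed.

Section Holonomic.
Variables (xi : arrow M 1) (a : local_bisection (@B1 R n M)).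
Hypotheses (Bxi : B1 xi) (ax : bdom a (src xi)) (aS : S s xi = jet a (src xi)).
Hypothesis hol : holonomic (S s xi).
Local Notation x := (src xi).
Local Notation y := (tgt xi).
Local Notation i := (at0 x).
Local Notation j := (at0 y).
Local Notation u0 := (phi0 i x : E).
Local Notation w0 := (phi0 j y : E).
Local Notation L := (arrow_lin i j xi).
Local Notation f := (bis0 i j a).
Local Notation F := (bis1 i j a).
Local Notation Gi := (christoffel s i).
Local Notation Gj := (christoffel s j).

Let ix : dom0 i x := mat_dom x.
Let jy : dom0 j y := mat_dom y.
Let ty : tgt (a x) = y.
Proof. by rewrite -(S_tgt Bxi) aS. Qed.
Let jay : dom0 j (tgt (a x)).
Proof. by rewrite ty. Qed.
Let lL : linear L := arrow_lin_linear j Bxi ix.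

Let fibre_point (X V : E) : exists z : Tk M 2,
  base z = x /\ phi2 i z = ((u0, X), (V, 0)).
Proof.
exists (chi2 i ((u0, X), (V, 0))); split; first by rewrite /= mphiK.
by apply: chi2K => /=; rewrite !mphiK.
Qed.

(** The jet of [a] and S(xi) are the same arrow on T^2M. Comparing their two chart expressions
    determines the value, the base derivative and the quadratic term of [a] at the source. *)
Lemma jet_S_chart (X V : E) :
  [/\ F (u0, X) = L X, 'd f u0 V = L V &
      bis_diff a x i j V X = L (Gi u0 V X) - Gj w0 (L V) (L X)].
Proof.
have [z [zx zE]] := fibre_point X V.
have e1 := jet_chart ax ix jay zx zE.
have e2 := S_chart Bxi ix jy zx zE; rewrite aS e1 in e2.
have F0 : F (u0, 0) = 0 := linear_zero (bis1_linear_at j ax ix).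
split.
- exact: (congr1 (fun p : (E * E) * (E * E) => p.1.2) e2).
- exact: (congr1 (fun p : (E * E) * (E * E) => p.2.1) e2).
have := congr1 (fun p : (E * E) * (E * E) => p.2.2) e2.
by rewrite [LHS]/= [RHS]/= F0 (linear_zero lL) !add0r.
Qed.

Lemma bis0_at : f u0 = w0.
Proof. by rewrite bis0E // ty. Qed.

Lemma bis1_at X : F (u0, X) = L X.
Proof. by have [] := jet_S_chart X X. Qed.

Lemma diff_bis0 V : 'd f u0 V = L V.
Proof. by have [] := jet_S_chart V V. Qed.

Lemma bis_diffE V X : bis_diff a x i j V X = L (Gi u0 V X) - Gj w0 (L V) (L X).
Proof. by have [] := jet_S_chart X V. Qed.

(** When S(xi) is the 2-jet of a diffeomorphism [h], it acts by the second tangent map of [h], so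
    the quadratic term is a second derivative and the Schwarz lemma applies. *)
Lemma holonomic_symmetric V X : bis_diff a x i j V X = bis_diff a x i j X V.
Proof.
have [U [h [g [hd]]]] := hol; rewrite (S_src Bxi) => Ux Sh.
have [_ _ _ sh _] := hd; have {}sh := sh x Ux.
have hx : h x = y by rewrite -(S_tgt Bxi) Sh.
have hT : hat (dif h) = @tmap R (Tk M 0) (Tk M 0) h.
  by apply/funext => z; rewrite /hat /=; case: asboolP.
have jh : dom0 j (h x) by rewrite hx.
pose t : E -> E := phi0 j \o h \o chi0 i.
have st : smooth t u0.
  by have [] := (@smooth_atP R (Tk M 0) (Tk M 0) i j h x g0 g0 ix jh).1 sh.
have BH V' X' : bis_diff a x i j V' X' = ('d (tangent t) (u0, X') (V', 0)).2.
  have [z [zx zE]] := fibre_point X' V'.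
  have e1 := jet_chart ax ix jay zx zE.
  have iz : dom0 i z.1.1 by rewrite (zx : z.1.1 = x).
  have jz : dom0 j (h z.1.1) by rewrite (zx : z.1.1 = x).
  have sz : @smooth_at R (Tk M 0) (Tk M 0) h z.1.1 by rewrite (zx : z.1.1 = x).
  have e2 := @tmap_tmap_chart R (Tk M 0) i j h z g0 iz jz sz.
  have e3 : act (jet a x) z = tmap (@tmap R (Tk M 0) (Tk M 0) h) z.
    apply: (etrans (congr1 (fun eta => act eta z) (etrans (esym aS) Sh))).
    exact: (etrans (jetE (dif h) zx) (congr1 (fun b => tmap b z) hT)).
  rewrite -e3 in e2.
  have := congr1 (fun p : (E * E) * (E * E) => p.2.2) (etrans (esym e1) e2).
  have F0 : F (u0, 0) = 0 := linear_zero (bis1_linear_at j ax ix).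
  rewrite [LHS]/= F0 add0r => ->.
  by rewrite -[phi _ z]/(phi2 i z) zE.
by rewrite !BH (schwarz X V st).
Qed.

(** The antisymmetric part of the quadratic term, L G(V, X) - G'(L V, L X) minus the same with V and
    X exchanged, is zero. *)
Lemma torsion_preserved V X :
  L (torsion_form s i u0 V X) = torsion_form s j w0 (L V) (L X).
Proof.
have := holonomic_symmetric V X; rewrite !bis_diffE => e.
rewrite /torsion_form (linear_add _ (- _) lL) (linear_opp _ lL).
move: (L (Gi u0 V X)) (L (Gi u0 X V)) (Gj w0 (L V) (L X)) (Gj w0 (L X) (L V)) e.
move=> p q p' q' e; apply/eqP; rewrite subr_eq -[p](subrK p') e.
by apply/eqP/rowP => l; rewrite !mxE; ring.
Qed.

(* For x' near x, S(a(x')) acts on T^2M by S_local in charts, and S_quad is   *)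
(* its quadratic term.                                                        *)
Definition S_quad (z : E * (E * E)) : E :=
  F (z.1, Gi z.1 z.2.1 z.2.2) - Gj (f z.1) (F (z.1, z.2.1)) (F (z.1, z.2.2)).

Definition S_local (m : (E * E) * (E * E)) : (E * E) * (E * E) :=
  ((f m.1.1, F m.1), (F (m.1.1, m.2.1),
     F (m.1.1, m.2.2) + S_quad (m.1.1, (m.2.1, m.1.2)))).

Local Notation Sa := (fun x' => S s (a x')).

(** [S_chart] applied to a(x') for every x' near the source, with the charts [i] and [j] held
    fixed. *)
Lemma S_local_near (m : (E * E) * (E * E)) : m.1.1 = u0 ->
  \forall m' \near m, S_local m' = (phi2 j \o hat Sa \o chi2 i) m'.
Proof.
move=> mu; have nb := bis_near ax ix jay.
pose Q u := [/\ dom0 i (chi0 i u), phi0 i (chi0 i u) = u,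
  bdom a (chi0 i u) & dom0 j (tgt (a (chi0 i u)))].
have nQ : \forall m' \near m, Q m'.1.1.
  apply: (@near_fst_pair _ (E * E)%type (E * E)%type (fun p => Q p.1)).
  by apply: (@near_fst_pair _ E E Q); rewrite mu.
apply: filterS nQ => -[[u X] [V W]]; rewrite [_.1.1]/= => -[iu uE au ju].
set x' := chi0 i u in iu uE au ju.
have Ba := bisection_in au; have sx := bisection_src au.
have su : phi0 i (src (a x')) = u by rewrite sx.
pose z : Tk M 2 := chi2 i ((u, X), (V, W)).
have zE : phi2 i z = ((phi0 i (src (a x')), X), (V, W)).
  by rewrite su; exact: (chi2K (z := ((u, X), (V, W))) iu uE).
have zx : base z = src (a x') by rewrite sx.
have ix' : dom0 i (src (a x')) by rewrite sx.
have e := S_chart Ba ix' ju zx zE; cbv zeta in e.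
have LE v : arrow_lin i j (a x') v = F (u, v) by rewrite bis1_arrow_lin.
rewrite !LE in e; apply: esym; apply: (etrans e).
exact: (congr1 (fun w : E => ((f u, F (u, X)), (F (u, V), F (u, W) +
  (F (u, Gi w V X) - Gj (f u) (F (u, V)) (F (u, X)))))) su).
Qed.

Lemma S_quad_differentiable V X : differentiable S_quad ((u0, (V, X)) : E * (E * E)).
Proof.
pose z : E * (E * E) := (u0, (V, X)).
have s1 := @smooth_fst _ E (E * E)%type z; have s2 := @smooth_snd _ E (E * E)%type z.
have s21 := smooth_comp s2 (@smooth_fst _ E E z.2).
have s22 := smooth_comp s2 (@smooth_snd _ E E z.2).
have sF (W : E) : smooth F (u0, W) := bis1_smooth ax ix jay W.
have sf := smooth_comp s1 (bis0_smooth ax ix jay : smooth f z.1).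
apply: smooth_differentiable; apply: smoothB.
  exact: smooth_comp (smooth_pair s1 (christoffel_smooth s ix V X)) (sF _).
have sV := smooth_comp (smooth_pair s1 s21) (sF V).
have sX := smooth_comp (smooth_pair s1 s22) (sF X).
have sG := christoffel_smooth s jy (L V) (L X).
rewrite -!bis1_at -bis0_at in sG.
exact: smooth_comp (smooth_pair sf (smooth_pair sV sX)) sG.
Qed.

Lemma diff_S_local (X V W : E) :
  is_diff (((u0, X), (V, W)) : (E * E) * (E * E)) S_local
    (fun q : (E * E) * (E * E) => (('d f u0 q.1.1, 'd F (u0, X) q.1),
       ('d F (u0, V) (q.1.1, q.2.1), 'd F (u0, W) (q.1.1, q.2.2) +
        'd S_quad (u0, (V, X)) (q.1.1, (q.2.1, q.1.2))))).
Proof.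
pose p : (E * E) * (E * E) := ((u0, X), (V, W)).
have p1 := @is_diff_fst _ (E * E)%type (E * E)%type p.
have p2 := @is_diff_snd _ (E * E)%type (E * E)%type p.
have p11 := is_diff_comp p1 (@is_diff_fst _ E E p.1).
have p12 := is_diff_comp p1 (@is_diff_snd _ E E p.1).
have p21 := is_diff_comp p2 (@is_diff_fst _ E E p.2).
have p22 := is_diff_comp p2 (@is_diff_snd _ E E p.2).
have dF (v : E) : is_diff ((u0, v) : E * E) F ('d F (u0, v)).
  exact/differentiableP/bis1_differentiable.
have df : is_diff u0 f ('d f u0).
  exact/differentiableP/smooth_differentiable/bis0_smooth.
have dQ := differentiableP (S_quad_differentiable V X).
have d1 := is_diff_comp p11 (df : is_diff ((fst \o fst) p) f _).
have d2 := is_diff_comp p1 (dF X : is_diff (p.1) F _).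
have d3 := is_diff_comp (is_diff_pair p11 p21) (dF V).
have d4 := is_diff_comp (is_diff_pair p11 p22) (dF W).
have d5 := is_diff_comp (is_diff_pair p11 (is_diff_pair p21 p12)) dQ.
exact: is_diff_pair (is_diff_pair d1 d2) (is_diff_pair d3 (is_diffD d4 d5)).
Qed.

(* The left hand side is the derivative of the map q of the proof, which is   *)
(* zero on the fibre over u0 because xi preserves the torsion.                *)
Lemma diff_S_quad_antisym (V X Z dV dX : E) :
  let Ti := torsion_form s i in let Tj := torsion_form s j in
  'd S_quad (u0, (V, X)) (Z, (dV, dX)) - 'd S_quad (u0, (X, V)) (Z, (dX, dV)) =
  L ('d (fun w : E => Ti w V X) u0 Z + Gi u0 Z (Ti u0 V X)
     - Ti u0 (Gi u0 Z V) X - Ti u0 V (Gi u0 Z X))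
  - ('d (fun w : E => Tj w (L V) (L X)) w0 (L Z) + Gj w0 (L Z) (Tj w0 (L V) (L X))
     - Tj w0 (Gj w0 (L Z) (L V)) (L X) - Tj w0 (L V) (Gj w0 (L Z) (L X))).
Proof.
move=> Ti Tj.
pose z : E * (E * E) := (u0, (V, X)).
pose sw (w : E * (E * E)) := (w.1, (w.2.2, w.2.1)).
pose q (w : E * (E * E)) :=
  F (w.1, Ti w.1 w.2.1 w.2.2) - Tj (f w.1) (F (w.1, w.2.1)) (F (w.1, w.2.2)).
have dsw : is_diff z sw sw.
  have p2 := @is_diff_snd _ E (E * E)%type z.
  have p21 := is_diff_comp p2 (@is_diff_fst _ E E z.2).
  have p22 := is_diff_comp p2 (@is_diff_snd _ E E z.2).
  exact: is_diff_pair (@is_diff_fst _ E (E * E)%type z) (is_diff_pair p22 p21).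
have dQ := differentiableP (S_quad_differentiable V X).
have dQ' := differentiableP (S_quad_differentiable X V).
have dS := is_diffB dQ (is_diff_comp dsw (dQ' : is_diff (sw z) S_quad _)).
(* Antisymmetrizing [S_quad] replaces each Christoffel symbol by its torsion; the term inside F is
   handled by linearity of F in the fibre. *)
have nq : \forall w \near z, (S_quad - (S_quad \o sw)) w = q w.
  pose Q u := [/\ dom0 i (chi0 i u), phi0 i (chi0 i u) = u,
    bdom a (chi0 i u) & dom0 j (tgt (a (chi0 i u)))].
  have nQ : \forall w \near z, Q w.1.
    exact: (@near_fst_pair _ E (E * E)%type Q z (bis_near ax ix jay)).
  apply: filterS nQ => -[u [v w]] [iu uE au _].
  have lF := bis1_linear j iu uE au.
  rewrite -[LHS]/(F (u, Gi u v w) - Gj (f u) (F (u, v)) (F (u, w)) -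
    (F (u, Gi u w v) - Gj (f u) (F (u, w)) (F (u, v)))).
  rewrite -[RHS]/(F (u, Gi u v w - Gi u w v) -
    (Gj (f u) (F (u, v)) (F (u, w)) - Gj (f u) (F (u, w)) (F (u, v)))).
  rewrite (linear_add (Gi u v w) (- Gi u w v) lF) (linear_opp (Gi u w v) lF).
  move: (F (u, Gi u v w)) (F (u, Gi u w v)) (Gj _ _ _) (Gj _ _ _) => b c d e.
  by apply/rowP => l; rewrite !mxE; ring.
have dq := is_diff_near nq dS.
have dqz : differentiable q z := ex_diff (is_diff_def := dq).
have e1 := congr1 (fun h : E * (E * E) -> E => h (Z, (dV, dX)))
  (diff_val (is_diff_def := dq)).
apply: (etrans (esym e1)).
have -> : (Z, (dV, dX)) = (Z, 0) + (0, (dV, dX)) :> E * (E * E).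
  by rewrite -[RHS]/(Z + 0, (0 + dV, 0 + dX)) addr0 !add0r.
(* Preservation of the torsion, at all vectors over u0; hence the fibre part (dV, dX) of the
   direction does not contribute. *)
have q0 v w : q (u0, (v, w)) = 0.
  by rewrite /q /= bis0_at !bis1_at torsion_preserved subrr.
rewrite linearD [X in _ + X](_ : _ = 0); last first.
  apply: diff_affine_line => // t.
  have -> : t *: (0, (dV, dX)) + z = (u0, (t *: dV + V, t *: dX + X)).
    rewrite -[LHS]/(t *: (0 : E) + u0, (t *: dV + V, t *: dX + X)).
    by rewrite scaler0 add0r.
  by rewrite !q0 scaler0 addr0.
rewrite addr0.
have d1 : is_diff u0 (fun u : E => (u, (V, X))) (fun u : E => (u, 0)).
  exact: is_diff_pair.
have dqu := is_diff_comp d1 (differentiableP dqz : is_diff (u0, (V, X)) q _).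
have e2 := congr1 (fun h : E -> E => h Z) (diff_val (is_diff_def := dqu)).
apply: (etrans (esym e2)) => {e1 e2}.
have dt := differentiableP (ex_diff (is_diff_def := is_diff_torsion_form1 s V X ix)).
have df : is_diff u0 f ('d f u0).
  exact/differentiableP/smooth_differentiable/bis0_smooth.
have dF := differentiableP (bis1_differentiable ax ix jay (Ti u0 V X)).
have da := is_diff_comp (is_diff_pair (is_diff_id u0) dt) dF.
pose TT (w : E * (E * E)) := Tj w.1 w.2.1 w.2.2.
have dT : is_diff ((f u0, (F (u0, V), F (u0, X))) : E * (E * E)) TT
    ('d TT (w0, (L V, L X))).
  rewrite bis0_at !bis1_at; apply: differentiableP.
  exact: (torsion_form_differentiable s (L V) (L X) jy).
have dF' v := is_diff_bis1 ax ix jay v.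
have db := is_diff_comp (is_diff_pair df (is_diff_pair (dF' V) (dF' X))) dT.
have e3 := congr1 (fun h : E -> E => h Z) (diff_val (is_diff_def := is_diffB da db)).
apply: (etrans e3) => {e3}.
rewrite -[LHS]/('d F (u0, Ti u0 V X) (Z, 'd (fun w : E => Ti w V X) u0 Z) -
  'd TT (w0, (L V, L X)) ('d f u0 Z, (bis_diff a x i j Z V, bis_diff a x i j Z X))).
have eF := diff_fibre_linear Z ('d (fun w : E => Ti w V X) u0 Z)
  (bis1_differentiable ax ix jay (Ti u0 V X)) (bis1_linear_at j ax ix).
have eT := diff_torsion_form s (L V) (L X) ('d f u0 Z) (bis_diff a x i j Z V)
  (bis_diff a x i j Z X) jy.
have eL : L (Ti u0 V X) = Tj w0 (L V) (L X) := torsion_preserved V X.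
have eB := etrans (bis_diffE Z (Ti u0 V X))
  (congr1 (fun v => L (Gi u0 Z (Ti u0 V X)) - Gj w0 (L Z) v) eL).
have {}eF := etrans eF (congr2 (fun v w : E => v + w) eB (bis1_at _)).
have lT X' := torsion_form_linearl s X' jy; have rT V' := torsion_form_linearr s V' jy.
(* The derivative of F(u, V) along Z is L G(Z, V) - G'(L Z, L V). Preservation of the torsion moves
   L out of the first of the resulting terms, which then belongs to the source. *)
have eV : Tj w0 (bis_diff a x i j Z V) (L X) =
    L (Ti u0 (Gi u0 Z V) X) - Tj w0 (Gj w0 (L Z) (L V)) (L X).
  rewrite bis_diffE torsion_preserved -(linear_opp _ (lT (L X))).
  exact: (linear_add _ _ (lT (L X))).
have eX : Tj w0 (L V) (bis_diff a x i j Z X) =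
    L (Ti u0 V (Gi u0 Z X)) - Tj w0 (L V) (Gj w0 (L Z) (L X)).
  rewrite bis_diffE torsion_preserved -(linear_opp _ (rT (L V))).
  exact: (linear_add _ _ (rT (L V))).
have eD : 'd (fun w : E => Tj w (L V) (L X)) w0 ('d f u0 Z) =
    'd (fun w : E => Tj w (L V) (L X)) w0 (L Z).
  exact: (congr1 (fun v : E => 'd (fun w : E => Tj w (L V) (L X)) w0 v) (diff_bis0 Z)).
have {}eT := etrans eT (congr2 (fun v w : E => v + w)
  (congr2 (fun v w : E => v + w) eD eV) eX).
apply: (etrans (congr2 (fun v w : E => v - w) eF eT)).
have alg (d g t1 t2 d' g' t1' t2' : E) :
    (L g - g') + L d - (d' + (L t1 - t1') + (L t2 - t2')) =
    L (d + g - t1 - t2) - (d' + g' - t1' - t2').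
  rewrite (linear_add _ (- t2) lL) (linear_opp t2 lL) (linear_add _ (- t1) lL).
  rewrite (linear_opp t1 lL) (linear_add d g lL).
  move: (L d) (L g) (L t1) (L t2) => *.
  by apply/rowP => l; rewrite !mxE; ring.
exact: alg.
Qed.

(** The representative is given only through its jet. The jet determines F(u0, .) and the target,
    hence the arrow. *)
Lemma bisection_at : a x = xi.
Proof.
have [La [_ aE]] := B1P (bisection_in ax); have [Lx [_ xE]] := B1P Bxi.
rewrite (bisection_src ax) ty in aE.
have actE (L' : E -> E) v : act (lin_arrow x y L') (x, v) = (y, L' v).
  by rewrite /=; case: asboolP.
rewrite aE [RHS]xE; congr lin_arrow; apply/funext => v.
have h1 : F (u0, v) = La v.
  by rewrite /bis1 chi1_at /hat (_ : base ((x, v) : Tk M 1) = x) // aE actE phi1_at.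
have h2 : L v = Lx v.
  by rewrite arrow_lin_at // (congr1 (fun b : arrow M 1 => act b (x, v)) xE) actE.
by rewrite -h1 -h2 bis1_at.
Qed.

(** The preferred charts at [t.1] and at its image are [i] and [j], so the differential that defines
    the jet is that of [S_local]. *)
Lemma act_jet_S (t : Tk M 3) (X V W : E) : base t = x ->
  phi2 i t.1 = ((u0, X), (V, W)) ->
  [/\ act (jet Sa x) t = (hat Sa t.1, 'd S_local ((u0, X), (V, W)) t.2),
      (hat Sa t.1).1.1 = y & phi2 j (hat Sa t.1) = S_local ((u0, X), (V, W))].
Proof.
move=> tx tE; have tx1 : t.1.1.1 = x by exact: tx.
have aE : Sa x = S s xi.
  by rewrite bisection_at.
have hE : hat Sa t.1 = act (S s xi) t.1.
  by rewrite /hat (_ : base (t.1 : Tk M 2) = x) // aE.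
have hy : (hat Sa t.1).1.1 = y by rewrite hE S_base.
have tK : chi2 i ((u0, X), (V, W)) = t.1.
  have it : dom0 i t.1.1.1 by rewrite tx1.
  by rewrite -tE; exact: (@phiK R (Tk M 2) g2 i t.1 it).
have nS := S_local_near (m := ((u0, X), (V, W))) erefl.
have pE : phi2 j (hat Sa t.1) = S_local ((u0, X), (V, W)).
  by rewrite -tK; exact: esym (nbhs_singleton nS).
refine (And3 _ hy pE); apply: (etrans (jetE Sa tx)).
have dS := is_diff_near nS (diff_S_local X V W).
have d0 := diff_val (is_diff_def := dS).
have d1 := diff_val (is_diff_def := diff_S_local X V W).
have e : 'd (phi2 (at2 (hat Sa t.1)) \o hat Sa \o chi2 (at2 t.1))
    (phi2 (at2 t.1) t.1) t.2 =
    'd S_local ((u0, X), (V, W)) t.2.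
  have -> : at2 (hat Sa t.1) = j by exact: (congr1 at0 hy).
  have -> : at2 t.1 = i by exact: (congr1 at0 tx1).
  rewrite tE.
  exact: (congr1 (fun h : (E * E) * (E * E) -> (E * E) * (E * E) => h t.2)
    (etrans d0 (esym d1))).
apply: (etrans (tmap_T2 (hat Sa) t)).
move: (hat Sa t.1) e => m e.
by refine (f_equal (pair m) _); exact e.
Qed.

(** Conjugating by kappa_* exchanges (X, dX) with (V, dV) before the action and undoes the exchange
    of components after it. The terms in F return to their places, and only the order of the
    arguments of [S_quad] remains changed. *)
Lemma is_Pi_jet_S (t : Tk M 3) (X V W Z dX dV dW : E) : base t = x ->
  phi2 i t.1 = ((u0, X), (V, W)) -> t.2 = ((Z, dX), (dV, dW)) ->
  is_Pi (act (jet Sa x) t) (act (kappa_arrow (jet Sa x)) t)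
    (y, 'd S_quad (u0, (V, X)) (Z, (dV, dX)) - 'd S_quad (u0, (X, V)) (Z, (dX, dV))).
Proof.
move=> tx tE t2.
have kx : base (kappa_star t) = x.
  by rewrite kappa_starE; exact: etrans (kappa_base t.1) tx.
have it : dom0 i t.1.1.1 by rewrite (tx : t.1.1.1 = x).
have kE : phi2 i (kappa_star t).1 = ((u0, V), (X, W)).
  by rewrite kappa_starE (phi2_kappa it) tE.
have k2 : (kappa_star t).2 = ((Z, dV), (dX, dW)) by rewrite kappa_starE t2.
have [E1 y1 p1] := act_jet_S tx tE.
have [E2 y2 p2] := act_jet_S kx kE.
have z2E : act (kappa_arrow (jet Sa x)) t = kappa_star (act (jet Sa x) (kappa_star t)).
  by rewrite /kappa_arrow; move: (act (jet Sa x)) => h /=; case: asboolP.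
set m1 := hat Sa t.1 in E1 y1 p1; set m2 := hat Sa (kappa_star t).1 in E2 y2 p2.
have d1 := congr1 (fun h : (E * E) * (E * E) -> (E * E) * (E * E) => h t.2)
  (diff_val (is_diff_def := diff_S_local X V W)).
have d2 := congr1 (fun h : (E * E) * (E * E) -> (E * E) * (E * E) => h (kappa_star t).2)
  (diff_val (is_diff_def := diff_S_local V X W)).
rewrite t2 /= in d1; rewrite k2 /= in d2.
(* Agreement under the projection p: the two points of T^2M have quadratic terms with V and X
   exchanged, equal by holonomy. *)
have mE : m1 = kappa m2.
  have jm1 : dom0 j m1.1.1 by rewrite y1.
  have jm2 : dom0 j m2.1.1 by rewrite y2.
  have jk : dom0 j (kappa m2).1.1 by rewrite kappa_base.
  apply: (phi2_inj jm1 jk); rewrite (phi2_kappa jm2) p1 p2.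
  rewrite /S_local /swap_mid /=; congr (_, (_, _ + _)).
  by rewrite /S_quad /= bis0_at !bis1_at -!bis_diffE holonomic_symmetric.
have E1' : act (jet Sa x) t = (m1, (('d f u0 Z, 'd F (u0, X) (Z, dX)),
    ('d F (u0, V) (Z, dV), 'd F (u0, W) (Z, dW) + 'd S_quad (u0, (V, X)) (Z, (dV, dX))))).
  by rewrite E1; refine (f_equal (pair m1) _); rewrite t2; exact d1.
have E2' : act (kappa_arrow (jet Sa x)) t =
    (m1, (('d f u0 Z, 'd F (u0, X) (Z, dX)),
    ('d F (u0, V) (Z, dV), 'd F (u0, W) (Z, dW) + 'd S_quad (u0, (X, V)) (Z, (dX, dV))))).
  rewrite z2E E2 kappa_starE mE; refine (f_equal (pair (kappa m2)) _).
  by rewrite k2; refine (f_equal (@swap_mid R E) d2).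
exact: is_Pi_components y1 E1' E2'.
Qed.

End Holonomic.

Lemma exists_SS (xi : arrow M 1) : B1 xi -> exists a : local_bisection (@B1 R n M),
  [/\ bdom a (src xi), S s xi = jet a (src xi) &
      SS s xi = jet (fun x' => S s (a x')) (src xi)].
Proof.
move=> Bxi; have [b [bx Sb _ _ _]] := S_affine Bxi.
have ex : exists eta, is_SS s xi eta by exists (jet (fun x' => S s (b x')) (src xi)), b.
by have [a aP] : is_SS s xi (SS s xi) := xgetPex _ ex; exists a.
Qed.

End Main.

End Charts.

Unset Implicit Arguments.

Theorem proposition7p1 (R : realType) (n : nat) (M : manifold R n)
    (s : symmetry_jet M) (xi : arrow M 1) (X Y Z : M -> Tk M 1) :
  B1 xi ->
  holonomic (S s xi) ->
  vector_field_near (src xi) X ->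
  vector_field_near (src xi) Y ->
  vector_field_near (src xi) Z ->
  let x := src xi in
  let XX : Tk M 3 := sstar X (star Y (Z x)) in
  is_Pi (act (SS s xi) XX) (act (kappa_arrow (SS s xi)) XX)
    (subT (act xi (nabla_torsion s (Z x) (Y x) (X x)))
          (nabla_torsion s (act xi (Z x)) (act xi (Y x)) (act xi (X x)))).
Proof.
move=> Bxi hol [pX sX] [pY sY] [pZ _] x XX.
have g0 := good_Tk M 0.
have [a [ax aS ->]] := exists_SS s Bxi.
have Xx : (X x).1 = x := pX x; have Yx : (Y x).1 = x := pY x.
have Zx : (Z x).1 = x := pZ x.
pose w : Tk M 2 := star Y (Z x).
have w1 : w.1 = Y x by rewrite /w /star /tmap Zx.
(* Y is a section, so the projection of Y_* Z to the tangent bundle along the differential of the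
   base projection is Z. *)
have w2 : w.2.1 = (Z x).2.
  have sYz : @smooth_at R (Tk M 0) (Tk M 1) Y (Z x).1 by rewrite Zx.
  have := @tmap_proj_section R (Tk M 0) Y (Z x) g0 pY sYz.
  by rewrite (tmap_proj (N := Tk M 0) w g0) => /(congr1 snd).
have sXw : @smooth_at R (Tk M 0) (Tk M 1) X w.1.1 by rewrite w1 Yx.
(* The same for X_**: four of the eight components of the element of T^3M are those of w, which
   supplies the coordinates V = Y and Z needed below. *)
have wE : ((XX.1.1.1, XX.1.2.1), (XX.2.1.1, XX.2.2.1)) = w.
  apply: (etrans (esym (tmap_tmap_proj (N := Tk M 0) XX g0))).
  exact: (@tmap_tmap_proj_section R (Tk M 0) X w g0 pX sXw).
have e1 : XX.1.1 = X x by rewrite -[LHS]/(X w.1.1) w1 Yx.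
have tx : base XX = x by rewrite -[LHS]/(XX.1.1.1) e1.
have eV : XX.1.2.1 = (Y x).2 by rewrite -w1 -wE.
have eZ : XX.2.1.1 = (Z x).2 by rewrite -w2 -wE.
pose i := @at_ R (Tk M 0) x; pose j := @at_ R (Tk M 0) (tgt xi).
have tE : @phi R (Tk M 2) i XX.1 =
    ((@phi R (Tk M 0) i x, (X x).2), ((Y x).2, XX.1.2.2)).
  have := phi2_at XX.1; rewrite (tx : XX.1.1.1 = x) e1 -eV => ->.
  by rewrite -surjective_pairing.
have t2 : XX.2 = (((Z x).2, XX.2.1.2), (XX.2.2.1, XX.2.2.2)).
  by rewrite -eZ -!surjective_pairing.
have := is_Pi_jet_S Bxi ax aS hol tx tE t2.
rewrite (diff_S_quad_antisym Bxi ax aS hol).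
have actE v : act xi (x, v) = (tgt xi, arrow_lin i j xi v).
  have [L [_ aE]] := act_B1 Bxi; rewrite aE; congr pair.
  by rewrite arrow_lin_at // aE.
have pE (v : Tk M 1) : v.1 = x -> act xi v = (tgt xi, arrow_lin i j xi v.2).
  by case: v => _ v /= ->; exact: actE.
rewrite (pE _ Xx) (pE _ Yx) (pE _ Zx).
rewrite (nabla_torsion_chart s Zx Yx Xx) actE.
by rewrite (nabla_torsion_chart s (x := tgt xi) (Z := (_, _)) (U := (_, _)) (V := (_, _))
  erefl erefl erefl).
Qed.
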